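(* Let $X$ be a complete separable metric space and $\mu$ a Radon measure on $X$. If $\mathcal A=(P,\nu)$ is a $C$-Lipschitz Alberti representation of $\mu$, then the formula $$\int_X g\,D_{\mathcal A}f\,d\mu=\int_{\operatorname{Frag}(X)}dP(\gamma)\int_{\operatorname{dom}\gamma}(f\circ\gamma)'(t)\,(g\circ\gamma)(t)\,d\big((\gamma^{-1})_\sharp\nu_\gamma\big)(t)=\int_{\operatorname{Frag}(X)}dP(\gamma)\int_X g\,\partial_\gamma f\,d\nu_\gamma$$ for $f\in\operatorname{Lip}_b(X)$ and all bounded Borel $g\in L^1(\mu)$, where $$\partial_\gamma f(x)=\begin{cases}(f\circ\gamma)'(\gamma^{-1}(x))&\text{if }x\in\operatorname{im}\gamma\text{ and the derivative exists}\\0&\text{otherwise,}\end{cases}$$ defines a derivation $D_{\mathcal A}\in\mathscr X(\mu)$ with $\|D_{\mathcal A}\|_{\mathscr X(\mu)}\le C$. Denoting, for a Radon measure $\mu'$, by $\operatorname{Alb}(\mu')$ the set of Alberti representations of $\mu'$ which are Lipschitz, and letting $\operatorname{Alb}_{\mathrm{sub}}(\mu)=\bigcup\{\operatorname{Alb}(\mu\llcorner S): S\subset X\text{ Borel}\}$, one obtains a map $\operatorname{Der}\colon\operatorname{Alb}_{\mathrm{sub}}(\mu)\to\mathscr X(\mu)$, $\mathcal A\mapsto D_{\mathcal A}$ (where $\mathscr X(\mu\llcorner S)$ is identified with $\chi_S\mathscr X(\mu)$).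
   Context: Derivations: $\operatorname{Lip}_b(X)$ is the algebra of bounded real Lipschitz functions with norm $\max(\|f\|_\infty,\mathbf L(f))$, $\mathbf L(f)$ being the global Lipschitz constant; it is a dual Banach space, and $f_n\to f$ weak* iff $f_n\to f$ pointwise and the $f_n$ are bounded in norm. A derivation is a bounded linear map $D\colon\operatorname{Lip}_b(X)\to L^\infty(\mu)$ with $D(fg)=fDg+gDf$ that is weak* continuous (if $f_n\to f$ weak* then $\int h\,Df_n\,d\mu\to\int h\,Df\,d\mu$ for all $h\in L^1(\mu)$). Derivations form an $L^\infty(\mu)$-module $\mathscr X(\mu)$ with the operator norm; an element of $\mathscr X(\mu\llcorner S)$, where $\mu\llcorner S$ is the restriction of $\mu$ to $S$, becomes an element of $\mathscr X(\mu)$ by extending $Df$ by $0$ off $S$; $\chi_S$ is the indicator function of $S$. Fragments: a fragment in $X$ is a bi-Lipschitz map $\gamma\colon K\to X$ with $K=\operatorname{dom}\gamma\subset\mathbb R$ compact of positive Lebesgue measure; $\operatorname{Frag}(X)$ is the set of fragments, topologized by identifying $\gamma$ with its graph in the space of nonempty compact subsets of $\mathbb R\times X$ with the topology induced by the Hausdorff distance. For $f$ Lipschitz, $(f\circ\gamma)'(t)$ is computed along $\operatorname{dom}\gamma$ (it exists for a.e. $t\in\operatorname{dom}\gamma$). Alberti representations: let $M(X)$ be the Banach space of finite (signed) Borel measures on $X$. An Alberti representation of a Radon measure $\mu$ is a pair $(P,\nu)$ where (1) $P$ is a Borel probability measure on $\operatorname{Frag}(X)$; (2) $\nu\colon\operatorname{Frag}(X)\to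 M(X)$, $\gamma\mapsto\nu_\gamma$, is Borel for the weak* topology on $M(X)$, that is, $\gamma\mapsto\int_X g\,d\nu_\gamma$ is Borel for each continuous compactly supported $g\colon X\to\mathbb R$, and $\nu_\gamma$ is absolutely continuous with respect to the 1-dimensional Hausdorff measure on the image of $\gamma$; (3) $\mu=\int_{\operatorname{Frag}(X)}\nu_\gamma\,dP(\gamma)$, that is, $\mu(A)=\int\nu_\gamma(A)\,dP(\gamma)$ for Borel $A$; (4) for all Borel $A\subset X$ and reals $a\le b$, the map $\gamma\mapsto\nu_\gamma(A\cap\gamma(\operatorname{dom}\gamma\cap[a,b]))$ is Borel. It is $C$-Lipschitz if $P$ gives full measure to the set of $C$-Lipschitz fragments, and Lipschitz if it is $C$-Lipschitz for some $C$. $(\gamma^{-1})_\sharp\nu_\gamma$ is the push-forward of $\nu_\gamma$ under $\gamma^{-1}\colon\operatorname{im}\gamma\to\operatorname{dom}\gamma$.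
   Formalization: The measures ν_γ of an Alberti representation are taken to be nonnegative finite Borel measures; with signed ν_γ the claim is false (μ=0 represented by Lebesgue measure on [0,1] along t and its negative along 1−t). *)

(* Defs.v *)
From HB Require Import structures.
From mathcomp Require Import all_boot all_order all_algebra.
From mathcomp Require Import all_classical all_reals all_analysis.
From mathcomp Require Import measurable_realfun.
From mathcomp Require Import lra.

Set Implicit Arguments.
Unset Strict Implicit.
Unset Printing Implicit Defensive.

Import Order.TTheory GRing.Theory Num.Theory.
Import numFieldNormedType.Exports.

Local Open Scope classical_set_scope.
Local Open Scope ring_scope.

(* Measurable and complete types of the library are pointed, hence so are the
   metric spaces considered here; there is nothing to prove on an empty space,
   which carries no fragment. *)
#[short(type="completeMetricType")]
HB.structure Definition CompleteMetric (K : numDomainType) :=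
  { T of Metric K T & Complete T }.

Definition separable (T : topologicalType) :=
  exists2 A : set T, countable A & dense A.

Notation borel X := (g_sigma_algebraType (@open X)).

Definition radon (R : realType) (X : completeMetricType R)
    (mu : set (borel X) -> \bar R) :=
  (forall x : X, exists2 U : set X, open_nbhs x U & (mu U < +oo)%E) /\
  (forall A : set (borel X), measurable A ->
     mu A = ereal_sup [set mu K | K in [set K : set X | compact K /\ K `<=` A]]).

Section lipb.
Context {R : realType} (X : metricType R).

Definition lip_with (L : R) (f : X -> R) :=
  forall x y, `|f x - f y| <= L * mdist x y.

Definition lipb : {pred X -> R} :=
  mem [set f | (exists M, forall x, `|f x| <= M) /\ (exists L, lip_with L f)].

Lemma lipbP (f : X -> R) : reflect
  (exists M : R, [/\ 0 <= M, forall x, `|f x| <= M & lip_with M f]) (f \in lipb).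
Proof.
apply/(iffP idP) => [/set_mem[[M Mf] [L Lf]]|[M [M0 Mf Lf]]]; last first.
  by apply/mem_set; split; exists M.
have ML : `|M| <= `|M| + `|L| by rewrite lerDl.
have LM : `|L| <= `|M| + `|L| by rewrite lerDr.
exists (`|M| + `|L|); split => [|x|x y]; first exact: addr_ge0.
  by rewrite (le_trans (Mf x))// (le_trans (ler_norm M)).
rewrite (le_trans (Lf x y))// ler_wpM2r ?mdist_ge0//.
by rewrite (le_trans (ler_norm L)).
Qed.

Lemma lipb_subring_closed : subring_closed lipb.
Proof.
split.
- apply/lipbP; exists 1; split => // [x|x y]; first by rewrite normr1.
  by rewrite subrr normr0 mul1r mdist_ge0.
- move=> f g /lipbP[M [M0 Mf Lf]] /lipbP[N [N0 Ng Lg]].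
  apply/lipbP; exists (M + N); split => [|x|x y]; first exact: addr_ge0.
    by rewrite (le_trans (ler_normB _ _))// lerD.
  rewrite [X in `|X|](_ : _ = (f x - f y) - (g x - g y)).
    by rewrite (le_trans (ler_normB _ _))// mulrDl lerD ?Lf ?Lg.
  by rewrite !fctE; lra.
- move=> f g /lipbP[M [M0 Mf Lf]] /lipbP[N [N0 Ng Lg]].
  apply/lipbP; exists (M * N + (M * N + N * M)); split => [|x|x y].
  + by rewrite !addr_ge0// mulr_ge0.
  + rewrite [`|_|]normrM (@le_trans _ _ (M * N))//; first exact: ler_pM.
    by rewrite lerDl addr_ge0// mulr_ge0.
  + rewrite [X in `|X|](_ : _ = f x * (g x - g y) + g y * (f x - f y)).
      rewrite (le_trans (ler_normD _ _))// mulrDl ler_wpDl//.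
        by rewrite mulr_ge0 ?mdist_ge0// mulr_ge0.
      rewrite !normrM; have := Lf x y; have := Lg x y => Lg' Lf'.
      by rewrite mulrDl -!mulrA lerD// ler_pM.
    by rewrite !fctE; lra.
Qed.

Lemma lipb_scaler_closed : scaler_closed lipb.
Proof.
move=> a f /lipbP[M [M0 Mf Lf]].
apply/lipbP; exists (`|a| * M); split => [|x|x y]; first exact: mulr_ge0.
  by rewrite fctE normrZ ler_wpM2l.
rewrite !fctE -scalerBr normrZ -mulrA ler_wpM2l//; exact: Lf.
Qed.

HB.instance Definition _ := GRing.isSubringClosed.Build _ lipb lipb_subring_closed.
HB.instance Definition _ := GRing.isScaleClosed.Build _ _ lipb lipb_scaler_closed.

Record LipB := MkLipB { LipB_fun :> X -> R ; LipB_mem : LipB_fun \in lipb }.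

HB.instance Definition _ := [isSub for LipB_fun].
HB.instance Definition _ := [Choice of LipB by <:].
HB.instance Definition _ :=
  GRing.SubChoice_isSubComPzRing.Build _ _ LipB lipb_subring_closed.
HB.instance Definition _ := [SubZmodule_isSubLmodule of LipB by <:].

Definition sup_norm (f : X -> R) : R := sup [set `|f x| | x in [set: X]].
Definition lip_const (f : X -> R) : R := inf [set L | 0 <= L /\ lip_with L f].
Definition lipb_norm (f : LipB) : R := Num.max (sup_norm f) (lip_const f).

(* A sequence converges weak* in the dual Banach space Lip_b(X) iff it converges
   pointwise and is bounded in norm. *)
Definition lipb_wcvg (F : nat -> LipB) (f : LipB) :=
  (forall x, F n x @[n --> \oo] --> f x) /\
  (exists M, forall n, lipb_norm (F n) <= M).

End lipb.

Section derivations.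
Context {R : realType} {X : completeMetricType R}.

Definition Linf (mu : {measure set (borel X) -> \bar R}) :=
  LspaceType mu (leey 1).

Definition Linf_norm (mu : {measure set (borel X) -> \bar R}) (u : Linf mu) :
  \bar R := 'N[mu]_+oo[EFin \o u]%E.

(* The module operations of L^oo(mu) are computed on representatives. *)
Record is_derivation (mu : {measure set (borel X) -> \bar R})
    (D : LipB X -> Linf mu) : Prop := IsDerivation {
  der_linear : forall (a : R) (f g : LipB X),
    {ae mu, forall x, D (a *: f + g) x = a * D f x + D g x} ;
  der_bounded : exists M : R, forall f : LipB X,
    (Linf_norm (D f) <= (M * lipb_norm f)%:E)%E ;
  der_leibniz : forall f g : LipB X,
    {ae mu, forall x, D (f * g) x = f x * D g x + g x * D f x} ;
  der_wcontinuous : forall (F : nat -> LipB X) (f : LipB X), lipb_wcvg F f ->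
    forall h : borel X -> R, mu.-integrable setT (EFin \o h) ->
    (\int[mu]_x (h x * D (F n) x)%:E)%E @[n --> \oo] -->
    (\int[mu]_x (h x * D f x)%:E)%E }.

Record derivation (mu : {measure set (borel X) -> \bar R}) := Derivation {
  der_fun :> LipB X -> Linf mu ;
  derP : is_derivation der_fun }.

Definition der_norm (mu : {measure set (borel X) -> \bar R})
    (D : derivation mu) : \bar R :=
  ereal_sup [set Linf_norm (D f) | f in [set f : LipB X | lipb_norm f <= 1]].

Definition zero_extension (mu : {measure set (borel X) -> \bar R})
    (S : set (borel X)) (mS : measurable S)
    (D : derivation (mrestr mu mS)) (E : derivation mu) :=
  forall f, {ae mu, forall x, E f x = \1_S x * D f x}.

End derivations.

Section fragments.
Context {R : realType} (X : metricType R).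

Record fragment := Fragment {
  fdom : set R ;
  fmap :> fdom -> X ;
  fdom_compact : compact fdom ;
  fdom_pos : (0 < @lebesgue_measure R fdom)%E ;
  fmap_bilip : exists c L : R, 0 < c /\ forall s t : fdom,
    c * `|\val s - \val t| <= mdist (fmap s) (fmap t) <=
      L * `|\val s - \val t| }.

HB.instance Definition _ := gen_eqMixin fragment.
HB.instance Definition _ := gen_choiceMixin fragment.

Definition frag_lip (C : R) (y : fragment) :=
  forall s t : fdom y, mdist (y s) (y t) <= C * `|\val s - \val t|.

Definition frag_im (y : fragment) : set X := range y.

Definition frag_im_itv (y : fragment) (a b : R) : set X :=
  [set y t | t in [set t : fdom y | a <= \val t <= b]].

Definition frag_graph (y : fragment) : set (R * X) :=
  range (fun t : fdom y => (\val t, y t)).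

Definition prod_dist (p q : R * X) : R :=
  Num.max `|p.1 - q.1| (mdist p.2 q.2).

Definition hausdorff_dist (A B : set (R * X)) : \bar R := Order.max
  (ereal_sup [set ereal_inf [set (prod_dist p q)%:E | q in B] | p in A])
  (ereal_sup [set ereal_inf [set (prod_dist p q)%:E | p in A] | q in B]).

Definition frag_open : set (set fragment) := [set U | forall y, U y ->
  exists2 e : R, 0 < e & forall z,
    (hausdorff_dist (frag_graph y) (frag_graph z) < e%:E)%E -> U z].

(* X may carry no fragment at all, so that [fragment] is only pointed under a
   nonemptiness assumption. *)
Definition pfragment (h : [set: fragment] !=set0) : Type := fragment.

HB.instance Definition _ h := Choice.on (pfragment h).
HB.instance Definition _ h := isPointed.Build (pfragment h) (projT1 (cid h)).

Definition bfragment (h : [set: fragment] !=set0) :=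
  g_sigma_algebraType (frag_open : set (set (pfragment h))).

HB.instance Definition _ h := Measurable.on (bfragment h).

(* [f \o y] extended by 0 off [fdom y]; the extension is never evaluated
   outside [fdom y] below. *)
Definition along (f : X -> R) (y : fragment) : R -> R := 'valL_0 (f \o y).

Definition frag_quotient (f : X -> R) (y : fragment) (t s : R) : R :=
  (along f y s - along f y t) / (s - t).

Definition frag_derivable (f : X -> R) (y : fragment) (t : R) :=
  [/\ fdom y t, limit_point (fdom y) t &
      cvg (frag_quotient f y t @ within (fdom y) t^')].

Definition frag_derive (f : X -> R) (y : fragment) (t : R) : R :=
  if `[< frag_derivable f y t >]
  then lim (frag_quotient f y t @ within (fdom y) t^') else 0.

Definition frag_inv (y : fragment) (x : X) : R :=
  xget 0 [set \val t | t in [set t : fdom y | y t = x]].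

Definition frag_partial (f : X -> R) (y : fragment) (x : X) : R :=
  if `[< frag_im y x /\ frag_derivable f y (frag_inv y x) >]
  then frag_derive f y (frag_inv y x) else 0.

Definition diam (E : set X) : \bar R :=
  Order.max 0%E (ereal_sup [set (mdist p.1 p.2)%:E | p in E `*` E]).

Definition hausdorff1_delta (d : R) (A : set X) : \bar R := ereal_inf
  [set (\sum_(i <oo) diam (E i))%E | E in [set E : nat -> set X |
     A `<=` \bigcup_i E i /\ forall i, (diam (E i) <= d%:E)%E]].

Definition hausdorff1 (A : set X) : \bar R :=
  ereal_sup [set hausdorff1_delta d A | d in [set d : R | 0 < d]].

End fragments.

Section alberti.
Context {R : realType} (X : completeMetricType R).

(* The measures [alb_nu y] are nonnegative: with signed measures that cancel
   each other in [int nu_y dP(y)], the function [D_A f] does not exist in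
   general (e.g. [mu = 0] represented by Lebesgue measure on the unit interval,
   run through in one direction, and by its opposite on the unit interval, run
   through in the other direction). *)
Record alberti_pair := AlbertiPair {
  alb_frag : [set: fragment X] !=set0 ;
  alb_P : probability (bfragment alb_frag) R ;
  alb_nu : fragment X -> {finite_measure set (borel X) -> \bar R} }.

Record is_alberti (mu : set (borel X) -> \bar R) (A : alberti_pair) : Prop :=
  IsAlberti {
  alb_weak_measurable : forall g : X -> R, continuous g ->
    compact (closure [set x | g x != 0]) ->
    measurable_fun [set: bfragment (alb_frag A)]
      (fun y => \int[alb_nu A y]_x (g x)%:E)%E ;
  alb_ac : forall y : fragment X,
    alb_nu A y `<< (fun E : set (borel X) => hausdorff1 (E `&` frag_im y)) ;
  alb_disintegration : forall E : set (borel X), measurable E ->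
    mu E = (\int[alb_P A]_y alb_nu A y E)%E ;
  alb_measurable : forall E : set (borel X), measurable E ->
    forall a b : R, a <= b ->
    measurable_fun [set: bfragment (alb_frag A)]
      (fun y => alb_nu A y (E `&` frag_im_itv y a b)) }.

Definition alberti_lip (C : R) (A : alberti_pair) :=
  alb_P A [set y | frag_lip C y] = 1%E.

Definition Alb (mu : set (borel X) -> \bar R) : set alberti_pair :=
  [set A | is_alberti mu A /\ exists C, alberti_lip C A].

Definition Alb_sub (mu : set (borel X) -> \bar R) : set alberti_pair :=
  [set A | exists (S : set (borel X)) (mS : measurable S), Alb (mrestr mu mS) A].

(* Push-forward of [alb_nu A y] under the inverse of [y]. The value of
   [frag_inv y] off the image of [y] is irrelevant, by [alb_ac]. *)
Definition alb_push (A : alberti_pair) (y : fragment X) :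
    set (measurableTypeR R) -> \bar R :=
  pushforward (alb_nu A y) (frag_inv y : borel X -> measurableTypeR R).

Definition dom_integral (A : alberti_pair) (f g : X -> R) (y : fragment X) :
    \bar R :=
  (\int[alb_push A y]_(t in fdom y) (frag_derive f y t * along g y t)%:E)%E.

Definition im_integral (A : alberti_pair) (f g : X -> R) (y : fragment X) :
    \bar R :=
  (\int[alb_nu A y]_x (g x * frag_partial f y x)%:E)%E.

(* The integrals of the formula are also required to converge: the integral of
   a function that is not integrable has a default value in the library. *)
Record alberti_formula (mu : {measure set (borel X) -> \bar R})
    (A : alberti_pair) (D : LipB X -> Linf mu) (f : LipB X) (g : borel X -> R) :
    Prop := AlbertiFormula {
  formula_integrable :
    mu.-integrable setT (fun x => (g x * D f x)%:E) ;
  formula_dom_integrable : forall y : fragment X,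
    (alb_push A y).-integrable (fdom y)
      (fun t => (frag_derive f y t * along g y t)%:E) ;
  formula_im_integrable : forall y : fragment X,
    (alb_nu A y).-integrable setT (fun x => (g x * frag_partial f y x)%:E) ;
  formula_outer_dom_integrable :
    (alb_P A).-integrable setT (dom_integral A f g) ;
  formula_outer_im_integrable :
    (alb_P A).-integrable setT (im_integral A f g) ;
  formula_dom :
    (\int[mu]_x (g x * D f x)%:E = \int[alb_P A]_y dom_integral A f g y)%E ;
  formula_im : (\int[alb_P A]_y dom_integral A f g y =
    \int[alb_P A]_y im_integral A f g y)%E }.

Definition alberti_der (mu : {measure set (borel X) -> \bar R})
    (A : alberti_pair) (D : LipB X -> Linf mu) :=
  forall (f : LipB X) (g : borel X -> R), measurable_fun setT g ->
    (exists M, forall x, `|g x| <= M) -> mu.-integrable setT (EFin \o g) ->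
  alberti_formula A D f g.

End alberti.

(* Main.v *)
Require Import Defs.
From HB Require Import structures.
From mathcomp Require Import all_boot all_order all_algebra.
From mathcomp Require Import all_classical all_reals all_analysis.
From mathcomp Require Import measurable_realfun.
From mathcomp Require Import ring lra.

(** For a fixed [f], integrating [g * frag_partial f y] against [nu_y] and then
    over [P] gives a linear functional of [g], and [D f] is its density with
    respect to [mu].

    Existence. A Radon measure on a separable space is sigma-finite
    ([radon_sigma_finite]). Put [K = lip_const f * C]. For [P]-almost every [y]
    one has [-K <= frag_partial f y <= K], so that
    [E |-> int_P int_E (frag_partial f y + K) dnu_y] is a measure which is at
    most [2 K mu]. It has a density [q] with values between [0] and [2 K]
    ([bounded_density]), and [D f = q - K] satisfies the formula for indicator
    functions, hence for all bounded integrable [g] ([alberti_density]); it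
    also satisfies [-K <= D f <= K], which gives the bound on the norm.

    The inner integrals must first be Borel functions of [y]
    ([frag_partial_integral_measurable]). Extend [f \o y] to the line by
    McShane's formula. The derivative along [y] is the limit of the difference
    quotients of this extension over the cells of finer and finer grids, so the
    inner integral is a limit of finite sums of products of two kinds of
    functions of [y]. The values of the extension at a fixed point are Borel
    in [y], because their strict sublevel sets are open for the Hausdorff
    distance ([mcshane_measurable]). The integrals over the piece of the image
    which is parametrized by a fixed interval are Borel because their
    measurability is part of the definition of an Alberti representation
    ([im_itv_integral_measurable]).

    On one fragment everything takes place on the line, because [nu_y] is
    carried by the image of [y] and does not charge the images of Lebesgue
    null sets ([nu_ae_im]). There the facts needed are that a Lipschitz function
    is almost everywhere differentiable and is the integral of its derivative
    ([lipschitz_ae_slope]), and that pointwise convergence of equi-Lipschitz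
    functions implies weak convergence of their derivatives ([lipschitz_weak]).

    Linearity and the Leibniz rule hold along each fragment almost everywhere.
    They pass to the densities because a density is determined by its integrals
    over the sets of finite measure ([sigma_finite_ae_eq]), which also gives
    uniqueness. For weak* continuity, the convergence on each fragment
    ([im_integral_wcvg]) is integrated by dominated convergence
    ([outer_wcvg]); this tests the densities against indicator functions, and
    [weak_test_indic] passes to all integrable functions.

    For the second part, a derivation of a restriction [mrestr mu mS] is
    extended by zero ([zero_extension_exists]). If the same pair represents the
    restrictions of [mu] to two sets, then the two extensions by zero have the
    same integrals over the sets of finite measure, so they agree
    ([zero_extension_transfer]) and the result does not depend on the set. *)

Set Implicit Arguments.
Unset Strict Implicit.
Unset Printing Implicit Defensive.

Import Order.TTheory GRing.Theory Num.Theory.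
Import numFieldNormedType.Exports.

Local Open Scope classical_set_scope.
Local Open Scope ring_scope.

(** * Integrals of bounded functions and restrictions of measures *)

Section integration.
Context d (T : measurableType d) (R : realType) (m : {measure set T -> \bar R}).

Lemma integral_indicM (E : set T) (u : T -> R) :
  (\int[m]_(x in E) (u x)%:E = \int[m]_x (\1_E x * u x)%:E)%E.
Proof.
rewrite integral_mkcond; apply: eq_integral => x _.
by rewrite patchE indicE; case: ifP => _; rewrite ?mul1r ?mul0r.
Qed.

Lemma integrable_ae_eq (u v : T -> \bar R) : measurable_fun setT v -> ae_eq m setT u v ->
  m.-integrable setT u -> m.-integrable setT v.
Proof.
move=> mv uv /integrableP[mu_ iu]; apply/integrableP; split => //.
rewrite (le_lt_trans _ iu)// le_eqVlt; apply/orP; left; apply/eqP.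
apply: ge0_ae_eq_integral => //; try exact: measurableT_comp.
apply: (@filterS _ _ (ae_filter_ringOfSetsType m) _ _ _ uv) => x h _.
by rewrite h.
Qed.

Lemma indic_le1 (E : set T) (x : T) : `|\1_E x : R| <= 1.
Proof. by rewrite indicE; case: (x \in E); rewrite ?normr1 ?normr0. Qed.

Lemma integral_one (E : set T) : measurable E -> (\int[m]_(x in E) 1%:E = m E)%E.
Proof. by move=> mE; have := integral_cst m mE 1%:E; rewrite mul1e. Qed.

Lemma indic_integrable (E : set T) : measurable E -> (m E < +oo)%E ->
  m.-integrable setT (EFin \o \1_E).
Proof.
move=> mE Efin; apply/integrableP; split; first exact/measurable_EFinP.
under eq_integral do rewrite /= ger0_norm//.
by rewrite integral_indic// setIT.
Qed.

Lemma integrableM_bounded (E : set T) (h v : T -> R) (M : R) : measurable E ->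
  m.-integrable E (EFin \o h) -> measurable_fun E v ->
  (forall x, E x -> `|v x| <= M) -> m.-integrable E (EFin \o (fun x => h x * v x)).
Proof.
move=> mE ih mv vM.
have := @integrableMl _ _ _ m _ mE _ v ih mv.
have -> : ((EFin \o h) \* (EFin \o v))%E = EFin \o (fun x => h x * v x).
  by apply/funext => x /=; rewrite EFinM.
apply; exists M; split; first exact: num_real.
by move=> N MN x Ex; apply: (le_trans (vM _ Ex)); exact: ltW.
Qed.

End integration.

Lemma bounded_integrable d (T : measurableType d) (R : realType)
    (m : {finite_measure set T -> \bar R}) (u : T -> R) (M : R) :
  measurable_fun setT u -> (forall x, `|u x| <= M) -> m.-integrable setT (EFin \o u).
Proof.
move=> mu uM; apply: measurable_bounded_integrable => //.
  by rewrite ltey_eq fin_num_measure.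
exists M; split; first exact: num_real.
by move=> N MN x _; apply: (le_trans (uM x)); exact: ltW.
Qed.

Section restriction.
Context d (T : measurableType d) (R : realType) (mu : {measure set T -> \bar R}).
Variables (S : set T) (mS : measurable S).
Notation muS := (mrestr mu mS).

Lemma sigma_finite_mrestr : sigma_finite setT mu -> sigma_finite setT muS.
Proof.
move=> [F FT mF]; exists F => // i; have [mFi Fi] := mF i; split => //.
by rewrite (le_lt_trans _ Fi)// /mrestr le_measure ?inE//; exact: measurableI.
Qed.

Lemma ae_mrestr (Q : T -> Prop) : {ae muS, forall x, Q x} ->
  {ae mu, forall x, S x -> Q x}.
Proof.
move=> [N [mN N0 QN]]; exists (N `&` S); split; first exact: measurableI.
  exact: N0.
by move=> x /= /not_implyP[Sx nQ]; split => //; exact: QN.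
Qed.

Lemma mrestr_integral (f : T -> \bar R) : measurable_fun setT f ->
  (\int[muS]_x f x = \int[mu]_(x in S) f x)%E.
Proof.
move=> mf; have -> : (\int[mu]_(x in S) f x = \int[muS]_(x in S) f x)%E.
  by apply: eq_measure_integral => B mB BS; rewrite /= /mrestr setIidl.
rewrite [RHS]integral_mkcond; apply: ae_eq_integral => //.
  by apply/(measurable_restrictT _ mS); exact: measurable_funTS.
exists (~` S); split; [exact: measurableC|by rewrite /= /mrestr setICl measure0|].
move=> x /= h Sx; apply: h => _; by rewrite patchE mem_set.
Qed.

Lemma mrestr_integrable (f : T -> \bar R) : measurable_fun setT f ->
  muS.-integrable setT f <-> mu.-integrable S f.
Proof.
move=> mf; have mnf : measurable_fun setT (fun x => `|f x|%E) by exact: measurableT_comp.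
split=> /integrableP[_ fi]; apply/integrableP; split.
- exact: measurable_funTS.
- by rewrite -mrestr_integral.
- exact: mf.
- by rewrite mrestr_integral.
Qed.

End restriction.

(** * Densities with respect to a sigma-finite measure *)

Section sigma_finite.
Context d (T : measurableType d) (R : realType) (mu : {measure set T -> \bar R}).
Hypothesis sf : sigma_finite setT mu.

Lemma sigma_finite_negligible (A : set T) :
  (forall E, measurable E -> (mu E < +oo)%E -> mu.-negligible (E `&` A)) ->
  mu.-negligible A.
Proof.
move=> h; have [F FT mF] := sf.
have -> : A = \bigcup_n (F n `&` A) by rewrite -setI_bigcupl -FT setTI.
by apply: negligible_bigcup => n; apply: h; have [] := mF n.
Qed.

(** On a set of finite measure, equality of the integrals over all measurable
    subsets forces equality almost everywhere; countably many such sets cover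
    the space. *)
Lemma sigma_finite_ae_eq (u v : T -> R) :
  measurable_fun setT u -> measurable_fun setT v ->
  (forall E, measurable E -> (mu E < +oo)%E ->
     mu.-integrable E (EFin \o u) /\
     (\int[mu]_(x in E) (u x)%:E = \int[mu]_(x in E) (v x)%:E)%E) ->
  {ae mu, forall x, u x = v x}.
Proof.
move=> mu_ mv_ h; apply: sigma_finite_negligible => E mE Efin.
have : ae_eq mu E (EFin \o u) (EFin \o v).
  apply: integral_ae_eq => //.
  - exact: (h E mE Efin).1.
  - exact/measurable_EFinP/measurable_funTS.
  move=> B BE mB.
  by apply: (h B mB _).2; apply: le_lt_trans Efin; rewrite le_measure ?inE.
apply: negligibleS => x [Ex ne] /= /(_ Ex) [] /ne; exact.
Qed.

(** On the part of [E] where [u] exceeds [c] the hypothesis forces [u] to have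
    the same integrals as the constant [c], hence to be equal to it. *)
Lemma ae_le_integral (u : T -> \bar R) (c : R) : 0 <= c -> measurable_fun setT u ->
  (forall x, 0 <= u x)%E ->
  (forall E, measurable E -> (mu E < +oo)%E ->
    (\int[mu]_(x in E) u x <= c%:E * mu E)%E) ->
  {ae mu, forall x, (u x <= c%:E)%E}.
Proof.
move=> c0 mu_ u0 h; apply: sigma_finite_negligible => E mE Efin.
pose A := E `&` [set x | (c%:E < u x)%E].
have mA : measurable A.
  by apply: measurable_lte => //; exact: measurable_funTS.
have cfin B : (mu B < +oo)%E -> (c%:E * mu B < +oo)%E.
  by move=> Bf; rewrite lte_mul_pinfty// lee_fin.
have finS B : measurable B -> B `<=` A -> (mu B < +oo)%E.
  move=> mB BA; apply: le_lt_trans Efin; rewrite le_measure ?inE//.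
  by move=> x /BA [].
have : ae_eq mu A u (cst c%:E).
  apply: integral_ae_eq => //.
  - apply/integrableP; split; first exact: measurable_funTS.
    under eq_integral do rewrite gee0_abs//.
    apply: (le_lt_trans (h _ mA (finS _ mA (@subset_refl _ _)))).
    exact: cfin (finS _ mA (@subset_refl _ _)).
  - move=> B BA mB; apply/eqP; rewrite eq_le; apply/andP; split.
      by rewrite integral_cst//; apply: h => //; exact: finS.
    apply: le_integral => //.
    + apply/integrableP; split => //.
      by rewrite integral_cst//= ger0_norm// cfin// finS.
    + apply/integrableP; split; first exact: measurable_funTS.
      under eq_integral do rewrite gee0_abs//.
      exact: (le_lt_trans (h _ mB (finS _ mB BA)) (cfin _ (finS _ mB BA))).
    + by move=> x /[!inE] /BA [_ /ltW].
apply: negligibleS => x [Ex /negP]; rewrite -ltNge => cu /= /(_ (conj Ex cu)) ux.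
by rewrite ux ltxx in cu.
Qed.

(** The measure [lam] may be infinite. It is cut into the finite pieces given by
    sigma-finiteness, and the Radon-Nikodym densities of the pieces are added up. The sum is at
    most [c] almost everywhere, so that truncating it at [c] gives a real-valued
    density which is bounded everywhere. *)
Lemma bounded_density (lam : {measure set T -> \bar R}) (c : R) :
  0 <= c ->
  (forall E, measurable E -> (lam E <= c%:E * mu E)%E) ->
  exists q : T -> R, [/\ measurable_fun setT q, forall x, 0 <= q x <= c &
    forall E, measurable E -> (lam E = \int[mu]_(x in E) (q x)%:E)%E].
Proof.
move=> c0 lamle; have [F TF /all_and2[mF muFoo]] := sf.
pose E := seqDU F.
have mE k : measurable (E k).
  by apply: measurableD => //; exact: bigsetU_measurable.
have muEoo k : (mu (E k) < +oo)%E.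
  by rewrite (le_lt_trans _ (muFoo k))// le_measure ?inE//; exact: subDsetl.
have UET : \bigcup_i E i = [set: T] by rewrite TF [RHS]seqDU_bigcup_eq.
have tE := trivIset_seqDU F.
have lamfin B : measurable B -> (mu B < +oo)%E -> (lam B < +oo)%E.
  move=> mB Bfin; apply: (le_lt_trans (lamle _ mB)).
  by rewrite lte_mul_pinfty// lee_fin.
pose mu' : {sigma_finite_measure set T -> \bar R} :=
  HB.pack_for (SigmaFiniteMeasure.type T R) (Measure.sort mu)
    (isSigmaFinite.Build _ _ _ _ sf)
    (isSFinite.Build _ _ _ _ (sfinite_measure_sigma_finite sf)).
pose lam_ j : {finite_measure set T -> \bar R} :=
  mfrestr (mE j) (lamfin _ (mE j) (muEoo j)).
have dom k : lam_ k `<< mu'.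
  apply/null_content_dominatesP => S mS mu0.
  have mu0' : mu (S `&` E k) = 0%E.
    apply/eqP; rewrite eq_le measure_ge0 andbT -[leRHS]mu0.
    by rewrite le_measure ?inE//; exact: measurableI.
  apply/eqP; rewrite eq_le measure_ge0 andbT.
  apply: (le_trans (lamle _ _)); first exact: measurableI.
  by rewrite mu0' mule0.
have [g /all_and4[g0 gfin gi gE]] :=
  choice (fun j => radon_nikodym_sigma_finite (dom j)).
have mg k : measurable_fun setT (g k) by exact: measurable_int (gi k).
pose u x : \bar R := (\sum_(k <oo) g k x)%E.
have mu_ : measurable_fun setT u by exact: ge0_emeasurable_sum.
have u0 x : (0 <= u x)%E by exact: nneseries_ge0.
have uE B : measurable B -> (lam B = \int[mu]_(x in B) u x)%E.
  move=> mB; rewrite integral_nneseries//; last by move=> n; exact: measurable_funTS.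
  under eq_eseriesr => k _ do rewrite -gE//.
  rewrite -{1}(setIT B) -UET setI_bigcupr measure_bigcup//.
  - by apply: eq_eseriesl => // x; rewrite in_setT.
  - by move=> i _; exact: measurableI.
  - exact: trivIset_setIl.
(* the bound on [lam] becomes a bound on its density *)
have uc : {ae mu, forall x, (u x <= c%:E)%E}.
  by apply: ae_le_integral => // B mB _; rewrite -uE// lamle.
pose q x := fine (mine (u x) c%:E).
have uq x : (u x <= c%:E)%E -> u x = (q x)%:E.
  rewrite /q => uxc; rewrite min_l// fineK//.
  by rewrite ge0_fin_numE// (le_lt_trans uxc)// ltry.
have mine_fin x : mine (u x) c%:E \is a fin_num.
  by rewrite ge0_fin_numE ?le_min ?u0 ?lee_fin// gt_min ltry orbT.
exists q; split.
- by apply/measurable_EFinP; rewrite (_ : EFin \o q = fun x => mine (u x) c%:E);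
    [exact: measurable_mine|apply/funext => x /=; rewrite fineK].
- move=> x; rewrite -!lee_fin fineK//.
  by rewrite le_min u0 lee_fin c0 ge_min lexx orbT.
- move=> B mB; rewrite uE//; apply: ae_eq_integral => //.
  + exact: measurable_funTS.
  + apply: measurable_funTS; rewrite (_ : (fun x => _) = fun x => mine (u x) c%:E);
      [exact: measurable_mine|by apply/funext => x /=; rewrite fineK].
  + by apply: filterS uc => x /uq.
Qed.

End sigma_finite.

(** * Disintegration formulas *)

Section disintegration.
Context d dY (T : measurableType d) (Y : measurableType dY) (R : realType).
Import HBNNSimple.

Lemma integral_nnsfunM (m : {measure set T -> \bar R}) (h : {nnsfun T >-> R})
    (r : T -> R) : measurable_fun setT r -> (forall x, 0 <= r x) ->
  (\int[m]_x (h x * r x)%:E =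
   \sum_(c \in range h) c%:E * \int[m]_(x in h @^-1` [set c]) (r x)%:E)%E.
Proof.
move=> mr r0.
transitivity (\int[m]_x (\sum_(c \in range h)
    ((c * \1_(h @^-1` [set c]) x)%:E * (r x)%:E)))%E.
  apply: eq_integral => x _; rewrite EFinM fimfunE -fsumEFin// ge0_mule_fsuml//.
  by move=> c; exact: nnfun_muleindic_ge0.
rewrite ge0_integral_fsum//; last 2 first.
  - move=> c; apply: emeasurable_funM; last exact/measurable_EFinP.
    by apply/measurable_EFinP; exact: measurable_funM.
  - by move=> c x _; rewrite mule_ge0 ?lee_fin// -lee_fin nnfun_muleindic_ge0.
apply: eq_fsbigr => c /[!inE] -[t _ <-].
under eq_integral do rewrite EFinM -muleA.
rewrite ge0_integralZl//; last 3 first.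
  - by apply: emeasurable_funM; exact/measurable_EFinP.
  - by move=> x _; rewrite mule_ge0 ?lee_fin.
  - by rewrite lee_fin.
congr (_ * _)%E; rewrite [RHS]integral_mkcond; apply: eq_integral => x _.
by rewrite epatch_indic/= muleC.
Qed.

(** Both sides are additive in [g] and commute with nondecreasing limits, so
    the formula for sets extends to simple functions and then to nonnegative
    functions. The measurability of the inner integral is carried along the same
    way. *)
Lemma ge0_disintegration (mu : {measure set T -> \bar R})
    (P : {measure set Y -> \bar R}) (nu : Y -> {measure set T -> \bar R})
    (q : T -> R) (rho : Y -> T -> R) :
  measurable_fun setT q -> (forall x, 0 <= q x) ->
  (forall y, measurable_fun setT (rho y)) -> (forall y x, 0 <= rho y x) ->
  (forall E, measurable E ->
    measurable_fun setT (fun y => (\int[nu y]_(x in E) (rho y x)%:E)%E)) ->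
  (forall E, measurable E -> (\int[mu]_(x in E) (q x)%:E =
    \int[P]_y \int[nu y]_(x in E) (rho y x)%:E)%E) ->
  forall g : T -> R, measurable_fun setT g -> (forall x, 0 <= g x) ->
  measurable_fun setT (fun y => (\int[nu y]_x (g x * rho y x)%:E)%E) /\
  (\int[mu]_x (g x * q x)%:E =
    \int[P]_y \int[nu y]_x (g x * rho y x)%:E)%E.
Proof.
move=> mq q0 mrho rho0 mK eqE g mg g0.
have mg' : measurable_fun setT (EFin \o g) by exact/measurable_EFinP.
pose h := nnsfun_approx measurableT mg'.
have hcvg (r : R) x : ((h n x * r)%:E @[n --> \oo] --> (g x * r)%:E)%E.
  rewrite EFinM; under eq_fun do rewrite EFinM.
  apply: cvgeZr => //.
  exact: (@cvg_nnsfun_approx _ _ _ _ measurableT _ mg' (fun t _ => g0 t) x I).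
have hnd x : {homo (fun n => h n x) : a b / (a <= b)%N >-> a <= b}.
  by move=> a b ab; exact/lefP/(nd_nnsfun_approx measurableT mg').
have hlim (m : {measure set T -> \bar R}) (r : T -> R) :
    measurable_fun setT r -> (forall x, 0 <= r x) ->
    (\int[m]_x (h n x * r x)%:E @[n --> \oo] --> \int[m]_x (g x * r x)%:E)%E.
  move=> mr r0.
  have -> : (\int[m]_x (g x * r x)%:E =
     \int[m]_x limn (fun n => (h n x * r x)%:E))%E.
    by apply: eq_integral => x _; apply/esym/cvg_lim => //; exact: hcvg.
  apply: cvg_monotone_convergence => //.
  - by move=> n; apply/measurable_EFinP; exact: measurable_funM.
  - by move=> n x _; rewrite lee_fin mulr_ge0.
  - by move=> x _ a b ab; rewrite lee_fin ler_wpM2r// hnd.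
have mh n : measurable_fun setT (fun y => (\int[nu y]_x (h n x * rho y x)%:E)%E).
  under eq_fun do rewrite integral_nnsfunM//.
  apply: emeasurable_fun_fsum => // c.
  by apply: emeasurable_funM => //; exact: mK.
have hE n : (\int[mu]_x (h n x * q x)%:E =
    \int[P]_y \int[nu y]_x (h n x * rho y x)%:E)%E.
  rewrite integral_nnsfunM//; under [RHS]eq_integral do rewrite integral_nnsfunM//.
  rewrite ge0_integral_fsum//; last 2 first.
  - by move=> c; apply: emeasurable_funM => //; exact: mK.
  - move=> c y _; have [c0|c0] := leP 0 c.
      by rewrite mule_ge0 ?lee_fin// integral_ge0// => x _; rewrite lee_fin.
    by rewrite preimage_nnfun0// integral_set0 mule0.
  apply: eq_fsbigr => c /[!inE] -[t _ <-]; rewrite eqE// ge0_integralZl//.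
  - exact: mK.
  - by move=> y _; rewrite integral_ge0// => x _; rewrite lee_fin.
  - by rewrite lee_fin.
have mg_ : measurable_fun setT (fun y => (\int[nu y]_x (g x * rho y x)%:E)%E).
  apply: (emeasurable_fun_cvg _ _ mh) => y _; exact: hlim.
split => //; have := hlim mu q mq q0; under eq_fun do rewrite hE.
move=> /cvg_lim <- //; apply/cvg_lim => //.
have -> : (\int[P]_y \int[nu y]_x (g x * rho y x)%:E =
    \int[P]_y limn (fun n => \int[nu y]_x (h n x * rho y x)%:E))%E.
  by apply: eq_integral => y _; apply/esym/cvg_lim => //; exact: hlim.
apply: cvg_monotone_convergence => //.
- by move=> n y _; rewrite integral_ge0// => x _; rewrite lee_fin mulr_ge0.
- move=> y _ a b ab; apply: ge0_le_integral => //.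
  + by move=> x _; rewrite lee_fin mulr_ge0.
  + by apply/measurable_EFinP; exact: measurable_funM.
  + by apply/measurable_EFinP; exact: measurable_funM.
  + by move=> x _; rewrite lee_fin ler_wpM2r// hnd.
Qed.

End disintegration.

(** * Weak convergence of bounded functions *)

Section weak_limit.
Context d (T : measurableType d) (R : realType) (m : {measure set T -> \bar R}).
Import HBSimple.

Variables (u_ : nat -> T -> R) (u : T -> R) (M : R).
Hypotheses (mu_ : forall n, measurable_fun setT (u_ n)) (mu : measurable_fun setT u)
  (u_M : forall n x, `|u_ n x| <= M) (uM : forall x, `|u x| <= M).

(** The integrability of [h] is part of the definition so that the closure
    properties below can be chained. *)
Definition weak_test (h : T -> R) :=
  m.-integrable setT (EFin \o h) /\
  (\int[m]_x (h x * u_ n x)) @[n --> \oo] --> \int[m]_x (h x * u x).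

Let M0 : 0 <= M := le_trans (normr_ge0 _) (uM point).

Let ihv (h v : T -> R) : m.-integrable setT (EFin \o h) -> measurable_fun setT v ->
  (forall x, `|v x| <= M) -> m.-integrable setT (EFin \o (fun x => h x * v x)).
Proof. by move=> ih mv vM; apply: (integrableM_bounded (M:=M)) => // x _. Qed.

Let diff_le (h k v : T -> R) : m.-integrable setT (EFin \o h) ->
  m.-integrable setT (EFin \o k) -> measurable_fun setT v ->
  (forall x, `|v x| <= M) ->
  `|\int[m]_x (h x * v x) - \int[m]_x (k x * v x)| <=
    M * \int[m]_x `|h x - k x|.
Proof.
move=> ih ik mv vM; rewrite -RintegralB//; try exact: ihv.
have ihk : m.-integrable setT (EFin \o (fun x => h x - k x)).
  rewrite (_ : _ \o _ = (EFin \o h) \- (EFin \o k))%E; first exact: integrableB.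
  by apply/funext => x /=; rewrite EFinB.
under eq_Rintegral do rewrite -mulrBl.
apply: (le_trans (le_normr_Rintegral _ _)) => //; first exact: ihv.
rewrite -RintegralZl//; last exact: integrable_norm.
apply: le_Rintegral => //.
- by apply: integrable_norm; exact: ihv.
- rewrite (_ : _ \o _ = (fun x => M%:E * (EFin \o (fun x => `|h x - k x|%R)) x))%E.
    by apply: integrableZl => //; exact: integrable_norm.
  by apply/funext => x /=.
- by move=> x _; rewrite normrM mulrC ler_wpM2r.
Qed.

(** Since all the functions [u_ n] and [u] are bounded by [M], replacing [h] by
    [h_ k] changes the integrals by at most [M] times the distance of [h] and
    [h_ k] in L^1, uniformly in [n]. *)
Lemma weak_test_closed (h : T -> R) (h_ : nat -> T -> R) :
  m.-integrable setT (EFin \o h) -> (forall k, weak_test (h_ k)) ->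
  (\int[m]_x `|h x - h_ k x|) @[k --> \oo] --> 0 -> weak_test h.
Proof.
move=> ih th hk0; split => //; apply/cvgrPdist_le => e e0.
pose e' := e / 3 / (M + 1).
have M1 : 0 < M + 1 by rewrite ltr_wpDl.
have e'0 : 0 < e' by rewrite !divr_gt0.
have [k hk] : exists k, \int[m]_x `|h x - h_ k x| <= e'.
  move/cvgrPdist_le : hk0 => /(_ _ e'0)[k _ /(_ k)] /(_ (leqnn k)).
  by rewrite sub0r normrN => kk; exists k; rewrite (le_trans (ler_norm _)).
have [ik] := th k => /cvgrPdist_le /(_ (e / 3)).
rewrite divr_gt0// => /(_ isT); apply: filterS => n hn.
have Me : M * \int[m]_x `|h x - h_ k x| <= e / 3.
  have -> : e / 3 = (M + 1) * e' by rewrite /e' mulrCA divff ?mulr1 ?gt_eqF.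
  by rewrite ler_pM ?lerDl// Rintegral_ge0.
have h1 := le_trans (diff_le ih ik mu uM) Me.
have h2 := le_trans (diff_le ih ik (mu_ n) (u_M n)) Me.
rewrite ler_norml in h1; rewrite ler_norml in h2; rewrite ler_norml in hn.
rewrite ler_norml; lra.
Qed.

Lemma weak_test0 : weak_test (fun=> 0).
Proof.
split; first exact: integrable0.
have E (v : T -> R) : \int[m]_x (0 * v x) = 0.
  by under eq_Rintegral do rewrite mul0r; rewrite /Rintegral integral0.
by under eq_fun do rewrite E; rewrite E; exact: cvg_cst.
Qed.

Lemma weak_testD h k : weak_test h -> weak_test k -> weak_test (fun x => h x + k x).
Proof.
move=> [ih th] [ik tk]; split.
  rewrite (_ : _ \o _ = (EFin \o h) \+ (EFin \o k))%E; first exact: integrableD.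
  by apply/funext => x /=; rewrite EFinD.
have E (v : T -> R) : measurable_fun setT v -> (forall x, `|v x| <= M) ->
    \int[m]_x ((h x + k x) * v x) = \int[m]_x (h x * v x) + \int[m]_x (k x * v x).
  move=> mv vM; under eq_Rintegral do rewrite mulrDl.
  by rewrite RintegralD//; exact: ihv.
under eq_fun do rewrite E//.
by rewrite E//; apply: cvgD.
Qed.

Lemma weak_testZ c h : weak_test h -> weak_test (fun x => c * h x).
Proof.
move=> [ih th]; split.
  rewrite (_ : _ \o _ = (fun x => c%:E * (EFin \o h) x))%E; first exact: integrableZl.
  by apply/funext => x /=; rewrite EFinM.
have E (v : T -> R) : measurable_fun setT v -> (forall x, `|v x| <= M) ->
    \int[m]_x (c * h x * v x) = c * \int[m]_x (h x * v x).
  move=> mv vM; under eq_Rintegral do rewrite -mulrA.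
  by rewrite RintegralZl//; exact: ihv.
under eq_fun do rewrite E//.
by rewrite E//; apply: cvgMl_tmp.
Qed.

(** The indicators of a nondecreasing sequence of sets converge in L^1 to that
    of the union when the latter has finite measure. *)
Lemma weak_test_nondecreasing (A_ : nat -> set T) :
  (forall k, measurable (A_ k)) -> {homo A_ : i j / (i <= j)%N >-> i `<=` j} ->
  (m (\bigcup_k A_ k) < +oo)%E -> (forall k, weak_test (\1_(A_ k))) ->
  weak_test (\1_(\bigcup_k A_ k)).
Proof.
move=> mA ndA Afin tA; set A := \bigcup_k A_ k.
have mAA : measurable A by exact: bigcup_measurable.
have Akfin k : (m (A_ k) < +oo)%E.
  by apply: le_lt_trans Afin; rewrite le_measure ?inE//; exact: bigcup_sup.
apply: (weak_test_closed (indic_integrable mAA Afin) tA).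
have -> : (fun k => \int[m]_x `|\1_A x - \1_(A_ k) x|) =
    (fun k => fine (m A) - fine (m (A_ k))).
  apply/funext => k.
  transitivity (\int[m]_x (\1_A x - \1_(A_ k) x)).
    apply: eq_Rintegral => x _; rewrite ger0_norm// subr_ge0 !indicE.
    case: (boolP (x \in A_ k)) => //; rewrite inE => Akx.
    by rewrite mem_set//; exists k.
  rewrite RintegralB//; try exact: indic_integrable.
  by rewrite /Rintegral !integral_indic// !setIT.
have : (m \o A_) k @[k --> \oo] --> m A.
  apply: nondecreasing_cvg_mu => // i j ij; exact/subsetPset/ndA.
have fA : m A \is a fin_num by rewrite ge0_fin_numE.
rewrite -(fineK fA) => /fine_cvgP[_ h].
rewrite -(subrr (fine (m A))); apply: cvgB => //; exact: cvg_cst.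
Qed.

Lemma weak_test_bigcup (F : nat -> set T) :
  (forall k, measurable (F k)) -> trivIset setT F ->
  (m (\bigcup_k F k) < +oo)%E -> (forall k, weak_test (\1_(F k))) ->
  weak_test (\1_(\bigcup_k F k)).
Proof.
move=> mF tF Ffin tests.
have E : \bigcup_k F k = \bigcup_k \big[setU/set0]_(i < k) F i.
  apply/seteqP; split => x [k _].
    by move=> Fx; exists k.+1 => //; rewrite big_ord_recr/=; right.
  by rewrite -bigcup_mkord => -[i /= ik Fx]; exists i.
rewrite E; apply: weak_test_nondecreasing.
- by move=> k; exact: bigsetU_measurable.
- by move=> i j ij; exact: subset_bigsetU.
- by rewrite -E.
elim=> [|k ih]; first by rewrite big_ord0 indic0; exact: weak_test0.
rewrite big_ord_recr/= (_ : \1_ _ =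
    (fun x => \1_(\big[setU/set0]_(i < k) F i) x + \1_(F k) x)).
  exact: weak_testD.
apply/funext => x; rewrite !indicE in_setU.
case: (boolP (x \in F k)) => Fkx; last by rewrite orbF addr0.
rewrite orbT memNset ?add0r// -bigcup_mkord => -[i /= ik Fix].
have : (F i `&` F k) !=set0 by exists x; split => //; exact: set_mem.
by move=> /tF => /(_ I I) ik'; rewrite ik' ltnn in ik.
Qed.

Lemma weak_test_sfun :
  (forall g : {sfun T >-> R}, m.-integrable setT (EFin \o g) -> weak_test g) ->
  forall h, m.-integrable setT (EFin \o h) -> weak_test h.
Proof.
move=> tg h ih.
have [g [ig _ /fine_cvgP[_ gl]]] := approximation_sfun_integrable measurableT ih.
by apply: (weak_test_closed ih (fun k => tg (g k) (ig k))).
Qed.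

(** Integrable simple functions are finite combinations of indicators of sets
    of finite measure and are dense in L^1. *)
Lemma weak_test_indic :
  (forall E, measurable E -> (m E < +oo)%E -> weak_test (\1_E)) ->
  forall h, m.-integrable setT (EFin \o h) -> weak_test h.
Proof.
move=> tE; apply: weak_test_sfun => g ig.
have -> : (g : T -> R) = (fun x => \sum_(c <- finmap.enum_fset (fset_set (range g)))
    c * \1_(g @^-1` [set c]) x).
  by apply/funext => x; rewrite fimfunE fsbig_finite.
elim: (finmap.enum_fset _) => [|c s ih].
  rewrite (_ : (fun _ => _) = (fun=> 0)); first exact: weak_test0.
  by apply/funext => x; rewrite big_nil.
under eq_fun do rewrite big_cons.
apply: weak_testD => //.
(* the level set of the value [0] may have infinite measure *)
have [->|c0] := eqVneq c 0.
  rewrite (_ : (fun _ => _) = (fun=> 0)); first exact: weak_test0.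
  by apply/funext => x; rewrite mul0r.
apply: weak_testZ; apply: tE => //.
have c0' : 0 < `|c| by rewrite normr_gt0.
have /integrableP[mgE gfin] := ig.
have := le_lt_trans (le_integral_abse m measurableT mgE c0') gfin.
rewrite setTI => h1.
have : (m (g @^-1` [set c]) <= m [set x | (`|c|%:E <= `|(EFin \o g) x|)%E])%E.
  apply: le_measure; rewrite ?inE//.
    rewrite -[X in measurable X]setTI; apply: measurable_lee => //.
    exact: measurableT_comp.
  by move=> x /= ->.
move=> /le_lt_trans; apply; move: h1.
case: (m _) => [r _|/=|//]; first exact: ltry.
by rewrite gt0_muley ?lte_fin.
Qed.

End weak_limit.

(** * Lipschitz functions of a real variable *)

Section lipschitz_real.
Context {R : realType}.
Notation leb := (@lebesgue_measure R).

(** Differentiability at [t] with derivative [c], in a form that is free of the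
    division by [s - t] and restricts to subsets at once. *)
Definition has_slope (F : R -> R) (t c : R) := forall e, 0 < e ->
  exists2 dl, 0 < dl & forall s, `|s - t| < dl ->
    `|F s - F t - c * (s - t)| <= e * `|s - t|.

Lemma derivable_slope (F : R -> R) t c :
  derivable F t 1 /\ derive1 F t = c -> has_slope F t c.
Proof.
move=> [dF]; rewrite derive1E => Fc e e0.
have : (fun h => h^-1 *: (F (h *: 1 + t) - F t)) @ 0^' --> c by rewrite -Fc; exact: dF.
move/cvgrPdist_le => /(_ _ e0); rewrite near_withinE => -[dl/= dl0 hdl].
exists dl => // s std; have [->|st] := eqVneq s t.
  by rewrite !subrr mulr0 subr0 normr0 mulr0.
have st0 : s - t != 0 by rewrite subr_eq0.
have := hdl (s - t); rewrite /= sub0r normrN => /(_ std st0).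
rewrite scaler1 subrK => hs.
rewrite -ler_pdivrMr ?normr_gt0// -normfV -normrM mulrBl mulfK//.
by rewrite distrC mulrC.
Qed.

Lemma measure_unique_ocitv (m1 m2 : {measure set (measurableTypeR R) -> \bar R}) :
  (forall a b, a <= b -> m1 `]a, b]%classic = m2 `]a, b]%classic) ->
  (forall a b, (m1 `]a, b]%classic < +oo)%E) ->
  forall A, measurable A -> m1 A = m2 A.
Proof.
move=> m12 m1fin A mA.
apply: (@measure_unique _ R (measurableTypeR R) (@ocitv R) (fun n : nat => `]-n%:R, n%:R]%classic)) => //.
- exact: ocitvI.
- by move=> i; exact: is_ocitv.
- by rewrite bigcup_itvT.
- move=> _ /ocitvP[->|[[a b] /= ab ->]]; first by rewrite !measure0.
  by rewrite m12// ltW.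
Qed.

Lemma lebesgue_itvoc (a b : R) : a <= b -> leb `]a, b]%classic = (b - a)%:E.
Proof.
rewrite le_eqVlt => /predU1P[->|ab]; rewrite lebesgue_measure_itv/= lte_fin.
  by rewrite ltxx subrr.
by rewrite ab EFinB.
Qed.

Variables (L : R).

Section cumul.
Variable (F : R -> R).
Hypothesis FL : forall s t, `|F s - F t| <= L * `|s - t|.

Lemma lipschitz_continuous : continuous F.
Proof.
move=> t; apply/cvgrPdist_lt => e e0.
have L0 : 0 <= L by have := le_trans (normr_ge0 _) (FL 1 0); rewrite subr0 normr1 mulr1.
near=> s; apply: (le_lt_trans (FL _ _)).
apply: (@le_lt_trans _ _ ((L + 1) * `|t - s|)).
  by rewrite ler_wpM2r// lerDl.
rewrite mulrC -ltr_pdivlMr ?ltr_wpDl//; near: s.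
apply: (@cvgr_dist_lt _ _ _ (nbhs t) _ id t) => //.
by rewrite divr_gt0// ltr_wpDl.
Unshelve. all: by end_near. Qed.

(** Adding [L * t] makes an [L]-Lipschitz function nondecreasing, hence the
    cumulative function of a Lebesgue-Stieltjes measure. *)
Definition shear (t : R) : R := F t + L * t.

Lemma shear_nondecreasing : nondecreasing shear.
Proof.
move=> s t st; rewrite /shear; have := FL s t.
rewrite (distrC s) (ger0_norm (_ : 0 <= t - s)) ?subr_ge0// ler_norml => /andP[_].
by lra.
Qed.

Lemma shear_right_continuous : right_continuous shear.
Proof.
apply: right_continuousW => t; apply: cvgD; first exact: lipschitz_continuous.
by apply: cvgMl_tmp; exact: cvg_id.
Qed.

HB.instance Definition _ := isCumulative.Build R _ R shear
  shear_nondecreasing shear_right_continuous.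

Definition shear_measure := lebesgue_stieltjes_measure shear.

End cumul.

Lemma shear_measure_itv (F : R -> R) (FL : forall s t, `|F s - F t| <= L * `|s - t|)
    a b : a <= b ->
  shear_measure FL `]a, b]%classic = (F b - F a + L * (b - a))%:E.
Proof.
move=> ab; rewrite /shear_measure /lebesgue_stieltjes_measure /measure_extension/=.
rewrite measurable_mu_extE/=; last exact: is_ocitv.
by rewrite wlength_itv_bnd// /shear; congr EFin; ring.
Qed.

(** The measures attached to [F] and to [- F] add up to [2 * L] times Lebesgue
    measure, so each of them is at most this multiple. *)
Lemma shear_measure_le (F : R -> R) (FL : forall s t, `|F s - F t| <= L * `|s - t|)
    (A : set (measurableTypeR R)) : measurable A ->
  (shear_measure FL A <= (2 * L)%:E * leb A)%E.
Proof.
move=> mA.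
have L0 : 0 <= L by have := le_trans (normr_ge0 _) (FL 1 0); rewrite subr0 normr1 mulr1.
have FNL s t : `|(- F) s - (- F) t| <= L * `|s - t|.
  by rewrite !fctE -opprD normrN FL.
have L20 : 0 <= 2 * L by rewrite mulr_ge0.
have E : measure_add (shear_measure FL) (shear_measure FNL) A =
    mscale (NngNum L20) leb A.
  apply: measure_unique_ocitv => // a b.
    move=> ab; transitivity (shear_measure FL `]a, b]%classic +
        shear_measure FNL `]a, b]%classic)%E; first exact: measure_addE.
    rewrite !shear_measure_itv// /= /mscale/=.
    rewrite lebesgue_measure_itv/= lte_fin.
    move: ab; rewrite le_eqVlt => /predU1P[->|ab].
      by rewrite ltxx !subrr mulr0 addr0 mule0 adde0.
    by rewrite ab -EFinD -EFinB -EFinM; congr EFin; rewrite !fctE; ring.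
  have [ab|ba] := leP a b; last by rewrite set_itv_ge ?measure0 ?ltry// bnd_simp -leNgt ltW.
  rewrite [X in (X < _)%E](_ : _ = shear_measure FL `]a, b]%classic +
    shear_measure FNL `]a, b]%classic)%E; last exact: measure_addE.
  by rewrite !shear_measure_itv// -EFinD ltry.
have := E; rewrite measure_addE /mscale/= => <-.
by rewrite leeDl.
Qed.

(** The density [q] of the measure attached to [F t + L * t] gives
    [h = q - L], whose integrals over intervals are the increments of [F]; the
    Lebesgue differentiation theorem then identifies [h] with the derivative
    almost everywhere. *)
Lemma lipschitz_ae_slope (F : R -> R) :
  (forall s t, `|F s - F t| <= L * `|s - t|) ->
  exists h : R -> R, [/\ measurable_fun [set: measurableTypeR R] h, forall t, `|h t| <= L,
    forall a b, a <= b -> \int[leb]_(t in `]a, b]) h t = F b - F a &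
    {ae leb, forall t, has_slope F t (h t)}].
Proof.
move=> FL.
have L0 : 0 <= L by have := le_trans (normr_ge0 _) (FL 1 0); rewrite subr0 normr1 mulr1.
have sf : sigma_finite setT leb by exact: sigma_finiteT.
have [q [mq q0 qE]] := bounded_density sf (mulr_ge0 (ler0n _ 2) L0)
  (shear_measure_le FL).
pose h t := q t - L.
have mh : measurable_fun setT h by exact: measurable_funB.
have hL t : `|h t| <= L.
  by have := q0 t; rewrite /h ler_norml => /andP[]; lra.
have fin_itv a b : (leb `]a, b]%classic < +oo)%E.
  by rewrite lebesgue_measure_itv/= ; case: ifP => _; rewrite ?ltry// -EFinB ltry.
have bint (v : R -> R) (M : R) (D : set R) : measurable D -> (leb D < +oo)%E ->
    measurable_fun setT v -> (forall t, `|v t| <= M) ->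
    leb.-integrable D (EFin \o v).
  move=> mD Dfin mv vM; apply: measurable_bounded_integrable => //.
    exact: measurable_funTS.
  exists M; split; first exact: num_real.
  by move=> N MN x Ex; apply: (le_trans (vM x)); exact: ltW.
have qL t : `|q t| <= 2 * L by rewrite ger0_norm; have /andP[] := q0 t.
have hE a b : a <= b -> \int[leb]_(t in `]a, b]) h t = F b - F a.
  move=> ab; rewrite /h RintegralB//; last 2 first.
    - exact: (bint q _ _ _ (fin_itv a b) mq qL).
    - by apply: (bint (cst L) L) => // t; rewrite ger0_norm.
  rewrite Rintegral_cst// [X in X - _](_ : _ = F b - F a + L * (b - a)); last first.
    rewrite /Rintegral -(qE `]a, b]%classic)//.
    exact: (congr1 fine (shear_measure_itv FL ab)).
  by rewrite [fine _](congr1 fine (lebesgue_itvoc ab))/= addrK.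
exists h; split => //.
have loch : locally_integrable setT h.
  split => //; first exact: openT.
  move=> K _ cK.
  apply: (@le_lt_trans _ _ (\int[leb]_(x in K) (cst L%:E x))%E).
    apply: ge0_le_integral => //.
    - exact: compact_measurable.
    - by apply/measurable_EFinP; apply: measurableT_comp => //; exact: measurable_funTS.
    - by move=> x _; rewrite lee_fin.
  rewrite integral_cst//=; last exact: compact_measurable.
  by rewrite lte_mul_pinfty ?lee_fin// compact_finite_measure.
(* the fundamental theorem of calculus is applied on half-lines *)
pose n_ (n : nat) : R := - n%:R.
have key (n : nat) : {ae leb, forall t, n_ n < t -> has_slope F t (h t)}.
  have := @FTC1 R h (BRight (n_ n)) (fun y => bint h L _ (measurable_itv _) (fin_itv _ y) mh hL) loch.
  apply: filterS; first exact: (ae_filter_ringOfSetsType leb).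
  move=> t /= ht nt.
  have [] := ht; first by rewrite lte_fin.
  move=> dG cG.
  have sl := derivable_slope (conj dG cG).
  move=> e e0; have [dl dl0 hdl] := sl e e0.
  exists (Num.min dl (t - n_ n)); first by rewrite lt_min dl0 subr_gt0.
  move=> s; rewrite lt_min => /andP[sdl sn].
  have ns : n_ n <= s.
    by have := ler_norm (t - s); rewrite distrC => h1; have := le_lt_trans h1 sn; lra.
  have := hdl s sdl; rewrite !hE//; last exact: ltW.
  by rewrite (_ : F s - F (n_ n) - (F t - F (n_ n)) = F s - F t)//; ring.
have : {ae leb, forall t, forall n, n_ n < t -> has_slope F t (h t)}.
  by apply/ae_foralln => n; exact: key.
apply: filterS; first exact: (ae_filter_ringOfSetsType leb).
move=> t /(_ (Num.trunc `|t|).+1); apply.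
rewrite /n_ ltrNl; apply: (le_lt_trans (ler_norm _)); rewrite normrN.
exact: truncnS_gt.
Qed.

(** Contrary to the quotients in the definition of [has_slope], these have both
    ends moving; this is allowed as long as the point [t] stays between them. *)
Lemma straddle (F : R -> R) t c : has_slope F t c ->
  forall e, 0 < e -> exists2 dl, 0 < dl & forall a b, a <= t <= b -> a < b ->
    b - a < dl -> `|(F b - F a) / (b - a) - c| <= e.
Proof.
move=> sl e e0; have [dl dl0 h] := sl e e0; exists dl => // a b /andP[at_ tb] ab abdl.
have ba0 : 0 < b - a by rewrite subr_gt0.
have -> : (F b - F a) / (b - a) - c = (F b - F a - c * (b - a)) / (b - a).
  by rewrite [RHS]mulrBl mulfK ?gt_eqF.
rewrite normrM normfV (gtr0_norm ba0) ler_pdivrMr//.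
have hb : `|b - t| = b - t by rewrite ger0_norm ?subr_ge0.
have ha : `|a - t| = t - a by rewrite distrC ger0_norm ?subr_ge0.
have := h b; rewrite hb => /(_ ltac:(lra)).
have := h a; rewrite ha => /(_ ltac:(lra)).
rewrite !ler_norml => /andP[h1 h2] /andP[h3 h4]; apply/andP; split; lra.
Qed.

End lipschitz_real.


Section lipschitz_weak.
Context {R : realType}.
Notation leb := (@lebesgue_measure R).
Variables (L : R) (F_ : nat -> R -> R) (F : R -> R) (h_ : nat -> R -> R) (h : R -> R).
Hypotheses (mh_ : forall n, measurable_fun [set: measurableTypeR R] (h_ n))
  (mh : measurable_fun [set: measurableTypeR R] h)
  (hL_ : forall n t, `|h_ n t| <= L) (hL : forall t, `|h t| <= L)
  (FE_ : forall n a b, a <= b -> \int[leb]_(t in `]a, b]) h_ n t = F_ n b - F_ n a)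
  (FE : forall a b, a <= b -> \int[leb]_(t in `]a, b]) h t = F b - F a)
  (F_F : forall t, F_ n t @[n --> \oo] --> F t).

Let test := @weak_test _ (measurableTypeR R) R leb h_ h.

Let leb_itv_fin a b : (leb `]a, b]%classic < +oo)%E.
Proof.
by rewrite lebesgue_measure_itv/= ; case: ifP => _; rewrite ?ltry// -EFinB ltry.
Qed.

Let test_itv a b : test (\1_(`]a, b]%classic)).
Proof.
split; first exact: integrable_indic_itv.
have E (v G : R -> R) :
    (forall a b, a <= b -> \int[leb]_(t in `]a, b]) v t = G b - G a) ->
    \int[leb]_x (\1_(`]a, b]%classic) x * v x) = if a <= b then G b - G a else 0.
  move=> vG; transitivity (\int[leb]_(x in `]a, b]) v x).
    rewrite [RHS]Rintegral_mkcond; apply: eq_Rintegral => x _.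
    by rewrite patchE indicE; case: ifP => _; rewrite ?mul1r ?mul0r.
  case: leP => [ab|ba]; first exact: vG.
  by rewrite set_itv_ge ?Rintegral_set0// bnd_simp -leNgt ltW.
rewrite (eq_cvg _ _ (fun n => E (h_ n) (F_ n) (FE_ n))) (E h F FE).
by case: leP => _; [exact: cvgB|exact: cvg_cst].
Qed.

(** Tested on an interval, the integrals are increments of [F_ n] and converge.
    The sets on which the convergence holds, inside a bounded window, form a
    Dynkin system; widening the window reaches all sets of finite measure, and
    these suffice. *)
Lemma lipschitz_weak (u : R -> R) : leb.-integrable setT (EFin \o u) ->
  (\int[leb]_x (u x * h_ n x)) @[n --> \oo] --> \int[leb]_x (u x * h x).
Proof.
move=> iu; suff [] : test u by [].
apply: (weak_test_indic mh_ mh hL_ hL _ iu) => E mE Efin.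
pose W (n : nat) : set R := `]- n%:R, n%:R]%classic.
have mW n : measurable (W n : set (measurableTypeR R)) by exact: measurable_itv.
have key n : forall S : set (measurableTypeR R), measurable S -> test (\1_(S `&` W n)).
  apply: (@dynkin_induction _ (measurableTypeR R) (@ocitv R)) => //.
  - exact: ocitvI.
  - by rewrite setTI; exact: test_itv.
  - move=> _ /ocitvP[->|[[a b] /= ab ->]].
      by rewrite set0I -(@set_itvoc0 _ _ 0); exact: test_itv.
    rewrite (_ : _ `&` _ = `]Num.max a (- n%:R), Num.min b n%:R]%classic).
      exact: test_itv.
    apply/seteqP; split => x; rewrite /W/= !in_itv/= gt_max le_min.
      by move=> [/andP[-> ->] /andP[-> ->]].
    by move=> /andP[/andP[-> ->] /andP[-> ->]].
  - move=> S mS tS.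
    rewrite (_ : \1_ _ = (fun x => \1_(W n) x + -1 * \1_(S `&` W n) x)).
      by apply: weak_testD => //; [exact: test_itv|exact: weak_testZ].
    apply/funext => x; rewrite !indicE !in_setI in_setC.
    by case: (x \in S); case: (x \in W n) => /=; rewrite ?mulr0 ?addr0// mulN1r subrr.
  - move=> A mA tA hA; rewrite setI_bigcupl; apply: weak_test_bigcup => //.
    + by move=> k; exact: measurableI.
    + exact: trivIset_setIr.
    + apply: le_lt_trans (leb_itv_fin (- n%:R) n%:R); rewrite le_measure ?inE//.
        by apply: bigcup_measurable => k _; exact: measurableI.
      by move=> x [k _ []].
have EE : E = \bigcup_n (E `&` W n).
  by rewrite -setI_bigcupr bigcup_itvT setIT.
rewrite EE; apply: weak_test_nondecreasing => //.
- by move=> k; exact: measurableI.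
- move=> i j ij x [Ex]; split => //; move: b; rewrite /W/= !in_itv/= => /andP[h1 h2].
  have : (i%:R : R) <= j%:R by rewrite ler_nat.
  by move=> ?; apply/andP; split; lra.
- by rewrite -EE.
- by move=> k; exact: key.
Qed.

End lipschitz_weak.

(** * The McShane extension *)

Section mcshane.
Context {R : realType} (K : set R) (phi : R -> R) (L M : R).
Hypotheses (K0 : K !=set0) (phiM : forall s, K s -> `|phi s| <= M) (L0 : 0 <= L).

(** The largest extension of an [L]-Lipschitz function on [K] to an [L]-Lipschitz
    function on the line. This formula is used, rather than some extension,
    because it depends on [K] and [phi] in a measurable way. *)
Definition mcshane (t : R) : R := inf [set phi s + L * `|t - s| | s in K].

Let has_lb t : has_lbound [set phi s + L * `|t - s| | s in K].
Proof.
exists (- M) => _ [s Ks <-]; have := phiM Ks; rewrite ler_norml => /andP[h _].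
by rewrite -[- M]addr0 lerD// mulr_ge0.
Qed.

Lemma mcshane_le t s : K s -> mcshane t <= phi s + L * `|t - s|.
Proof. by move=> Ks; apply: ge_inf => //; exists s. Qed.

Lemma le_mcshane t c : (forall s, K s -> c <= phi s + L * `|t - s|) -> c <= mcshane t.
Proof.
move=> h; apply: lb_le_inf; first by case: K0 => s Ks; exists (phi s + L * `|t - s|), s.
by move=> _ [s Ks <-]; exact: h.
Qed.

(** An infimum is below [c] as soon as one of its terms is: this existential
    form makes the strict sublevel sets open in all the data. *)
Lemma mcshane_lt t c : mcshane t < c <-> exists2 s, K s & phi s + L * `|t - s| < c.
Proof.
split=> [|[s Ks]]; last exact/le_lt_trans/mcshane_le.
move=> /inf_lt [|_ [s Ks <-] sc]; last by exists s.
by case: K0 => s Ks; exists (phi s + L * `|t - s|), s.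
Qed.

Lemma mcshane_lipschitz s t : `|mcshane s - mcshane t| <= L * `|s - t|.
Proof.
have half a b : mcshane a <= mcshane b + L * `|a - b|.
  rewrite -lerBlDr; apply: le_mcshane => r Kr; rewrite lerBlDr.
  apply: (le_trans (mcshane_le a Kr)).
  rewrite -addrA -mulrDr lerD2l ler_wpM2l//.
  by rewrite (_ : a - r = (b - r) + (a - b)) ?ler_normD//; ring.
rewrite ler_norml; apply/andP; split.
  by have := half t s; rewrite distrC; lra.
by have := half s t; lra.
Qed.

Lemma mcshane_ext t : (forall s t, K s -> K t -> `|phi s - phi t| <= L * `|s - t|) ->
  K t -> mcshane t = phi t.
Proof.
move=> phiL Kt; apply/eqP; rewrite eq_le; apply/andP; split.
  by rewrite (le_trans (mcshane_le t Kt))// subrr normr0 mulr0 addr0.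
apply: le_mcshane => s Ks.
by have := phiL _ _ Kt Ks; rewrite ler_norml => /andP[_]; lra.
Qed.

End mcshane.

Lemma mcshane_close {R : realType} (K : set R) (phi psi : R -> R) (L M e : R) t :
  K !=set0 -> (forall s, K s -> `|phi s| <= M) -> (forall s, K s -> `|psi s| <= M) ->
  0 <= L -> (forall s, K s -> `|phi s - psi s| <= e) ->
  `|mcshane K phi L t - mcshane K psi L t| <= e.
Proof.
move=> K0 phiM psiM L0 h.
have half (f g : R -> R) : (forall s, K s -> `|f s| <= M) ->
    (forall s, K s -> `|g s| <= M) -> (forall s, K s -> `|f s - g s| <= e) ->
    mcshane K f L t <= mcshane K g L t + e.
  move=> fM gM fg; rewrite -lerBlDr; apply: (le_mcshane K0) => s Ks; rewrite lerBlDr.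
  apply: (le_trans (mcshane_le fM L0 t Ks)).
  by have := fg _ Ks; rewrite ler_norml => /andP[_]; lra.
rewrite ler_norml; apply/andP; split.
  have h' s : K s -> `|psi s - phi s| <= e by rewrite distrC; exact: h.
  by have := half psi phi psiM phiM h'; lra.
by have := half phi psi phiM psiM h; lra.
Qed.

(** The distance to [K] is Lipschitz, hence differentiable almost everywhere.
    At an isolated point of [K] it has a corner, being equal to [|s - t|] nearby. *)
Lemma ae_limit_point {R : realType} (K : set R) : K !=set0 ->
  {ae @lebesgue_measure R, forall t, K t -> limit_point K t}.
Proof.
move=> K0; pose dK := mcshane K (cst 0) 1.
have cst0 (s : R) : K s -> `|cst 0 s : R| <= 0 by rewrite normr0.
have dKL := mcshane_lipschitz K0 cst0 (@ler01 R).
have [h [_ _ _]] := lipschitz_ae_slope dKL.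
apply: filterS; first exact: (ae_filter_ringOfSetsType (@lebesgue_measure R)).
move=> t sl Kt; apply: contrapT => nl.
have [U nU KU] : exists2 U, nbhs t U & K `&` U `<=` [set t].
  by move: nl; rewrite not_limit_pointE.
move: nU => /nbhs_ballP[r/= r0 rU].
have [dl dl0 hdl] := sl (1 / 2) ltac:(lra).
pose e := Num.min (r / 3) (dl / 2).
have e0 : 0 < e by rewrite lt_min; apply/andP; split; lra.
have er : e <= r / 3 by rewrite ge_min lexx.
have edl : e <= dl / 2 by rewrite ge_min lexx orbT.
have dKt : dK t = 0 by rewrite /dK (mcshane_ext K0 cst0)// => s u _ _; rewrite subrr normr0 mul1r.
(* within the isolation radius, [t] is the nearest point of [K] *)
have far s : `|s - t| = e -> dK s = e.
  move=> st; apply/eqP; rewrite eq_le; apply/andP; split.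
    by have := mcshane_le cst0 (@ler01 R) s Kt; rewrite st add0r mul1r.
  apply: (le_mcshane K0) => u Ku; rewrite add0r mul1r.
  have [ur|ur] := ltP `|t - u| r.
    have -> : u = t by apply: (KU u); split => //; apply: rU.
    by rewrite st.
  have := ler_normD (t - s) (s - u).
  by rewrite addrA subrK (distrC t s) st => h1; have := le_trans ur h1; lra.
have := hdl (t + e); have := hdl (t - e).
have E1 : t + e - t = e by ring.
have E2 : t - e - t = - e by ring.
rewrite E1 E2 normrN (gtr0_norm e0).
move=> /(_ ltac:(lra)) h1 /(_ ltac:(lra)); move: h1.
have F1 : dK (t - e) = e by apply: far; rewrite E2 normrN gtr0_norm.
have F2 : dK (t + e) = e by apply: far; rewrite E1 gtr0_norm.
rewrite -/dK dKt F1 F2 !ler_norml => /andP[h1 h2] /andP[h3 h4].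
by have : e <= 0; [lra|rewrite leNgt e0].
Qed.

(** * Fragments as curves defined on compact sets of reals *)

Section fragment_basics.
Context {R : realType} {X : completeMetricType R}.
Implicit Types (y : fragment X) (f : X -> R).

(** Total version of the map of a fragment, so that points of the domain can be
    handled as real numbers; its values off [fdom y] are never used. *)
Definition fcurve y : R -> X := 'valL_point y.

Lemma valL_val (T : Type) (U : Type) (v : U) (A : set T) (f : A -> U) (s : A) :
  'valL_v f (\val s) = f s.
Proof. exact: (congr1 (fun g : (A -> U) -> A -> U => g f s) (sigL_valL v)). Qed.

Lemma fcurve_val y (s : fdom y) : fcurve y (\val s) = y s.
Proof. exact: valL_val. Qed.

Lemma fdomP y t : fdom y t -> exists2 s : fdom y, \val s = t & y s = fcurve y t.
Proof.
by move=> yt; exists (SigSub (mem_set yt)) => //; rewrite -fcurve_val.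
Qed.

Lemma alongE f y t : fdom y t -> along f y t = f (fcurve y t).
Proof. by move=> /fdomP[s <- ys]; rewrite /along valL_val /= ys. Qed.

Lemma along_off f y t : ~ fdom y t -> along f y t = 0.
Proof.
by move=> nt; rewrite /along /= oinv_set_val insubN//; apply/negP => /set_mem.
Qed.

Lemma fcurve_bilip y : exists c L : R, [/\ 0 < c, 0 <= L &
  forall s t, fdom y s -> fdom y t ->
    c * `|s - t| <= mdist (fcurve y s) (fcurve y t) <= L * `|s - t|].
Proof.
have [c [L [c0 cL]]] := fmap_bilip y.
exists c, (Num.max L 0); split => //; first by rewrite le_max lexx orbT.
move=> s t /fdomP[s' <- <-] /fdomP[t' <- <-].
have /andP[-> h] := cL s' t'; rewrite (le_trans h)// ler_wpM2r// le_max lexx//.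
Qed.

Lemma frag_lipP C y : frag_lip C y <-> forall s t, fdom y s -> fdom y t ->
  mdist (fcurve y s) (fcurve y t) <= C * `|s - t|.
Proof.
split=> [h s t /fdomP[s' <- <-] /fdomP[t' <- <-]//|h s t].
by rewrite -!fcurve_val; apply: h; exact: set_valP.
Qed.

Lemma fdom_neq0 y : fdom y !=set0.
Proof.
apply/set0P/eqP => y0; have := fdom_pos y.
by rewrite y0 measure0 ltxx.
Qed.

Lemma fdom_measurable y : measurable (fdom y : set (measurableTypeR R)).
Proof. exact (@compact_measurable R (fdom y) (@fdom_compact R X y)). Qed.

Lemma fcurve_inj y s t : fdom y s -> fdom y t -> fcurve y s = fcurve y t -> s = t.
Proof.
move=> ys yt st; have [c [L [c0 _ h]]] := fcurve_bilip y.
have /andP[+ _] := h _ _ ys yt; rewrite st mdistxx => h1.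
apply/eqP; rewrite -subr_eq0 -normr_le0; rewrite pmulr_rle0// in h1.
Qed.

Lemma frag_imE y : frag_im y = fcurve y @` fdom y.
Proof.
apply/seteqP; split => [x [s _ <-]|x [t yt <-]].
  by exists (\val s); [exact: set_valP|exact: fcurve_val].
by have [s _ <-] := fdomP yt; exists s.
Qed.

Lemma frag_im_itvE y a b : frag_im_itv y a b = fcurve y @` (fdom y `&` `[a, b]%classic).
Proof.
apply/seteqP; split => [x [s /= sab <-]|x [t [yt]] /=].
  exists (\val s); last exact: fcurve_val.
  by split; [exact: set_valP|rewrite /= in_itv/=].
by rewrite in_itv/= => tab <-; have [s st <-] := fdomP yt; exists s => //=; rewrite st.
Qed.

Lemma frag_invK y t : fdom y t -> frag_inv y (fcurve y t) = t.
Proof.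
move=> yt; rewrite /frag_inv; case: xgetP => [s -> [s' /= ys' <-]|].
  by apply: (@fcurve_inj y) => //; [exact: set_valP|rewrite fcurve_val].
by move=> /(_ t); case; have [s st ys] := fdomP yt; exists s.
Qed.

Lemma frag_inv_off y x : ~ frag_im y x -> frag_inv y x = 0.
Proof.
move=> nx; rewrite /frag_inv; case: xgetP => [s _ [s' /= ys' _]|//].
by exfalso; apply: nx; exists s'.
Qed.

Lemma frag_im_inv y x : frag_im y x -> fdom y (frag_inv y x) /\ fcurve y (frag_inv y x) = x.
Proof. by rewrite frag_imE => -[t yt <-]; rewrite frag_invK. Qed.

Lemma fcurve_continuous y : {within fdom y, continuous (fcurve y)}.
Proof.
apply/subspace_continuousP => t yt.
have [c [L [c0 L0 h]]] := fcurve_bilip y.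
apply/metricType_numDomainType.cvgrPdist_lt => e e0.
near=> s; have ys : fdom y s by near: s; exact: withinT.
have /andP[_ h1] := h _ _ yt ys; apply: (le_lt_trans h1).
apply: (@le_lt_trans _ _ ((L + 1) * `|t - s|)); first by rewrite ler_wpM2r// lerDl.
rewrite mulrC -ltr_pdivlMr ?ltr_wpDl//; near: s.
apply: cvg_within; apply: (@cvgr_dist_lt _ _ _ (nbhs t) _ id t) => //.
by rewrite divr_gt0// ltr_wpDl.
Unshelve. all: by end_near. Qed.

Lemma fcurve_image_closed y (A : set R) : closed A ->
  closed (fcurve y @` (fdom y `&` A)).
Proof.
move=> cA; apply: compact_closed; first exact: metric_hausdorff.
apply: continuous_compact.
  apply: continuous_subspaceW (fcurve_continuous (y := y)); exact: subIsetl.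
by apply: compact_closedI => //; exact: fdom_compact.
Qed.

Lemma closed_borel (A : set X) : closed A -> measurable (A : set (borel X)).
Proof.
move=> cA; rewrite -[A]setCK; apply: measurableC; apply: sub_sigma_algebra.
exact: closed_openC.
Qed.

Lemma frag_im_itv_measurable y a b : measurable (frag_im_itv y a b : set (borel X)).
Proof.
by apply: closed_borel; rewrite frag_im_itvE; apply: fcurve_image_closed; exact: interval_closed.
Qed.

Lemma frag_im_measurable y : measurable (frag_im y : set (borel X)).
Proof.
apply: closed_borel; rewrite frag_imE -(setIT (fdom y)).
exact: fcurve_image_closed closedT.
Qed.

(** The inverse of a homeomorphism between compact sets: preimages of closed
    half-lines are images of compact sets, up to the default value [0] which
    [frag_inv] takes off the image. *)
Lemma frag_inv_measurable y :
  measurable_fun [set: borel X] (frag_inv y : borel X -> measurableTypeR R).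
Proof.
apply: (measurability (@RGenCInfty.G R)); first exact: RGenCInfty.measurableE.
move=> _ [_ [a ->] <-]; rewrite setTI.
have -> : frag_inv y @^-1` `[a, +oo[ = (fcurve y @` (fdom y `&` `[a, +oo[)) `|`
    ((if a <= 0 then setT else set0) `\` frag_im y).
  apply/seteqP; split => [x /= ax|x [[t [yt /= at_] <-]|[]]].
  - have [ix|nx] := pselect (frag_im y x).
      by left; have [h1 h2] := frag_im_inv ix; exists (frag_inv y x).
    right; split => //; move: ax; rewrite frag_inv_off// in_itv/= andbT => ->//.
  - by rewrite frag_invK.
  - case: ifPn => //= a0 _ nx; rewrite frag_inv_off//.
    by rewrite in_itv/= a0.
apply: measurableU.
  by apply: closed_borel; apply: fcurve_image_closed; exact: interval_closed.
apply: measurableD; last exact: frag_im_measurable.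
by case: ifP => _.
Qed.

(** The complement of a preimage of an open set is, inside [fdom y], the
    preimage of a closed set, which is compact. *)
Lemma fcurve_measurable y :
  measurable_fun (fdom y : set (measurableTypeR R)) (fcurve y : measurableTypeR R -> borel X).
Proof.
apply: (@measurability _ _ _ (borel X) _ _ (@open X)) => //.
move=> _ [U oU <-].
have : measurable (fdom y `\` fdom y `&` (fcurve y @^-1` (~` U)) : set (measurableTypeR R)).
  apply: measurableD; first exact: fdom_measurable.
  apply: compact_measurable.
  have /continuous_closedP/(_ (~` U)) := @fcurve_continuous y.
  move=> /(_ (open_closedC oU)) /closed_subspaceP => -[V cV VE].
  have -> : fdom y `&` fcurve y @^-1` (~` U) = fdom y `&` V.
    by rewrite setIC -VE setIC.
  by apply: compact_closedI => //; exact: fdom_compact.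
congr (measurable _); apply/seteqP; split => t /=.
  by move=> [yt /not_andP[//|/contrapT]].
by move=> [yt Ut]; split => // -[_].
Qed.

Lemma fcurve_lipschitz_along f y Lf L : lip_with Lf f -> 0 <= Lf ->
  (forall s t, fdom y s -> fdom y t ->
    mdist (fcurve y s) (fcurve y t) <= L * `|s - t|) ->
  forall s t, fdom y s -> fdom y t ->
    `|along f y s - along f y t| <= Lf * L * `|s - t|.
Proof.
move=> fL Lf0 h s t ys yt; rewrite !alongE//.
by rewrite (le_trans (fL _ _))// -mulrA ler_wpM2l// h.
Qed.

End fragment_basics.

(** * Derivative of a Lipschitz function along a fragment *)

Section fragment_derivative.
Context {R : realType} {X : completeMetricType R}.
Variables (f : X -> R) (y : fragment X) (L : R).
Notation K := (fdom y).
Notation leb := (@lebesgue_measure R).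
Hypothesis fyL : forall s t, K s -> K t ->
  `|along f y s - along f y t| <= L * `|s - t|.

Lemma along_bounded : exists M, forall s, K s -> `|along f y s| <= M.
Proof.
have [t0 Kt0] := fdom_neq0 y.
have cK : compact K := @fdom_compact R X y.
have [B [_ hB]] := compact_bounded cK.
exists (`|along f y t0| + `|L| * (B + 1 + `|t0|)) => s Ks.
have h1 : `|s| <= B + 1 by apply: hB => //; rewrite ltrDl.
rewrite -[along f y s](subrK (along f y t0)) (le_trans (ler_normD _ _))// addrC lerD2l.
rewrite (le_trans (fyL Ks Kt0))// (@le_trans _ _ (`|L| * `|s - t0|))//.
  by rewrite ler_wpM2r// ler_norm.
by rewrite ler_wpM2l// (le_trans (ler_normB _ _))// lerD2r.
Qed.

Lemma frag_quotient_le t s : K s -> K t -> s != t -> `|frag_quotient f y t s| <= L.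
Proof.
move=> Ks Kt st; rewrite /frag_quotient normrM normfV ler_pdivrMr ?fyL//.
by rewrite normr_gt0 subr_eq0.
Qed.

Lemma limit_point_proper t : limit_point K t -> ProperFilter (within K t^').
Proof.
move=> lt_; apply: Build_ProperFilter_ex => P.
rewrite /within/= => /nbhs_ballP[e/= e0 h].
have [s [st Ks se]] := lt_ _ (nbhsx_ballx t e e0).
by exists s; apply: h.
Qed.

(** Reading the derivative along the fragment off any extension of [f \o y]
    which is differentiable at [t]. *)
Lemma frag_derive_slope t F c : K t -> limit_point K t ->
  (forall s, K s -> F s = along f y s) -> has_slope F t c ->
  frag_derivable f y t /\ frag_derive f y t = c.
Proof.
move=> Kt lt_ FK sl.
have PF := limit_point_proper lt_.
have qc : frag_quotient f y t @ within K t^' --> c.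
  apply/cvgrPdist_le => e e0; have [dl dl0 hdl] := sl e e0.
  rewrite !near_withinE; apply/nbhs_ballP; exists dl => //= s std st Ks.
  rewrite /frag_quotient -!FK//.
  have st0 : s - t != 0 by rewrite subr_eq0.
  rewrite distrC -[X in _ - X](mulfK st0) -mulrBl normrM normfV.
  rewrite ler_pdivrMr ?normr_gt0//; apply: hdl.
  by rewrite distrC.
have dt : frag_derivable f y t by split => //; apply/cvg_ex; exists c.
split => //; rewrite /frag_derive; case: asboolP => // _.
exact: (cvg_lim (@Rhausdorff R) qc).
Qed.

Lemma frag_derivable_cvg t : frag_derivable f y t ->
  frag_quotient f y t @ within K t^' --> frag_derive f y t.
Proof.
by move=> dt; rewrite /frag_derive; case: asboolP => // _; case: dt.
Qed.

Lemma frag_derive_le t : 0 <= L -> `|frag_derive f y t| <= L.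
Proof.
move=> L0; have [dt|ndt] := pselect (frag_derivable f y t); last first.
  by rewrite /frag_derive; case: asboolP => // _; rewrite normr0.
have [Kt lt_ _] := dt; have PF := limit_point_proper lt_.
have h : `|frag_quotient f y t s| @[s --> within K t^'] --> `|frag_derive f y t|.
  by apply: cvg_norm; exact: frag_derivable_cvg.
apply: (cvgr_to_le h).
rewrite near_withinE; near=> s => Ks.
apply: frag_quotient_le => //; near: s; exact: nbhs_dnbhs_neq.
Unshelve. all: by end_near. Qed.

Hypothesis L0 : 0 <= L.

Lemma frag_extension : exists F : R -> R,
  (forall s t, `|F s - F t| <= L * `|s - t|) /\
  (forall s, K s -> F s = along f y s).
Proof.
have [M fM] := along_bounded.
exists (mcshane K (along f y) L); split.
  exact: (mcshane_lipschitz (fdom_neq0 y) fM L0).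
by move=> s Ks; apply: (mcshane_ext (fdom_neq0 y) fM L0 fyL).
Qed.

Let quot_continuous (F : R -> R) s t : continuous F -> t != s ->
  {for t, continuous (fun t => (F s - F t) / (s - t))}.
Proof.
move=> cF ts; apply: cvgM.
  by apply: cvgB; [exact: cvg_cst|exact: cF].
apply: cvgV; first by rewrite subr_eq0 eq_sym.
by apply: cvgB; [exact: cvg_cst|exact: cvg_id].
Qed.

Let open_neq (s : R) : open [set t | t != s].
Proof.
rewrite (_ : mkset _ = ~` [set s]).
  by apply: closed_openC; apply: accessible_closed_set1; exact: hausdorff_accessible (@Rhausdorff R).
by apply/seteqP; split => t /= /eqP.
Qed.

Let nbhs_neq (t s : R) : t != s -> \forall u \near t, u != s.
Proof. by move=> ts; have := @open_neq s; rewrite openE => /(_ t ts). Qed.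

Let open_gt (F : R -> R) s c : continuous F ->
  open [set t | t != s /\ c < (F s - F t) / (s - t)].
Proof.
move=> cF; rewrite openE => t /= [ts ct].
near=> u; split; first by near: u; exact: nbhs_neq.
by near: u; apply: (cvgr_gt _ (quot_continuous cF ts)).
Unshelve. all: by end_near. Qed.

Let open_osc (F : R -> R) s s' e : continuous F ->
  open [set t | (t != s /\ t != s') /\
    e < `|(F s - F t) / (s - t) - (F s' - F t) / (s' - t)|].
Proof.
move=> cF; rewrite openE => t /= [[ts ts'] ct].
near=> u; split.
  split; near: u; exact: nbhs_neq.
near: u; apply: (cvgr_gt _ (cvg_norm (cvgB (quot_continuous cF ts) (quot_continuous cF ts')))).
by [].
Unshelve. all: by end_near. Qed.

(** The points close to which two difference quotients of [F], taken towards
    [K] at scale [dl], differ by more than [e]. The limit of the quotients at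
    [t] exists iff for every [e] the point [t] avoids one of these sets for a
    suitable [dl] (Cauchy's criterion). They are open because [F] is defined and continuous on the
    whole line. *)
Let osc (F : R -> R) (dl e : R) : set R :=
  \bigcup_(p in [set p : R * R | K p.1 /\ K p.2]) (ball p.1 dl `&` ball p.2 dl `&`
    [set t | (t != p.1 /\ t != p.2) /\
      e < `|(F p.1 - F t) / (p.1 - t) - (F p.2 - F t) / (p.2 - t)|]).

(** The derivative at [t] is at least [c] iff at every scale some difference
    quotient is almost [c]. *)
Let above (F : R -> R) (dl c : R) : set R :=
  \bigcup_(s in K) (ball s dl `&` [set t | t != s /\ c < (F s - F t) / (s - t)]).

Let osc_open F dl e : continuous F -> open (osc F dl e).
Proof.
move=> cF; apply: bigcup_open => p _; apply: openI; last exact: open_osc.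
by apply: openI; apply: ball_open.
Qed.

Let above_open F dl c : continuous F -> open (above F dl c).
Proof.
move=> cF; apply: bigcup_open => p _; apply: openI; last exact: open_gt.
exact: ball_open.
Qed.

Let inv_gt0 (n : nat) : 0 < (n.+1%:R : R)^-1.
Proof. by rewrite invr_gt0. Qed.

Let derivableE (F : R -> R) : (forall s, K s -> F s = along f y s) ->
  [set t | frag_derivable f y t] = K `&` limit_point K `&`
   \bigcap_n \bigcup_m ~` (osc F m.+1%:R^-1 n.+1%:R^-1).
Proof.
move=> FK; apply/seteqP; split => t /=.
  move=> dt; have [Kt lt_ _] := dt; have PF := limit_point_proper lt_.
  split => // n _.
  have /cvgrPdist_lt /(_ (n.+1%:R^-1 / 2)) := frag_derivable_cvg dt.
  rewrite divr_gt0// => /(_ isT); rewrite !near_withinE => /nbhs_ballP[e/= e0 h].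
  have [m me] : exists m : nat, (m.+1%:R : R)^-1 < e.
    exists (Num.trunc e^-1); rewrite invf_plt ?posrE//; exact: truncnS_gt.
  exists m => //= -[[s s'] /= [Ks Ks'] [[bs bs'] [[ts ts'] +]]].
  have qs u : K u -> t != u -> ball u m.+1%:R^-1 t ->
      `|frag_derive f y t - (F u - F t) / (u - t)| < n.+1%:R^-1 / 2.
    move=> Ku tu bu; rewrite !FK//; apply: (h u) => //; last by rewrite eq_sym.
    by apply: ball_sym; apply: le_ball bu; exact: ltW.
  have := qs s Ks ts bs; have := qs s' Ks' ts' bs'.
  move: ((F s - F t) / (s - t)) ((F s' - F t) / (s' - t)) => a b.
  rewrite !ltr_norml ltr_normr => /andP[h1 h2] /andP[h3 h4].
  by case/orP; move: (n.+1%:R^-1) h1 h2 h3 h4 => i; lra.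
move=> [[Kt lt_] h]; have PF := limit_point_proper lt_; split => //.
apply/cauchy_cvgP/cauchy_exP => e e0.
have [n ne] : exists n : nat, (n.+1%:R : R)^-1 < e.
  exists (Num.trunc e^-1); rewrite invf_plt ?posrE//; exact: truncnS_gt.
have [m _ hm] := h n I.
have [s [st Ks se]] := lt_ _ (nbhsx_ballx t _ (inv_gt0 m)).
exists (frag_quotient f y t s).
change (\forall u \near t, u != t -> K u ->
  ball (frag_quotient f y t s) e (frag_quotient f y t u)).
apply/nbhs_ballP; exists m.+1%:R^-1 => //= u ue ut Ku.
rewrite /ball/= ltNge; apply/negP => eu; apply: hm.
exists (s, u) => //=; split; first by split; exact: ball_sym.
split; first by split; rewrite eq_sym.
by apply: (lt_le_trans ne); rewrite !FK.
Qed.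

Let deriv_geE (F : R -> R) c : (forall s, K s -> F s = along f y s) ->
  [set t | frag_derivable f y t /\ c <= frag_derive f y t] =
  [set t | frag_derivable f y t] `&`
   \bigcap_n \bigcap_m (above F m.+1%:R^-1 (c - n.+1%:R^-1)).
Proof.
move=> FK; apply/seteqP; split => t /=.
  move=> [dt ct]; have [Kt lt_ _] := dt; have PF := limit_point_proper lt_.
  split => // n _ m _.
  have : c - n.+1%:R^-1 < frag_derive f y t.
    by apply: lt_le_trans ct; rewrite ltrBlDr ltrDl.
  move=> /(cvgr_gt _ (frag_derivable_cvg dt)); rewrite !near_withinE.
  move=> /nbhs_ballP[e/= e0 h].
  have me0 : 0 < Num.min e m.+1%:R^-1 by rewrite lt_min e0/=.
  have [s [st Ks se]] := lt_ _ (nbhsx_ballx t _ me0).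
  exists s => //; split.
    by apply: ball_sym; apply: le_ball se; rewrite ge_min lexx orbT.
  split; first by rewrite eq_sym.
  rewrite !FK//; apply: h => //.
  by apply: le_ball se; rewrite ge_min lexx.
move=> [dt h]; split => //; have [Kt lt_ _] := dt; have PF := limit_point_proper lt_.
rewrite leNgt; apply/negP => dc.
pose e := c - frag_derive f y t.
have e0 : 0 < e by rewrite subr_gt0.
have [n ne] : exists n : nat, (n.+1%:R : R)^-1 < e / 2.
  exists (Num.trunc (e / 2)^-1); rewrite invf_plt ?posrE//; last exact: divr_gt0.
  exact: truncnS_gt.
have : frag_derive f y t < c - e / 2 by rewrite /e; lra.
move=> /(cvgr_lt _ (frag_derivable_cvg dt)); rewrite !near_withinE.
move=> /nbhs_ballP[r/= r0 hr].
have [m mr] : exists m : nat, (m.+1%:R : R)^-1 < r.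
  exists (Num.trunc r^-1); rewrite invf_plt ?posrE//; exact: truncnS_gt.
have [s Ks [sb [ts]]] := h n I m I; rewrite !FK// => hs.
have := hr s; rewrite /= /frag_quotient => /(_ _ _ Ks) hs'.
have := hs'; rewrite eq_sym => /(_ _ ts) => hs2.
have := lt_trans hs (hs2 (ball_sym (le_ball (ltW mr) sb))).
by rewrite ltrD2l ltrN2 => /lt_trans /(_ ne); rewrite ltxx.
Qed.

(** Borel measurability is needed at every point, not only up to a null set:
    by [derivableE] and [deriv_geE] the sets involved are countable combinations of
    open sets and of the compact domain. *)
Lemma frag_derive_measurable : measurable_fun [set: measurableTypeR R] (frag_derive f y).
Proof.
have [F [FL FK]] := frag_extension.
have cF := lipschitz_continuous FL.
have om (U : set R) : open U -> measurable (U : set (measurableTypeR R)).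
  by move=> oU; exact (open_measurable oU).
have mD : measurable ([set t | frag_derivable f y t] : set (measurableTypeR R)).
  rewrite (derivableE FK); apply: measurableI.
    apply: measurableI; first exact: fdom_measurable.
    have cl : closed (limit_point K).
      by apply: limit_point_closed; exact: hausdorff_accessible (@Rhausdorff R).
    rewrite -[limit_point K]setCK; apply: measurableC; apply: om.
    exact: closed_openC.
  apply: bigcap_measurable => // n _; apply: bigcup_measurable => m _.
  by apply: measurableC; apply: om; exact: osc_open.
apply: (@measurability _ _ (measurableTypeR R) R _ _ (@RGenCInfty.G R)).
  exact: RGenCInfty.measurableE.
move=> _ [_ [c ->] <-]; rewrite setTI.
have -> : frag_derive f y @^-1` `[c, +oo[ =
    [set t | frag_derivable f y t /\ c <= frag_derive f y t] `|`
    ((if c <= 0 then setT else set0) `\` [set t | frag_derivable f y t]).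
  apply/seteqP; split => t /=; rewrite in_itv/= andbT.
    move=> ct; have [dt|ndt] := pselect (frag_derivable f y t); first by left.
    right; split => //; move: ct; rewrite /frag_derive; case: asboolP => // _.
    by move=> ->.
  move=> [[]//|[+ ndt]]; rewrite /frag_derive; case: asboolP => // _.
  by case: ifP.
apply: measurableU; last by apply: measurableD => //; case: ifP.
rewrite (deriv_geE c FK); apply: measurableI => //.
apply: bigcap_measurable => // n _; apply: bigcap_measurable => // m _.
by apply: om; exact: above_open.
Qed.

Lemma frag_ae_derivable (F h : R -> R) : (forall s, K s -> F s = along f y s) ->
  {ae leb, forall t, has_slope F t (h t)} ->
  {ae leb, forall t, K t -> frag_derivable f y t /\ frag_derive f y t = h t}.
Proof.
move=> FK; have := ae_limit_point (fdom_neq0 y).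
apply: (@filterS2 _ _ (ae_filter_ringOfSetsType leb)) => t lt_ sl Kt.
exact: (frag_derive_slope Kt (lt_ Kt) FK sl).
Qed.

End fragment_derivative.

(** * Measures which are absolutely continuous along a fragment *)

Section absolute_continuity.
Context {R : realType} {X : completeMetricType R}.
Notation leb := (@lebesgue_measure R).

Lemma diam_ge0 (E : set X) : (0 <= diam E)%E.
Proof. by rewrite /diam le_max lexx. Qed.

Lemma diam_le (E : set X) (c : R) : 0 <= c ->
  (forall p q, E p -> E q -> mdist p q <= c) -> (diam E <= c%:E)%E.
Proof.
move=> c0 h; rewrite /diam ge_max lee_fin c0/=.
by apply: ge_ereal_sup => _ [[p q] /= [Ep Eq] <-]; rewrite lee_fin h.
Qed.

Lemma lebesgue_null_cover (N : set R) (e : R) : leb N = 0%E -> 0 < e ->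
  exists I : nat -> R * R, [/\ forall k, (I k).1 <= (I k).2,
    N `<=` \bigcup_k `](I k).1, (I k).2]%classic &
    (\sum_(k <oo) ((I k).2 - (I k).1)%:E < e%:E)%E].
Proof.
move=> N0 e0.
have : (leb N < e%:E)%E by rewrite N0 lte_fin.
rewrite /lebesgue_measure /lebesgue_stieltjes_measure /measure_extension/=.
move=> /ereal_inf_lt[_ [A [mA NA] <-]] Ae.
have /choice[I IE] : forall k, exists i : R * R, i.1 <= i.2 /\
    A k = `]i.1, i.2]%classic.
  move=> k.
  have /ocitvP[->|[i i12 ->]] := mA k; last by exists i; split => //; exact: ltW.
  by exists (0, 0); split => //=; rewrite set_itvoc0.
exists I; split => [k|x /NA[k _]|].
- by have [] := IE k.
- by rewrite (IE k).2 => h; exists k.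
- apply: le_lt_trans Ae; rewrite le_eqVlt; apply/orP; left; apply/eqP.
  apply: eq_eseriesr => k _; have [h ->] := IE k.
  by rewrite wlength_itv_bnd// .
Qed.

(** A Lebesgue null set is covered by intervals of small total length, which
    are then all short; their images under the [L]-Lipschitz curve have diameters at
    most [L] times the lengths. *)
Lemma hausdorff1_null (y : fragment X) (N : set R) (S : set X) : leb N = 0%E ->
  S `<=` fcurve y @` (fdom y `&` N) -> hausdorff1 S = 0%E.
Proof.
move=> N0 SN; have [c [L [c0 L0 yL]]] := fcurve_bilip y.
apply/eqP; rewrite eq_le; apply/andP; split; last first.
  apply: (@le_trans _ _ (hausdorff1_delta 1 S)).
    by apply: le_ereal_inf_tmp => _ [E _ <-]; apply: nneseries_ge0 => i _ _; exact: diam_ge0.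
  by apply: ereal_sup_ubound; exists 1 => //=.
apply: ge_ereal_sup => _ [d /= d0 <-].
apply/lee_addgt0Pr => e e0; rewrite add0e.
(* total length for which the diameters are at most [d] and their sum at most [e] *)
pose eta := Num.min (d / (L + 1)) (e / (L + 1)).
have L1 : 0 < L + 1 by rewrite ltr_wpDl.
have eta0 : 0 < eta by rewrite lt_min !divr_gt0.
have Leta a : eta <= a / (L + 1) -> L * eta <= a.
  rewrite ler_pdivlMr// => h; apply: le_trans h.
  by rewrite mulrC ler_wpM2l// ?lerDl// ltW.
have [I [I12 NI Ieta]] := lebesgue_null_cover N0 eta0.
pose E k := fcurve y @` (fdom y `&` `](I k).1, (I k).2]%classic).
have dE k : (diam (E k) <= (L * ((I k).2 - (I k).1))%:E)%E.
  apply: diam_le; first by rewrite mulr_ge0// subr_ge0.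
  move=> _ _ [s [Ks +] <-] [t [Kt +] <-]; rewrite /= !in_itv/=.
  move=> /andP[s1 s2] /andP[t1 t2]; have /andP[_ h] := yL _ _ Ks Kt.
  apply: (le_trans h); rewrite ler_wpM2l// ler_norml; lra.
have Ik k : (I k).2 - (I k).1 <= eta.
  rewrite -lee_fin; apply: le_trans (ltW Ieta).
  rewrite -[leLHS]/((fun k => ((I k).2 - (I k).1)%:E) k).
  rewrite (nneseriesD1 (n := k)) //.
    by rewrite leeDl// nneseries_ge0// => i _ _; rewrite lee_fin subr_ge0.
  by move=> i _; rewrite lee_fin subr_ge0.
apply: (@le_trans _ _ (\sum_(k <oo) diam (E k))%E).
  apply: ereal_inf_lbound; exists E => //; split.
    move=> x /SN[t [Kt /NI[k _ tk]] <-]; exists k => //; exists t => //.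
  move=> k; apply: (le_trans (dE k)); rewrite lee_fin.
  apply: (@le_trans _ _ (L * eta)); first by rewrite ler_wpM2l.
  by apply: Leta; rewrite ge_min lexx.
apply: (@le_trans _ _ (\sum_(k <oo) (L%:E * ((I k).2 - (I k).1)%:E))%E).
  by apply: lee_nneseries => [i _ _|i _]; [exact: diam_ge0|exact: dE].
rewrite nneseriesZl; last by move=> i _; rewrite lee_fin subr_ge0.
apply: (@le_trans _ _ (L%:E * eta%:E)%E).
  by apply: lee_wpmul2l; [rewrite lee_fin|exact: ltW].
by rewrite -EFinM lee_fin; apply: Leta; rewrite ge_min lexx orbT.
Qed.

End absolute_continuity.

Section push_measure.
Context {R : realType} {X : completeMetricType R}.
Notation leb := (@lebesgue_measure R).
Variables (A : alberti_pair X) (y : fragment X).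

(** A name for [alb_push A y] that carries its structure of finite measure. *)
Definition frag_push : set (measurableTypeR R) -> \bar R := alb_push A y.

Let mpush : {measure set (measurableTypeR R) -> \bar R} :=
  measure_function_pushforward__canonical__measure_function_Measure
    (alb_nu A y) (frag_inv_measurable y).

HB.instance Definition _ := isMeasure.Build _ _ _ frag_push
  (measure0 mpush) (measure_ge0 mpush) (@measure_semi_sigma_additive _ _ _ mpush).

Let push_fin : fin_num_fun frag_push.
Proof.
move=> B mB; rewrite /frag_push /alb_push /pushforward fin_num_measure//.
by rewrite -[X in measurable X]setTI; exact: (frag_inv_measurable y).
Qed.

HB.instance Definition _ := Measure_isFinite.Build _ _ _ frag_push push_fin.

Hypothesis ac : alb_nu A y `<< (fun E : set (borel X) => hausdorff1 (E `&` frag_im y)).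

Lemma nu_lebesgue_null (N : set (measurableTypeR R)) : measurable N -> leb N = 0%E ->
  alb_nu A y (frag_inv y @^-1` N) = 0%E.
Proof.
move=> mN N0.
have mpN : measurable (frag_inv y @^-1` N : set (borel X)).
  by rewrite -[X in measurable X]setTI; exact: (frag_inv_measurable y).
apply/(measure0_null_setP (alb_nu A y) mpN); apply: ac => B mB BN.
apply: (hausdorff1_null (y:=y) N0) => x [Bx ix].
by have [h1 h2] := frag_im_inv ix; exists (frag_inv y x) => //; split => //; exact: BN.
Qed.

Lemma nu_off_im : alb_nu A y (~` frag_im y) = 0%E.
Proof.
have mim : measurable (~` frag_im y : set (borel X)).
  by apply: measurableC; exact: frag_im_measurable.
apply/(measure0_null_setP (alb_nu A y) mim); apply: ac => B mB BN.
apply: (hausdorff1_null (y:=y) (N := set0)); first exact: measure0.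
by move=> x [/BN].
Qed.

Lemma push_dominated : frag_push `<< leb.
Proof.
apply/null_content_dominatesP => N mN N0; exact: nu_lebesgue_null.
Qed.

(** Transfer of statements that hold almost everywhere on the line to the
    measure [nu_y] on the space. *)
Lemma nu_ae_im (Q : R -> Prop) : {ae leb, forall t, Q t} ->
  {ae alb_nu A y, forall x, frag_im y x /\ Q (frag_inv y x)}.
Proof.
move=> [N [mN N0 QN]].
have nim : (alb_nu A y).-negligible (~` frag_im y).
  exists (~` frag_im y); split => //; last exact: nu_off_im.
  by apply: measurableC; exact: frag_im_measurable.
have nN : (alb_nu A y).-negligible (frag_inv y @^-1` N).
  exists (frag_inv y @^-1` N); split => //; last exact: nu_lebesgue_null.
  by rewrite -[X in measurable X]setTI; exact: (frag_inv_measurable y).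
apply: negligibleS (negligibleU nim nN) => x /= nQ.
have [ix|nix] := pselect (frag_im y x); last by left.
by right; apply: QN => /= Qx; apply: nQ.
Qed.

Lemma along_measurable (g : borel X -> R) : measurable_fun setT g ->
  measurable_fun [set: measurableTypeR R] (along g y).
Proof.
move=> mg.
have -> : along g y = (g \o fcurve y) \_ (fdom y).
  apply/funext => t; rewrite patchE; case: ifPn => [/set_mem|/negP] Kt.
    by rewrite alongE.
  by rewrite along_off// => yt; apply: Kt; exact/mem_set.
apply/measurable_restrict => //; first exact: fdom_measurable.
rewrite setTI; apply: (measurable_comp _ _ mg (fcurve_measurable (y := y))) => //.
Qed.

Lemma along_bound (g : X -> R) M : 0 <= M -> (forall x, `|g x| <= M) ->
  forall t, `|along g y t| <= M.
Proof.
move=> M0 gM t; have [Kt|nKt] := pselect (fdom y t); first by rewrite alongE.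
by rewrite along_off// normr0.
Qed.

(** Both sides are [0] when the derivative does not exist. *)
Lemma frag_partialE (f : X -> R) x : frag_im y x ->
  frag_partial f y x = frag_derive f y (frag_inv y x).
Proof.
move=> ix; rewrite /frag_partial; case: asboolP => // nd.
rewrite /frag_derive; case: asboolP => // d; exfalso; exact: nd.
Qed.

(** Change of variables. The function [u] lives on the line and vanishes off
    the domain; off the image of [y] the values of [w] do not matter, because
    [nu_y] vanishes there. *)
Lemma push_integral (u : R -> R) (w : X -> R) (M : R) :
  measurable_fun [set: measurableTypeR R] u -> (forall t, `|u t| <= M) ->
  (forall t, ~ fdom y t -> u t = 0) -> measurable_fun [set: borel X] w ->
  (forall x, frag_im y x -> w x = u (frag_inv y x)) ->
  (\int[alb_nu A y]_x (w x)%:E = \int[frag_push]_t (u t)%:E)%E.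
Proof.
move=> mu uM u0 mw wu.
have -> : (\int[frag_push]_t (u t)%:E = \int[alb_nu A y]_x (u (frag_inv y x))%:E)%E.
  rewrite [LHS](@integral_pushforward _ _ (borel X) (measurableTypeR R) R
    (frag_inv y) (frag_inv_measurable y) (alb_nu A y) setT (EFin \o u)) //.
    exact/measurable_EFinP.
  rewrite preimage_setT.
  apply: (@bounded_integrable _ (borel X) R (alb_nu A y) (u \o frag_inv y) M).
    exact: measurableT_comp mu (frag_inv_measurable y).
  by move=> x; exact: uM.
apply: ae_eq_integral => //.
- exact/measurable_EFinP.
- by apply/measurable_EFinP; exact: measurableT_comp mu (frag_inv_measurable y).
exists (~` frag_im y); split.
- by apply: measurableC; exact: frag_im_measurable.
- exact: nu_off_im.
- by move=> x /= h ix; apply: h => _; rewrite wu.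
Qed.

End push_measure.

(** * Borel functions of a fragment *)

Section fragment_topology.
Context {R : realType} {X : completeMetricType R}.
Variable (h0 : [set: fragment X] !=set0).
Notation Y := (bfragment h0).

Lemma frag_open_measurable (U : set (fragment X)) :
  frag_open U -> measurable (U : set Y).
Proof. by move=> oU; apply: sub_sigma_algebra. Qed.

Lemma hausdorff_dist_near (y z : fragment X) e t :
  (hausdorff_dist (frag_graph y) (frag_graph z) < e%:E)%E -> fdom y t ->
  exists t', [/\ fdom z t', `|t - t'| < e & mdist (fcurve y t) (fcurve z t') < e].
Proof.
rewrite /hausdorff_dist gt_max => /andP[h _] /fdomP[s <- <-].
have : (ereal_inf [set (prod_dist (\val s, y s) q)%:E | q in frag_graph z] < e%:E)%E.
  apply: le_lt_trans h; apply: ereal_sup_ubound; exists (\val s, y s) => //.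
  by exists s.
move=> /ereal_inf_lt[_ [_ [u _ <-] <-]]; rewrite lte_fin /prod_dist/= gt_max.
move=> /andP[h1 h2]; exists (\val u); split => //; first exact: set_valP.
by rewrite fcurve_val.
Qed.

(** A point of the graph of [y] has a point of the graph of [z] nearby as soon
    as the graphs are close, so an open condition which holds somewhere on the
    graph persists. All the measurability proofs below reduce to this. *)
Lemma frag_open_exists (Q : R -> X -> R -> X -> Prop) :
  (forall s x t z, Q s x t z -> exists2 e : R, 0 < e & forall s' x' t' z',
    `|s - s'| < e -> mdist x x' < e -> `|t - t'| < e -> mdist z z' < e ->
    Q s' x' t' z') ->
  frag_open [set y : fragment X | exists s t, [/\ fdom y s, fdom y t &
     Q s (fcurve y s) t (fcurve y t)]].
Proof.
move=> oQ y /= [s [t [ys yt Qst]]]; have [e e0 eQ] := oQ _ _ _ _ Qst.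
exists e => // z yz.
have [s' [zs' ss' ds']] := hausdorff_dist_near yz ys.
have [t' [zt' tt' dt']] := hausdorff_dist_near yz yt.
by exists s', t'; split => //; apply: eQ.
Qed.

Lemma frag_lip_measurable (C : R) : measurable ([set y | frag_lip C y] : set Y).
Proof.
have -> : ([set y | frag_lip C y] : set Y) =
    ~` [set y : fragment X | exists s t, [/\ fdom y s, fdom y t &
       C * `|s - t| < mdist (fcurve y s) (fcurve y t)]].
  apply/seteqP; split => y /=; rewrite frag_lipP.
    by move=> h [s [t [ys yt]]]; rewrite ltNge h.
  by move=> h s t ys yt; rewrite leNgt; apply/negP => st; apply: h; exists s, t.
apply: measurableC; apply: frag_open_measurable.
apply: (frag_open_exists (Q := fun s x t z => C * `|s - t| < mdist x z)).
move=> s x t z st.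
pose r := mdist x z - C * `|s - t|.
have r0 : 0 < r by rewrite subr_gt0.
have C1 : 0 < `|C| + 1 by rewrite ltr_wpDl.
exists (r / (4 * (`|C| + 1))); first by rewrite divr_gt0// mulr_gt0.
set e := r / _ => s' x' t' z' ss' xx' tt' zz'.
have eE : e * (4 * (`|C| + 1)) = r by rewrite /e divfK// gt_eqF// mulr_gt0.
have e0 : 0 < e by rewrite /e divr_gt0// mulr_gt0.
have h1 : mdist x z <= mdist x x' + mdist x' z' + mdist z' z.
  by rewrite (le_trans (metric_triangle _ z' _))// lerD2r metric_triangle.
rewrite (metric_sym z') in h1.
have h2 : `| `|s - t| - `|s' - t'| | <= 2 * e.
  rewrite (le_trans (ler_dist_dist _ _))//.
  have -> : s - t - (s' - t') = (s - s') - (t - t') by ring.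
  by rewrite (le_trans (ler_normB _ _))//; lra.
have h3 : C * `|s' - t'| <= C * `|s - t| + `|C| * (2 * e).
  have : C * (`|s' - t'| - `|s - t|) <= `|C| * (2 * e).
    rewrite (le_trans (ler_norm _))// normrM ler_wpM2l// distrC.
    exact: h2.
  by lra.
have h4 : r = mdist x z - C * `|s - t| by [].
by nra.
Qed.

Lemma fdom_bounded_measurable (n : R) :
  measurable ([set y | forall t, fdom y t -> `|t| <= n] : set Y).
Proof.
have -> : ([set y | forall t, fdom y t -> `|t| <= n] : set Y) =
    ~` [set y : fragment X | exists s t, [/\ fdom y s, fdom y t & n < `|s|]].
  apply/seteqP; split => y /=.
    by move=> h [s [t [ys _]]]; rewrite ltNge h.
  by move=> h s ys; rewrite leNgt; apply/negP => st; apply: h; exists s, s.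
apply: measurableC; apply: frag_open_measurable.
apply: (frag_open_exists (Q := fun s x t z => n < `|s|)) => s x t z ns.
exists (`|s| - n); first by rewrite subr_gt0.
move=> s' _ _ _ ss' _ _ _.
by have := ler_normD (s - s') s'; rewrite subrK; lra.
Qed.

(** By [mcshane_lt] the strict sublevel sets are of the form treated in
    [frag_open_exists]. *)
Lemma mcshane_measurable (f : X -> R) (Lf M L r : R) : lip_with Lf f ->
  (forall x, `|f x| <= M) -> 0 <= Lf -> 0 <= L ->
  measurable_fun [set: Y] (fun y : Y => mcshane (fdom y) (along f y) L r).
Proof.
move=> fL fM Lf0 L0.
apply: (@measurability _ _ Y R _ _ (@RGenInftyO.G R)).
  exact: RGenInftyO.measurableE.
move=> _ [_ [c ->] <-]; rewrite setTI.
have -> : (fun y : Y => mcshane (fdom y) (along f y) L r) @^-1` `]-oo, c[ =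
    [set y : fragment X | exists s t, [/\ fdom y s, fdom y t &
      f (fcurve y s) + L * `|r - s| < c]].
  apply/seteqP; split => y /=; rewrite in_itv/=;
    have aM t : fdom y t -> `|along f y t| <= M by move=> yt; rewrite alongE.
  - move=> /(mcshane_lt (fdom_neq0 y) aM L0 r c).1[s ys].
    by rewrite alongE// => sc; exists s, s.
  - move=> [s [_ [ys _ sc]]]; apply/(mcshane_lt (fdom_neq0 y) aM L0 r c).2.
    by exists s => //; rewrite alongE.
apply: frag_open_measurable.
apply: (frag_open_exists (Q := fun s x t z => f x + L * `|r - s| < c)) => s x t z ns.
have D0 : 0 < Lf + L + 1 by rewrite ltr_wpDl// addr_ge0.
exists ((c - (f x + L * `|r - s|)) / (Lf + L + 1)); first by rewrite divr_gt0// subr_gt0.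
set e := _ / _ => s' x' _ _ ss' xx' _ _.
have eE : e * (Lf + L + 1) = c - (f x + L * `|r - s|) by rewrite /e divfK// gt_eqF.
have e0 : 0 < e by rewrite divr_gt0// subr_gt0.
have h1 : f x' <= f x + Lf * e.
  have := fL x' x; rewrite ler_norml metric_sym => /andP[_ h].
  have : Lf * mdist x x' <= Lf * e by rewrite ler_wpM2l// ltW.
  by lra.
have h2 : L * `|r - s'| <= L * `|r - s| + L * e.
  rewrite -mulrDr ler_wpM2l//.
  have := ler_normD (r - s) (s - s'); rewrite addrA subrK; lra.
by nra.
Qed.

End fragment_topology.

(** * Norms of bounded Lipschitz functions *)

Section lipb_facts.
Context {R : realType} {X : completeMetricType R}.

Lemma lip_const_ge0 (f : LipB X) : 0 <= lip_const f.
Proof.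
have /lipbP[M [M0 fM fL]] := LipB_mem f.
by apply: lb_le_inf; [exists M|move=> x []].
Qed.

Lemma lip_constP (f : LipB X) : lip_with (lip_const f) f.
Proof.
have /lipbP[M [M0 fM fL]] := LipB_mem f.
move=> x z; apply/ler_addgt0Pr => e e0.
have d1 : 0 < mdist x z + 1 by rewrite ltr_wpDl// mdist_ge0.
have hi : has_inf [set L | 0 <= L /\ lip_with L f].
  by split; [exists M|exists 0 => L []].
have [L [L0 hL] Le] := inf_adherent (divr_gt0 e0 d1) hi.
apply: (le_trans (hL x z)).
apply: (@le_trans _ _ ((lip_const f + e / (mdist x z + 1)) * mdist x z)).
  by rewrite ler_wpM2r ?mdist_ge0// ltW.
rewrite mulrDl lerD2l mulrAC ler_pdivrMr// ler_wpM2l ?ltW//.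
by rewrite ltrDl.
Qed.

Lemma sup_normP (f : LipB X) x : `|f x| <= sup_norm f.
Proof.
have /lipbP[M [M0 fM fL]] := LipB_mem f.
by apply: ub_le_sup; [exists M => _ [z _ <-]|exists x].
Qed.

Lemma sup_norm_ge0 (f : LipB X) : 0 <= sup_norm f.
Proof. exact: le_trans (normr_ge0 _) (sup_normP f point). Qed.

Lemma lip_const_le_norm (f : LipB X) : lip_const f <= lipb_norm f.
Proof. by rewrite /lipb_norm le_max lexx orbT. Qed.

Lemma lipb_norm_ge0 (f : LipB X) : 0 <= lipb_norm f.
Proof. exact: le_trans (lip_const_ge0 f) (lip_const_le_norm f). Qed.

Lemma lip_continuous (f : LipB X) : continuous f.
Proof.
move=> x; apply/cvgrPdist_lt => e e0.
have L0 := lip_const_ge0 f.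
have L1 : 0 < lip_const f + 1 by rewrite ltr_wpDl.
apply/nbhs_ballP; exists (e / (lip_const f + 1)); first by rewrite /= divr_gt0.
move=> z; rewrite ballEmdist/= ltr_pdivlMr// => h.
apply: (le_lt_trans (lip_constP f x z)); apply: le_lt_trans h.
by rewrite mulrC ler_wpM2l ?mdist_ge0// lerDl.
Qed.

Lemma lipb_measurable (f : LipB X) : measurable_fun [set: borel X] (f : borel X -> R).
Proof.
apply: (@measurability _ _ (borel X) R _ _ (@RGenOpens.G R)).
  exact: RGenOpens.measurableE.
move=> _ [U [a [b ->]] <-]; rewrite setTI; apply: sub_sigma_algebra.
apply: open_comp; first by move=> x _; exact: lip_continuous.
exact: interval_open.
Qed.

End lipb_facts.

(** * Borel dependence of the inner integrals on the fragment *)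

Section fragment_measurability.
Context {R : realType} {X : completeMetricType R}.
Notation leb := (@lebesgue_measure R).
Variables (A : alberti_pair X).
Notation Y := (bfragment (alb_frag A)).
Hypothesis ac : forall y : fragment X,
  alb_nu A y `<< (fun E : set (borel X) => hausdorff1 (E `&` frag_im y)).
Hypothesis mitv : forall E : set (borel X), measurable E ->
  forall a b : R, a <= b ->
    measurable_fun [set: Y] (fun y => alb_nu A y (E `&` frag_im_itv y a b)).

(** The hypothesis says that the restrictions of [nu_y] to the pieces of the
    images form a kernel; adding the constant [M] to [g] reduces to nonnegative
    integrands. *)
Lemma im_itv_integral_measurable (g : borel X -> R) (M a b : R) :
  measurable_fun setT g -> (forall x, `|g x| <= M) -> a <= b ->
  measurable_fun [set: Y]
    (fun y => (\int[alb_nu A y]_(x in frag_im_itv y a b) (g x)%:E)%E).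
Proof.
move=> mg gM ab.
pose l (y : Y) : {measure set (borel X) -> \bar R} :=
  mrestr (alb_nu A y) (frag_im_itv_measurable y a b).
have ml U : measurable U -> measurable_fun [set: Y] (l ^~ U) by move=> mU; exact: mitv.
have mpos (u : borel X -> R) : measurable_fun setT u -> (forall x, 0 <= u x) ->
    measurable_fun [set: Y]
      (fun y => (\int[alb_nu A y]_(x in frag_im_itv y a b) (u x)%:E)%E).
  move=> mu u0; have -> : (fun y : Y => (\int[alb_nu A y]_(x in frag_im_itv y a b) (u x)%:E)%E)
      = (fun y : Y => (\int[l y]_x (EFin \o u) x)%E).
    by apply/funext => y; rewrite mrestr_integral//; exact/measurable_EFinP.
  apply: (@measurable_fun_integral_kernel _ _ _ _ _ l ml (EFin \o u)).
    by move=> x /=; rewrite lee_fin.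
  exact/measurable_EFinP.
have M0 : 0 <= M by exact: le_trans (normr_ge0 _) (gM point).
have gM0 x : 0 <= g x + M by have := gM x; rewrite ler_norml => /andP[]; lra.
have gM2 x : `|g x + M| <= 2 * M.
  by rewrite ger0_norm//; have := gM x; rewrite ler_norml => /andP[]; lra.
have mgM : measurable_fun [set: borel X] (fun x => g x + M) by exact: measurable_funD.
have -> : (fun y : Y => (\int[alb_nu A y]_(x in frag_im_itv y a b) (g x)%:E)%E) =
  (fun y : Y => (\int[alb_nu A y]_(x in frag_im_itv y a b) (g x + M)%:E -
    \int[alb_nu A y]_(x in frag_im_itv y a b) (cst M x)%:E)%E).
  apply/funext => y; rewrite -integralB_EFin//.
  - by apply: eq_integral => x _; rewrite -EFinB addrK.
  - exact: frag_im_itv_measurable.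
  - apply: integrableS (bounded_integrable (alb_nu A y) mgM gM2) => //; exact: frag_im_itv_measurable.
  - apply: integrableS (bounded_integrable (alb_nu A y) (u := cst M) (M := M) _ _) => //.
      exact: frag_im_itv_measurable.
    by move=> x; rewrite ger0_norm.
by apply: emeasurable_funB; apply: mpos.
Qed.

Lemma frag_partial_measurable (f : X -> R) (y : fragment X) (L : R) : 0 <= L ->
  (forall s t, fdom y s -> fdom y t ->
     `|along f y s - along f y t| <= L * `|s - t|) ->
  measurable_fun [set: borel X] (frag_partial f y) /\
  forall x, `|frag_partial f y x| <= L.
Proof.
move=> L0 fL; split; last first.
  move=> x; rewrite /frag_partial; case: asboolP => _; last by rewrite normr0.
  exact: frag_derive_le.
have -> : frag_partial f y = (frag_derive f y \o frag_inv y) \_ (frag_im y).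
  apply/funext => x; rewrite patchE; case: ifPn => [/set_mem|/negP] ix.
    by rewrite frag_partialE.
  rewrite /frag_partial; case: asboolP => // -[iy _]; exfalso; apply: ix; exact/mem_set.
apply/measurable_restrict => //; first exact: frag_im_measurable.
rewrite setTI; apply: measurable_funTS.
exact: measurableT_comp (frag_derive_measurable fL L0) (frag_inv_measurable y).
Qed.

Section riemann_sums.
Variables (f : LipB X) (psi : R -> R) (c : R) (g : borel X -> R) (M : R).
Hypotheses (cpsi : continuous psi) (psile : forall r, `|psi r| <= `|r| + c).
Hypotheses (mg : measurable_fun setT g) (gM : forall x, `|g x| <= M).

(** The grid of mesh [1 / m.+1] which starts at [- n]; it covers [[- n, n]] with
    its first [N n m] cells. *)
Let grid (n m k : nat) : R := - n%:R + k%:R / m.+1%:R.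

Let gridS n m k : grid n m k.+1 = grid n m k + m.+1%:R^-1.
Proof. by rewrite /grid -natr1 mulrDl mul1r addrA. Qed.

Let inv_gt0 (m : nat) : 0 < (m.+1%:R^-1 : R). Proof. by rewrite invr_gt0. Qed.

Let grid_le n m k : grid n m k <= grid n m k.+1.
Proof. by rewrite gridS lerDl ltW. Qed.

Let grid_mono n m j k : (grid n m j < grid n m k) = (j < k)%N.
Proof. by rewrite /grid ltrD2l ltr_pM2r// ltr_nat. Qed.

(** The points of all the grids. They are left out because there two pieces of
    the image overlap; being countable, they do not contribute. *)
Let Z : set R := range (fun p : nat * nat * nat => grid p.1.1 p.1.2 p.2).

Let Z_countable : countable Z.
Proof. exact: (sub_countable (card_image_le _ _) (countableP _)). Qed.

Let L n : R := lip_const f * n%:R.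
Let F n (y : Y) (r : R) : R := mcshane (fdom y) (along f y) (L n) r.
Let slope n m (y : Y) (k : nat) : R :=
  (F n y (grid n m k.+1) - F n y (grid n m k)) / (grid n m k.+1 - grid n m k).
Let N n m := (2 * n * m.+1)%N.
(** A Riemann sum for the integral of [g * psi (frag_partial f y)]: on the piece
    of the image over one cell, the derivative is replaced by the slope of the
    extension of [f \o y] over this cell. *)
Let S n m (y : Y) : \bar R := (\sum_(k < N n m) (psi (slope n m y k))%:E *
  \int[alb_nu A y]_(x in frag_im_itv y (grid n m k) (grid n m k.+1)) (g x)%:E)%E.

Let lf0 : 0 <= lip_const f. Proof. exact: lip_const_ge0 f. Qed.
Let L0 n : 0 <= L n. Proof. by rewrite mulr_ge0. Qed.

Let mS n m : measurable_fun [set: Y] (S n m).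
Proof.
apply: emeasurable_sum => k; apply: emeasurable_funM; last first.
  exact: im_itv_integral_measurable mg gM (grid_le _ _ _).
apply/measurable_EFinP; apply: measurableT_comp.
  exact: continuous_measurable_fun.
have mF r : measurable_fun [set: Y] (fun y : Y => F n y r).
  exact: mcshane_measurable (lip_constP f) (sup_normP f) lf0 (L0 n).
by apply: measurable_funM => //; exact: measurable_funB.
Qed.

(** The extension is taken with a Lipschitz constant that must not depend on
    [y]; this and the boundedness of the domain hold on these Borel sets, which
    exhaust the space of fragments. *)
Let B n : set Y := [set y | frag_lip n%:R y /\ forall t, fdom y t -> `|t| <= n%:R].

Let mB n : measurable (B n).
Proof.
have -> : B n = ([set y | frag_lip n%:R y] : set Y) `&`
    ([set y : fragment X | forall t, fdom y t -> `|t| <= n%:R] : set Y) by [].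
apply: measurableI; first exact: frag_lip_measurable.
exact: fdom_bounded_measurable.
Qed.

Let B_cover : \bigcup_n B n = setT.
Proof.
apply/seteqP; split => // y _; have [c' [L' [_ L'0 h]]] := fcurve_bilip y.
have cK : compact (fdom y) := @fdom_compact R X y.
have [b [_ hb]] := compact_bounded cK.
pose n := (Num.trunc (Num.max L' (b + 1))).+1.
have nL : Num.max L' (b + 1) <= n%:R by apply: ltW; exact: truncnS_gt.
move: nL; rewrite ge_max => /andP[nL nb].
exists n => //; split.
  apply/frag_lipP => s t ys yt; have /andP[_ h1] := h _ _ ys yt.
  by rewrite (le_trans h1)// ler_wpM2r.
by move=> t yt; apply: le_trans nb; apply: hb => //; rewrite ltrDl.
Qed.

Section one_fragment.
Variables (n : nat) (y : Y).
Hypothesis By : B n y.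

Let fyL : forall s t, fdom y s -> fdom y t ->
  `|along f y s - along f y t| <= L n * `|s - t|.
Proof.
have [/frag_lipP yL _] := By.
by apply: (fcurve_lipschitz_along (lip_constP f)).
Qed.

Let aM s : fdom y s -> `|along f y s| <= sup_norm f.
Proof. by move=> ys; rewrite alongE// sup_normP. Qed.

Let FL : forall s t, `|F n y s - F n y t| <= L n * `|s - t|.
Proof. exact: (mcshane_lipschitz (fdom_neq0 y) aM (L0 n)). Qed.

Let FE s : fdom y s -> F n y s = along f y s.
Proof. exact: (mcshane_ext (fdom_neq0 y) aM (L0 n) fyL). Qed.

Let slope_le m k : `|slope n m y k| <= L n.
Proof.
rewrite /slope normrM normfV ler_pdivrMr ?FL// normr_gt0 gridS addrAC subrr add0r.
by rewrite gt_eqF.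
Qed.

Let D m k : set (borel X) := frag_im_itv y (grid n m k) (grid n m k.+1).
Let s_ m (x : X) : R := \sum_(k < N n m) psi (slope n m y k) * (\1_(D m k) x * g x).

Let mD m k : measurable (D m k). Proof. exact: frag_im_itv_measurable. Qed.

Let m1g m k : measurable_fun [set: borel X] (fun x => \1_(D m k) x * g x).
Proof. by apply: measurable_funM. Qed.

Let b1g m k x : `|\1_(D m k) x * g x| <= M.
Proof.
rewrite normrM indicE; case: (x \in D m k); first by rewrite normr1 mul1r.
by rewrite normr0 mul0r (le_trans (normr_ge0 _) (gM x)).
Qed.

Let SE m : S n m y = (\int[alb_nu A y]_x (s_ m x)%:E)%E.
Proof.
rewrite /S /s_.
under [RHS]eq_integral do rewrite -sumEFin.
rewrite integral_sum//; last first.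
  move=> k; have := integrableZl measurableT (psi (slope n m y k))
    (bounded_integrable (alb_nu A y) (m1g m k) (b1g m k)).
  by apply: eq_integrable => // x _; rewrite /= EFinM.
apply: eq_bigr => k _; rewrite integral_indicM.
under [RHS]eq_integral do rewrite EFinM.
by rewrite integralZl//; exact: bounded_integrable (m1g m k) (b1g m k).
Qed.

(** Off the grid a point of the image lies in exactly one piece. *)
Let s_E m x : frag_im y x -> ~ Z (frag_inv y x) ->
  exists k : nat, grid n m k <= frag_inv y x <= grid n m k.+1 /\
    s_ m x = psi (slope n m y k) * g x.
Proof.
move=> ix nZ; have [yt tx] := frag_im_inv ix.
set t := frag_inv y x in nZ yt tx *.
have nZk j : t != grid n m j by apply/eqP => tj; apply: nZ; exists (n, m, j).
have [_ /(_ _ yt)] := By; rewrite ler_norml => /andP[nt tn].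
have u0 : 0 <= (t + n%:R) * m.+1%:R by rewrite mulr_ge0//; lra.
pose k := Num.trunc ((t + n%:R) * m.+1%:R).
have /andP[k1 k2] := truncn_itv u0; rewrite -/k in k1 k2.
have m0 : 0 < (m.+1%:R : R) by [].
have gk1 : grid n m k <= t.
  rewrite /grid addrC lerBlDr -(ler_pM2r m0) divfK ?gt_eqF//.
have gk2 : t < grid n m k.+1.
  rewrite /grid addrC ltrBrDr -(ltr_pM2r m0) divfK ?gt_eqF//.
have gtop : grid n m (N n m) = n%:R.
  by rewrite /grid /N natrM mulfK ?gt_eqF// natrM; lra.
have kN : (k < N n m)%N.
  rewrite -(grid_mono n m) gtop; apply: (lt_le_trans _ tn).
  by rewrite lt_neqAle gk1 eq_sym nZk.
exists k; split; first by rewrite gk1 ltW.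
rewrite /s_ (bigD1 (Ordinal kN))//= big1 ?addr0.
  rewrite indicE mem_set ?mul1r// /D frag_im_itvE; exists t => //; split => //=.
  by rewrite in_itv/= gk1 ltW.
move=> [j /= jN] /eqP jk; rewrite indicE memNset ?mul0r ?mulr0//.
rewrite /D frag_im_itvE => -[s [ys /=]]; rewrite in_itv/= => /andP[js sj] sx.
have st : s = t by apply: (fcurve_inj ys yt); rewrite sx.
rewrite st in js sj.
apply: jk; apply: val_inj => /=.
have : (j < k.+1)%N by rewrite -(grid_mono n m); exact: le_lt_trans js gk2.
have : (k < j.+1)%N.
  rewrite -(grid_mono n m) (lt_le_trans _ sj)// lt_neqAle gk1 eq_sym nZk//.
by rewrite !ltnS => h1 h2; apply/eqP; rewrite eqn_leq h1 h2.
Qed.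

Let psi_bound r : `|r| <= L n -> `|psi r| <= L n + c.
Proof. by move=> rL; rewrite (le_trans (psile r))// lerD2r. Qed.

Let M0 : 0 <= M. Proof. exact: le_trans (normr_ge0 _) (gM point). Qed.

Let ae_slope : {ae alb_nu A y, forall x, [/\ frag_im y x, ~ Z (frag_inv y x) &
   has_slope (F n y) (frag_inv y x) (frag_partial f y x)]}.
Proof.
have [h [mh hL hE hsl]] := lipschitz_ae_slope FL.
have := frag_ae_derivable (f := f) FE hsl.
have nZ : {ae leb, forall t, ~ Z t}.
  exists Z; split; last by move=> t /= /contrapT.
    by apply: countable_measurable; [move=> t; exact: measurable_set1|exact: Z_countable].
  exact: countable_lebesgue_measure0.
move=> dF; pose Q t := [/\ ~ Z t, has_slope (F n y) t (h t) &
    fdom y t -> frag_derivable f y t /\ frag_derive f y t = h t].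
have /(nu_ae_im (@ac y)) : {ae leb, forall t, Q t}.
  by apply: (@filterS3 _ _ (ae_filter_ringOfSetsType leb) _ _ _ _ _ nZ hsl dF).
apply: (@filterS _ _ (ae_filter_ringOfSetsType (alb_nu A y))) => x [ix [nZx sl dx]].
have [yt _] := frag_im_inv ix; split => //.
by rewrite frag_partialE//; have [_ ->] := dx yt.
Qed.

(** At almost every point of the image the cells shrink to a point where the
    extension has a slope, so the integrands converge pointwise ([straddle]);
    they are bounded because [psi] grows at most linearly and the slopes are
    bounded. *)
Lemma riemann_cvg : S n m y @[m --> \oo] -->
  (\int[alb_nu A y]_x (g x * psi (frag_partial f y x))%:E)%E.
Proof.
have [mp pL] := frag_partial_measurable (L0 n) fyL.
have mpsi : measurable_fun [set: R] psi by exact: continuous_measurable_fun.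
under eq_fun do rewrite SE.
have [] // := @dominated_convergence _ (borel X) R (alb_nu A y) setT measurableT
  (fun m x => (s_ m x)%:E) (fun x => (g x * psi (frag_partial f y x))%:E)
  (cst ((L n + c) * M)%:E).
- move=> m; apply/measurable_EFinP; apply: measurable_sum => k.
  by apply: measurable_funM.
- apply/measurable_EFinP; apply: measurable_funM => //.
  exact: measurableT_comp.
- apply: (@filterS _ _ (ae_filter_ringOfSetsType (alb_nu A y)) _ _ _ ae_slope) => x [ix nZ sl] _.
  apply: cvg_EFin; first exact: nearW.
  apply/cvgrPdist_lt => e e0 /=.
  have gx1 : 0 < `|g x| + 1 by rewrite ltr_wpDl.
  have /cvgrPdist_lt /(_ (e / (`|g x| + 1))) := @cpsi (frag_partial f y x).
  rewrite divr_gt0// => /(_ isT) /nbhs_ballP[r /= r0 hr].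
  have [dl dl0 hdl] := straddle sl (divr_gt0 r0 (ltr0n R 2)).
  exists (Num.trunc dl^-1) => // m /= mdl.
  have [k [/andP[k1 k2] ->]] := s_E m ix nZ.
  have sk : `|frag_partial f y x - slope n m y k| < r.
    rewrite distrC (le_lt_trans (hdl _ _ _ _ _))//.
    - by rewrite k1 k2.
    - by rewrite gridS ltrDl.
    - rewrite gridS addrAC subrr add0r invf_plt ?posrE//.
      by apply: (lt_le_trans (truncnS_gt _)); rewrite ler_nat ltnS.
    - by rewrite ltr_pdivrMr// ltr_pMr// ltr1n.
  have := hr _ sk; rewrite ltr_pdivlMr// => h.
  rewrite (mulrC (psi _)) -mulrBr normrM; apply: le_lt_trans h.
  by rewrite mulrC ler_wpM2l// lerDl.
- by apply: finite_measure_integrable_cst.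
- apply: (@filterS _ _ (ae_filter_ringOfSetsType (alb_nu A y)) _ _ _ ae_slope) => x [ix nZ _] m _; rewrite lee_fin.
  have [k [_ ->]] := s_E m ix nZ.
  by rewrite normrM; apply: ler_pM => //; apply: psi_bound; exact: slope_le.
Qed.

End one_fragment.

(** The function [psi] covers three uses: the identity, a constant (which gives
    the measurability of [y |-> nu_y E]), and a truncation of the derivative. *)
Lemma frag_partial_integral_measurable : measurable_fun [set: Y]
  (fun y => (\int[alb_nu A y]_x (g x * psi (frag_partial f y x))%:E)%E).
Proof.
rewrite -B_cover; apply/measurable_fun_bigcup => [n|n]; first exact: mB.
apply: (emeasurable_fun_cvg (fun m => S n m)).
- by move=> m; exact: measurable_funTS.
- by move=> y By; exact: riemann_cvg.
Qed.

End riemann_sums.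

End fragment_measurability.

(** * Calculus along one fragment *)

Section fragment_calculus.
Context {R : realType} {X : completeMetricType R}.
Notation leb := (@lebesgue_measure R).
Variables (A : alberti_pair X) (y : fragment X).
Hypothesis ac : alb_nu A y `<< (fun E : set (borel X) => hausdorff1 (E `&` frag_im y)).

Lemma frag_lip_along (f : LipB X) (C : R) : frag_lip C y ->
  forall s t, fdom y s -> fdom y t ->
    `|along f y s - along f y t| <= lip_const f * C * `|s - t|.
Proof.
move=> /frag_lipP yC; apply: (fcurve_lipschitz_along (lip_constP f)) => //.
exact: lip_const_ge0 f.
Qed.

Lemma frag_lip_exists : exists2 L, 0 <= L & frag_lip L y.
Proof.
have [c [L [_ L0 yL]]] := fcurve_bilip y; exists L => //.
by apply/frag_lipP => s t ys yt; have /andP[] := yL _ _ ys yt.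
Qed.

Lemma along_lip_exists (f : LipB X) : exists2 L, 0 <= L &
  forall s t, fdom y s -> fdom y t ->
    `|along f y s - along f y t| <= L * `|s - t|.
Proof.
have [L L0 yL] := frag_lip_exists; exists (lip_const f * L).
  by rewrite mulr_ge0//; exact: lip_const_ge0 f.
exact: frag_lip_along.
Qed.

Lemma frag_partial_bounded (f : LipB X) : exists2 L, 0 <= L &
  measurable_fun [set: borel X] (frag_partial f y) /\
  forall x, `|frag_partial f y x| <= L.
Proof.
have [L L0 fL] := along_lip_exists f; exists L => //.
exact: frag_partial_measurable L0 fL.
Qed.

Lemma frag_partial_le (f : LipB X) (C : R) : 0 <= C -> frag_lip C y ->
  forall x, `|frag_partial f y x| <= lip_const f * C.
Proof.
move=> C0 yC; have L0 : 0 <= lip_const f * C.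
  by rewrite mulr_ge0//; exact: lip_const_ge0 f.
exact: (frag_partial_measurable L0 (frag_lip_along f yC)).2.
Qed.

Lemma nu_ae_derivable (f : LipB X) :
  {ae alb_nu A y, forall x, frag_im y x /\ frag_derivable f y (frag_inv y x)}.
Proof.
have [L L0 fL] := along_lip_exists f.
have [F [FL FE]] := frag_extension fL L0.
have [h [mh hL hE hsl]] := lipschitz_ae_slope FL.
have /(nu_ae_im ac) := frag_ae_derivable (f := f) FE hsl.
apply: (@filterS _ _ (ae_filter_ringOfSetsType (alb_nu A y))) => x [ix dx].
by split=> //; have [yt _] := frag_im_inv ix; exact: (dx yt).1.
Qed.

Lemma frag_partial_integrable (f : LipB X) (g : borel X -> R) (M : R) :
  measurable_fun setT g -> (forall x, `|g x| <= M) ->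
  (alb_nu A y).-integrable setT (fun x => (g x * frag_partial f y x)%:E).
Proof.
move=> mg gM; have [L L0 [mp pL]] := frag_partial_bounded f.
apply: (@bounded_integrable _ _ _ _ _ (M * L)); first exact: measurable_funM.
by move=> x; rewrite normrM ler_pM.
Qed.

Let derive_along_measurable (f : LipB X) (g : borel X -> R) (M : R) :
  measurable_fun setT g -> (forall x, `|g x| <= M) ->
  let u t := frag_derive f y t * along g y t in
  measurable_fun [set: measurableTypeR R] u /\ exists K, forall t, `|u t| <= K.
Proof.
move=> mg gM; have [L L0 fL] := along_lip_exists f.
have M0 : 0 <= M by exact: le_trans (normr_ge0 _) (gM point).
split.
  apply: measurable_funM; first exact: (frag_derive_measurable fL L0).
  exact: along_measurable.
exists (L * M) => t; rewrite normrM ler_pM//; first exact: frag_derive_le.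
exact: along_bound.
Qed.

Let derive_along_off (f : LipB X) (g : borel X -> R) t : ~ fdom y t ->
  frag_derive f y t * along g y t = 0.
Proof.
move=> nt; rewrite /frag_derive; case: asboolP => [[]//|_]; exact: mul0r.
Qed.

Lemma dom_integrable (f : LipB X) (g : borel X -> R) (M : R) :
  measurable_fun setT g -> (forall x, `|g x| <= M) ->
  (alb_push A y).-integrable (fdom y)
      (fun t => (frag_derive f y t * along g y t)%:E).
Proof.
move=> mg gM; have [mu [K uK]] := derive_along_measurable f mg gM.
have := bounded_integrable (frag_push A y) mu uK.
move/integrableS; apply => //; exact: fdom_measurable.
Qed.

Lemma dom_integralE (f : LipB X) (g : borel X -> R) (M : R) :
  measurable_fun setT g -> (forall x, `|g x| <= M) ->
  dom_integral A f g y = im_integral A f g y.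
Proof.
move=> mg gM; have [mu [K uK]] := derive_along_measurable f mg gM.
rewrite /im_integral.
rewrite (push_integral (y:=y) ac mu uK (derive_along_off f g)); last 2 first.
- have [L L0 [mp pL]] := frag_partial_bounded f.
  exact: measurable_funM.
- move=> x ix; have [yt tx] := frag_im_inv ix.
  by rewrite frag_partialE// alongE// tx mulrC.
rewrite /dom_integral (_ : alb_push A y = frag_push A y :> (_ -> _))// integral_mkcond; apply: eq_integral => t _.
rewrite patchE; case: ifPn => // /negP nt.
by rewrite derive_along_off// => yt; apply: nt; exact/mem_set.
Qed.

Lemma frag_deriveP (f : X -> R) t l : fdom y t -> limit_point (fdom y) t ->
  frag_quotient f y t @ within (fdom y) t^' --> l -> frag_derive f y t = l.
Proof.
move=> yt lt_ fl; have PF := limit_point_proper lt_.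
have df : frag_derivable f y t by split => //; apply/cvg_ex; exists l.
by rewrite /frag_derive; case: asboolP => // _; exact: cvg_lim.
Qed.

Lemma alongD (a : R) (f g : LipB X) t :
  along (a *: f + g) y t = a * along f y t + along g y t.
Proof.
have [yt|nt] := pselect (fdom y t); first by rewrite !alongE.
by rewrite !along_off// mulr0 addr0.
Qed.

Lemma alongM (f g : LipB X) t : along (f * g) y t = along f y t * along g y t.
Proof.
have [yt|nt] := pselect (fdom y t); first by rewrite !alongE.
by rewrite !along_off// mulr0.
Qed.

Lemma frag_deriveD (a : R) (f g : LipB X) t :
  frag_derivable f y t -> frag_derivable g y t ->
  frag_derive (a *: f + g) y t = a * frag_derive f y t + frag_derive g y t.
Proof.
move=> df dg; have [yt lt_ _] := df; apply: frag_deriveP => //.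
have -> : frag_quotient (a *: f + g) y t =
    (fun s => a * frag_quotient f y t s + frag_quotient g y t s).
  by apply/funext => s; rewrite /frag_quotient !alongD; ring.
by apply: cvgD; [apply: cvgMl_tmp|]; exact: frag_derivable_cvg.
Qed.

(** The quotient of the product is
    [f(t) Qg + g(t) Qf + (s - t) Qf Qg], where [Qf] and [Qg] are the quotients
    of the factors; the last term tends to [0]. *)
Lemma frag_deriveM (f g : LipB X) t :
  frag_derivable f y t -> frag_derivable g y t ->
  frag_derive (f * g) y t =
    along f y t * frag_derive g y t + along g y t * frag_derive f y t.
Proof.
move=> df dg; have [yt lt_ _] := df; apply: frag_deriveP => //.
have s0 : (fun s => s - t) @ within (fdom y) t^' --> (0 : R).
  apply/cvgrPdist_lt => e e0; rewrite !near_withinE.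
  apply/nbhs_ballP; exists e => //= s st _ _.
  by rewrite sub0r normrN distrC.
have -> : along f y t * frag_derive g y t + along g y t * frag_derive f y t =
    along f y t * frag_derive g y t + along g y t * frag_derive f y t +
    0 * (frag_derive f y t * frag_derive g y t) by rewrite mul0r addr0.
have -> : frag_quotient (f * g) y t = (fun s => along f y t * frag_quotient g y t s +
    along g y t * frag_quotient f y t s +
    (s - t) * (frag_quotient f y t s * frag_quotient g y t s)).
  apply/funext => s; rewrite /frag_quotient !alongM.
  have [->|st] := eqVneq s t; first by rewrite !subrr; ring.
  by field; rewrite subr_eq0.
apply: cvgD; first by apply: cvgD; apply: cvgMl_tmp; exact: frag_derivable_cvg.
by apply: cvgM => //; apply: cvgM; exact: frag_derivable_cvg.
Qed.

Lemma frag_partialD (a : R) (f g : LipB X) : {ae alb_nu A y, forall x,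
  frag_partial (a *: f + g) y x = a * frag_partial f y x + frag_partial g y x}.
Proof.
apply: (@filterS2 _ _ (ae_filter_ringOfSetsType (alb_nu A y)) _ _ _ _
  (nu_ae_derivable f) (nu_ae_derivable g)) => x [ix df] [_ dg].
by rewrite !frag_partialE//; exact: frag_deriveD.
Qed.

Lemma frag_partialM (f g : LipB X) : {ae alb_nu A y, forall x,
  frag_partial (f * g) y x = f x * frag_partial g y x + g x * frag_partial f y x}.
Proof.
apply: (@filterS2 _ _ (ae_filter_ringOfSetsType (alb_nu A y)) _ _ _ _
  (nu_ae_derivable f) (nu_ae_derivable g)) => x [ix df] [_ dg].
rewrite !frag_partialE// frag_deriveM//.
by have [yt tx] := frag_im_inv ix; rewrite !alongE// tx.
Qed.

End fragment_calculus.

(** * Classes of essentially bounded functions *)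

Section Linf_classes.
Context {R : realType} {X : completeMetricType R}.
Variable mu : {measure set (borel X) -> \bar R}.

Lemma Linf_measurable (u : Linf mu) : measurable_fun [set: borel X] (u : borel X -> R).
Proof. exact (measurable_funPT (repr (u : {mfun_ mu, borel X >-> measurableTypeR R}))). Qed.

Lemma finite_norm_le (u : borel X -> R) (M : R) : 0 <= M ->
  {ae mu, forall x, `|u x| <= M} -> ('N[mu]_+oo[EFin \o u] <= M%:E)%E.
Proof.
move=> M0 uM; rewrite unlock /Lnorm; case: ifP => _; last by rewrite lee_fin.
apply/ess_sup_inf.ess_supP; apply: (@filterS _ _ (ae_filter_ringOfSetsType mu) _ _ _ uM) => x.
by rewrite /= lee_fin.
Qed.

Lemma Linf_norm_le (u : Linf mu) (M : R) : 0 <= M ->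
  {ae mu, forall x, `|u x| <= M} -> (Linf_norm u <= M%:E)%E.
Proof. exact: finite_norm_le. Qed.

(** An element is a class modulo equality almost everywhere together with a
    proof that its norm is finite; the class determines the proof. *)
Lemma Linf_eq (u v : Linf mu) : {ae mu, forall x, u x = v x} -> u = v.
Proof.
move=> uv.
have : (u : {mfun_ mu, borel X >-> measurableTypeR R}) = v.
  rewrite -[LHS]reprK -[RHS]reprK; apply/eqmodP/asboolP.
  by apply: (@filterS _ _ (ae_filter_ringOfSetsType mu) _ _ _ uv).
case: u v {uv} => [u [[pu]]] [v [[pv]]] /= uv; subst v.
by rewrite (Prop_irrelevance pu pv).
Qed.

(** The representative chosen in the class of [u] need not be [u] itself, hence
    the conclusion up to a null set. *)
Lemma Linf_exists (u : borel X -> R) (M : R) :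
  0 <= M -> measurable_fun setT u -> {ae mu, forall x, `|u x| <= M} ->
  exists v : Linf mu, {ae mu, forall x, v x = u x}.
Proof.
move=> M0 mu_ uM.
have mu' : @measurable_fun _ _ (borel X) (measurableTypeR R) setT u by exact mu_.
pose um : {mfun borel X >-> measurableTypeR R} :=
  HB.pack_for {mfun borel X >-> measurableTypeR R} u
    (@isMeasurableFun.Build _ _ (borel X) (measurableTypeR R) u mu').
pose w : {mfun_ mu, borel X >-> measurableTypeR R} := (\pi um)%qT.
have wu : {ae mu, forall x, w x = u x}.
  have /eqmodP/asboolP : (\pi_({mfun_ mu, borel X >-> measurableTypeR R}) (repr w) = \pi um)%qT.
    by rewrite reprK.
  by apply: (@filterS _ _ (ae_filter_ringOfSetsType mu)) => x; apply.
have fw : finite_norm mu +oo w.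
  apply: le_lt_trans (ltry M); apply: finite_norm_le => //.
  by apply: (@filterS2 _ _ (ae_filter_ringOfSetsType mu) _ _ _ _ wu uM) => x -> //.
pose v : Linf mu := HB.pack_for (LspaceType mu (leey 1)) w
  (isFinLebesgue.Build _ _ _ mu _ (leey 1) w fw).
by exists v.
Qed.

End Linf_classes.

(** * The density of the averaged derivatives *)

Section alberti_density.
Context {R : realType} {X : completeMetricType R}.
Variables (mu : {measure set (borel X) -> \bar R}) (sf : sigma_finite setT mu).
Variables (A : alberti_pair X) (hA : is_alberti mu A) (C : R) (AC : alberti_lip C A).
Notation Y := (bfragment (alb_frag A)).
Notation P := (alb_P A).

Let ac := alb_ac hA.

Let outer_mfun (f : LipB X) (psi : R -> R) (c : R) (g : borel X -> R) (M : R) :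
  continuous psi -> (forall r, `|psi r| <= `|r| + c) ->
  measurable_fun setT g -> (forall x, `|g x| <= M) ->
  measurable_fun [set: Y]
    (fun y => (\int[alb_nu A y]_x (g x * psi (frag_partial f y x))%:E)%E).
Proof. exact: frag_partial_integral_measurable ac (alb_measurable hA) _ _ _ _ _. Qed.

(** Some fragment is [C]-Lipschitz, and its domain has two distinct points
    because it has positive measure. *)
Lemma lip_ge0 : 0 <= C.
Proof.
have [y yC] : exists y : fragment X, frag_lip C y.
  apply: contrapT => h; move: AC; rewrite /alberti_lip.
  rewrite (_ : [set y : fragment X | frag_lip C y] = set0) ?measure0.
    by move=> /eqP; rewrite eqe eq_sym oner_eq0.
  by apply/seteqP; split => // y yC; apply: h; exists y.
have [t0 Kt0] := fdom_neq0 y.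
have [s [ys st]] : exists s, fdom y s /\ s != t0.
  apply: contrapT => h; have := @fdom_pos R X y.
  have : fdom y `<=` [set t0].
    by move=> s ys /=; apply: contrapT => /eqP st; apply: h; exists s.
  move=> yt0 h2; have : (lebesgue_measure (fdom y) <= lebesgue_measure [set t0])%E.
    apply: le_measure => //; rewrite inE; first exact: fdom_measurable.
    exact: measurable_set1.
  by rewrite lebesgue_measure_set1 leNgt h2.
have /frag_lipP/(_ _ _ ys Kt0) h := yC.
have st0 : 0 < `|s - t0| by rewrite normr_gt0 subr_eq0.
by rewrite -(pmulr_lge0 _ st0) (le_trans _ h)// mdist_ge0.
Qed.

Lemma ae_lip : {ae P, forall y, frag_lip C y}.
Proof.
have mC : measurable ([set y | frag_lip C y] : set Y) by exact: frag_lip_measurable.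
exists (~` [set y | frag_lip C y]); split => //; first exact: measurableC.
by rewrite probability_setC// AC subee.
Qed.

Lemma alberti_measurable (E : set (borel X)) : measurable E ->
  measurable_fun [set: Y] (fun y => alb_nu A y E).
Proof.
move=> mE; have h := @outer_mfun 0 (cst 1) 1 \1_E 1.
rewrite (_ : (fun y : Y => alb_nu A y E) =
  (fun y : Y => \int[alb_nu A y]_x (\1_E x * cst 1 (frag_partial (0 : LipB X) y x))%:E)%E).
  apply: h => //; first by move=> r; exact: cvg_cst.
    by move=> r; rewrite /= normr1 lerDr.
  exact: indic_le1.
by apply/funext => y; rewrite -integral_indicM/= integral_one.
Qed.

Lemma alberti_ge0_integral (g : borel X -> R) : measurable_fun setT g ->
  (forall x, 0 <= g x) ->
  measurable_fun [set: Y] (fun y => \int[alb_nu A y]_x (g x)%:E)%E /\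
  (\int[mu]_x (g x)%:E = \int[P]_y \int[alb_nu A y]_x (g x)%:E)%E.
Proof.
move=> mg g0.
have [] := @ge0_disintegration _ _ (borel X) Y R mu P (fun y => alb_nu A y)
  (fun=> 1) (fun _ _ => 1) _ _ _ _ _ _ g mg g0 => //.
- move=> E mE; under eq_fun do rewrite integral_one//.
  exact: alberti_measurable.
- move=> E mE; rewrite integral_one// (alb_disintegration hA)//.
  by apply: eq_integral => y _; rewrite integral_one//.
move=> h1 h2; split.
  move: h1; under [X in measurable_fun _ X]eq_fun do under eq_integral do rewrite /= mulr1.
  by [].
move: h2; under eq_integral do rewrite /= mulr1.
move=> ->; apply: eq_integral => y _.
by apply: eq_integral => x _; rewrite /= mulr1.
Qed.

Section density.
Variable f : LipB X.
Let K := lip_const f * C.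
(** The translate by [K] of the truncation between [- K] and [K]. For almost
    every fragment the derivatives lie in this range, so nothing is changed, but the
    truncation makes the shifted derivative nonnegative and bounded for every
    fragment. *)
Let psi (r : R) : R := Num.min (Num.max (r + K) 0) (2 * K).
Let rho y x : R := psi (frag_partial f y x).

Let K0 : 0 <= K.
Proof. by rewrite mulr_ge0 ?lip_ge0//; exact: lip_const_ge0 f. Qed.

Let psi0 r : 0 <= psi r <= 2 * K.
Proof.
have K2 : 0 <= 2 * K by rewrite mulr_ge0.
by rewrite /psi le_min le_max lexx orbT K2 ge_min lexx orbT.
Qed.

Let psiE r : `|r| <= K -> psi r = r + K.
Proof.
rewrite ler_norml => /andP[h1 h2]; rewrite /psi (max_idPl _); last by lra.
by apply/min_idPl; lra.
Qed.

Let cpsi : continuous psi.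
Proof.
apply: min_fun_continuous; last by move=> r; exact: cvg_cst.
apply: max_fun_continuous; last by move=> r; exact: cvg_cst.
by move=> r; apply: cvgD; [exact: cvg_id|exact: cvg_cst].
Qed.

Let psi_le r : `|psi r| <= `|r| + 2 * K.
Proof.
have /andP[p0 pK] := psi0 r; rewrite ger0_norm//; have := normr_ge0 r; lra.
Qed.

Let mrho y : measurable_fun [set: borel X] (rho y).
Proof.
have [L L0 [mp pL]] := frag_partial_bounded y f.
have mpsi : measurable_fun [set: R] psi by exact: continuous_measurable_fun.
exact: (measurableT_comp mpsi mp).
Qed.

Let mKrho E : measurable E -> measurable_fun [set: Y]
  (fun y => (\int[alb_nu A y]_(x in E) (rho y x)%:E)%E).
Proof.
move=> mE; under eq_fun do rewrite integral_indicM.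
by apply: (@outer_mfun f psi (2 * K) _ 1) => //; exact: indic_le1.
Qed.

Let rho0 y x : 0 <= rho y x. Proof. by have /andP[] := psi0 (frag_partial f y x). Qed.

Let lam (E : set (borel X)) : \bar R := (\int[P]_y \int[alb_nu A y]_(x in E) (rho y x)%:E)%E.

Let lam0 : lam set0 = 0%E.
Proof. by rewrite /lam; under eq_integral do rewrite integral_set0; rewrite integral0. Qed.

Let lam_ge0 E : (0 <= lam E)%E.
Proof. by do 2 (apply: integral_ge0 => ? _); rewrite lee_fin. Qed.

Let lam_sigma : semi_sigma_additive lam.
Proof.
move=> F mF tF mUF; rewrite [X in _ --> X](_ : _ = (\sum_(i <oo) lam (F i))%E).
  apply: is_cvg_nneseries => n _ _; exact: lam_ge0.
rewrite /lam -integral_nneseries//; last 2 first.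
- by move=> n; exact: mKrho.
- by move=> n y _; apply: integral_ge0 => x _; rewrite lee_fin.
apply: eq_integral => y _; rewrite ge0_integral_bigcup//.
  by apply/measurable_EFinP; exact: measurable_funTS.
by move=> x _; rewrite lee_fin.
Qed.

HB.instance Definition _ := isMeasure.Build _ _ _ lam lam0 lam_ge0 lam_sigma.

Let lam_le E : measurable E -> (lam E <= (2 * K)%:E * mu E)%E.
Proof.
move=> mE; rewrite (alb_disintegration hA)// -ge0_integralZl_EFin//; last 2 first.
- exact: alberti_measurable.
- by rewrite mulr_ge0.
apply: ge0_le_integral => //.
- by move=> y _; apply: integral_ge0 => x _; rewrite lee_fin.
- exact: mKrho.
- by apply: measurable_funeM; exact: alberti_measurable.
move=> y _; rewrite -integral_cst//; apply: ge0_le_integral => //.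
- by move=> x _; rewrite lee_fin.
- by apply/measurable_EFinP; exact: measurable_funTS.
- by move=> x _; rewrite lee_fin; have /andP[] := psi0 (frag_partial f y x).
Qed.

Let outer_measurable (g : borel X -> R) (M : R) : measurable_fun setT g ->
  (forall x, `|g x| <= M) -> measurable_fun [set: Y] (im_integral A f g).
Proof.
move=> mg gM; apply: (@outer_mfun f id 0 g M) => //; first by move=> r; exact: cvg_id.
by move=> r; rewrite addr0.
Qed.

(** The density of [lam], shifted back by [K]. For [g >= 0] the formula is the
    difference of the disintegration formulas for [lam] and for [mu], both of
    which are finite; a general [g] is the difference of [g + |g|] and [|g|]. *)
Lemma alberti_density : exists q : borel X -> R,
  [/\ measurable_fun setT q, forall x, `|q x| <= K &
    forall (g : borel X -> R) (M : R), measurable_fun setT g -> (forall x, `|g x| <= M) ->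
      mu.-integrable setT (EFin \o g) ->
      P.-integrable setT (im_integral A f g) /\
      (\int[mu]_x (g x * q x)%:E = \int[P]_y im_integral A f g y)%E].
Proof.
have K2 : 0 <= 2 * K by rewrite mulr_ge0.
have [q0 [mq0 q0b q0E]] := bounded_density sf K2 lam_le.
have q00 x : 0 <= q0 x by have /andP[] := q0b x.
have qK x : `|q0 x - K| <= K.
  by have := q0b x => /andP[h1 h2]; rewrite ler_norml; lra.
exists (fun x => q0 x - K); split; first exact: measurable_funB.
  exact: qK.
have ge0_dis := @ge0_disintegration _ _ (borel X) Y R mu P (fun y => alb_nu A y)
  q0 rho mq0 q00 mrho rho0 mKrho (fun E mE => esym (q0E E mE)).
have pos (u : borel X -> R) (M : R) : measurable_fun setT u -> (forall x, 0 <= u x) ->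
    (forall x, u x <= M) -> mu.-integrable setT (EFin \o u) ->
    P.-integrable setT (im_integral A f u) /\
    (\int[mu]_x (u x * (q0 x - K))%:E = \int[P]_y im_integral A f u y)%E.
  move=> mu_ u0 uM iu.
  have uM' x : `|u x| <= M by rewrite ger0_norm.
  have [mPhi EPhi] := ge0_dis u mu_ u0.
  have [mPsi EPsi] := alberti_ge0_integral mu_ u0.
  set Phi := (fun y => _) in mPhi; set Psi := (fun y => _) in mPsi.
  have iuq : mu.-integrable setT (EFin \o (fun x => u x * q0 x)).
    apply: (integrableM_bounded (M := 2 * K)) => // x _.
    by have /andP[q1 q2] := q0b x; rewrite ger0_norm.
  have Phi0 y : (0 <= Phi y)%E by apply: integral_ge0 => x _; rewrite lee_fin mulr_ge0.
  have Psi0 y : (0 <= Psi y)%E by apply: integral_ge0 => x _; rewrite lee_fin.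
  have int0 (h : Y -> \bar R) : measurable_fun setT h -> (forall y, 0 <= h y)%E ->
      (\int[P]_y h y < +oo)%E -> P.-integrable setT h.
    move=> mh h0 hoo; apply/integrableP; split => //.
    by under eq_integral do rewrite gee0_abs//.
  have fin_int (h : borel X -> R) : mu.-integrable setT (EFin \o h) ->
      (\int[mu]_x (h x)%:E < +oo)%E.
    by move=> ih; have := integral_fune_lt_pinfty measurableT ih.
  have iPhi : P.-integrable setT Phi.
    by apply: int0 => //; rewrite -EPhi; exact: fin_int.
  have iPsi : P.-integrable setT Psi.
    by apply: int0 => //; rewrite -EPsi; exact: fin_int.
  have iK : P.-integrable setT (fun y => K%:E * Psi y)%E by exact: integrableZl.
  have mI := outer_measurable mu_ uM'.
  have IE : ae_eq P setT (fun y => Phi y - K%:E * Psi y)%E (im_integral A f u).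
    apply: (@filterS _ _ (ae_filter_ringOfSetsType P) _ _ _ ae_lip) => y yC _.
    have [L L0 [mp pL]] := frag_partial_bounded y f.
    have inu := bounded_integrable (alb_nu A y) mu_ uM'.
    have iur : (alb_nu A y).-integrable setT (EFin \o (fun x => u x * rho y x)).
      apply: (integrableM_bounded (M := 2 * K)) => // x _.
      by have /andP[q1 q2] := psi0 (frag_partial f y x); rewrite ger0_norm.
    rewrite /im_integral /Phi /Psi -integralZl// -integralB//; last exact: integrableZl.
    apply: eq_integral => x _; rewrite -EFinM -EFinB; congr (_%:E).
    rewrite /rho psiE; last exact: frag_partial_le lip_ge0 yC x.
    by ring.
  split; first by apply: (integrable_ae_eq mI IE); exact: integrableB.
  have <- : (\int[P]_y (Phi y - K%:E * Psi y) = \int[P]_y im_integral A f u y)%E.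
    apply: ae_eq_integral => //.
    by apply: emeasurable_funB => //; exact: measurable_int iK.
  rewrite integralB// integralZl// -EPhi -EPsi -integralZl// -integralB//; last exact: integrableZl.
  by apply: eq_integral => x _; rewrite -EFinM -EFinB mulrBr (mulrC K).
move=> g M mg gM ig.
have M0 : 0 <= M by exact: le_trans (normr_ge0 _) (gM point).
pose g2 := (fun x : borel X => `|g x|).
have mng : measurable_fun [set: borel X] g2 by exact: measurableT_comp.
have ing : mu.-integrable setT (EFin \o g2) by exact: integrable_norm.
have [i2 e2] := pos _ M mng (fun x => normr_ge0 _) gM ing.
pose g1 := (fun x : borel X => g x + `|g x|).
have ig1 : mu.-integrable setT (EFin \o g1) by exact: (integrableD measurableT ig ing).
have [i1 e1] : P.-integrable setT (im_integral A f g1) /\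
    (\int[mu]_x (g1 x * (q0 x - K))%:E =
     \int[P]_y im_integral A f g1 y)%E.
  apply: (pos _ (M + M)).
  - exact: measurable_funD.
  - by move=> x; have := ler_norm (- g x); rewrite /g1 normrN; lra.
  - by move=> x; have := gM x; have := ler_norm (g x); rewrite /g1; lra.
  - exact: ig1.
have IE y : im_integral A f g y =
    (im_integral A f g1 y - im_integral A f g2 y)%E.
  rewrite /im_integral -integralB_EFin//.
  - by apply: eq_integral => x _; rewrite -EFinB -mulrBl /g1 addrK.
  - apply: (@frag_partial_integrable _ _ _ _ _ _ (M + M)); first exact: measurable_funD.
    by move=> x; rewrite (le_trans (ler_normD _ _))// lerD// ?normr_id.
  - by apply: (@frag_partial_integrable _ _ _ _ _ _ M) => // x; rewrite /g2 normr_id.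
split.
  rewrite (_ : im_integral A f g = im_integral A f g1 \-
    im_integral A f g2)%E; first exact: integrableB.
  by apply/funext => y; exact: IE.
have -> : (\int[P]_y im_integral A f g y =
    \int[P]_y (im_integral A f g1 y - im_integral A f g2 y))%E.
  by apply: eq_integral => y _; exact: IE.
rewrite integralB// -e1 -e2 -integralB_EFin//.
- by apply: eq_integral => x _; rewrite -EFinB -mulrBl /g1 addrK.
- apply: (integrableM_bounded (M := K)) => //; exact: measurable_funB.
- by apply: (integrableM_bounded (M := K)) => //; exact: measurable_funB.
Qed.

End density.
End alberti_density.

(** * Weak* convergence of the inner and outer integrals *)

Section weak_continuity_fragment.
Context {R : realType} {X : completeMetricType R}.
Notation leb := (@lebesgue_measure R).

(** Near a point of [K] where the values are close, equicontinuity keeps them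
    close; compactness makes this uniform. *)
Lemma compact_equilipschitz_cvg (K : set R) (phi_ : nat -> R -> R) (phi : R -> R) (L : R) :
  compact K -> 0 <= L ->
  (forall n s t, K s -> K t -> `|phi_ n s - phi_ n t| <= L * `|s - t|) ->
  (forall s t, K s -> K t -> `|phi s - phi t| <= L * `|s - t|) ->
  (forall t, K t -> phi_ n t @[n --> \oo] --> phi t) ->
  forall e, 0 < e -> \forall n \near \oo, forall t, K t -> `|phi_ n t - phi t| <= e.
Proof.
move=> cK L0 phi_L phiL phi_phi e e0.
have := @compact_near_coveringP R K => -[/(_ cK) cov _].
have h := cov nat (\oo) (fun n t => K t -> `|phi_ n t - phi t| <= e) _ _.
suff : \forall n \near \oo, K `<=` [set t | K t -> `|phi_ n t - phi t| <= e].
  by apply: filterS => n hn t Kt; exact: hn.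
apply: h => t Kt.
have L1 : 0 < 3 * (L + 1) by rewrite mulr_gt0// ltr_wpDl.
pose r := e / (3 * (L + 1)); have r0 : 0 < r by rewrite divr_gt0.
have e3 : 0 < e / 3 by rewrite divr_gt0.
have /cvgrPdist_le/(_ _ e3) cv := phi_phi t Kt.
exists (ball t r, [set n | `|phi t - phi_ n t| <= e / 3]) => /=.
  by split=> //; exact: nbhsx_ballx.
move=> [s n] /= [st hn] Ks.
have Lr : L * `|t - s| <= e / 3.
  have -> : e / 3 = (L + 1) * r.
    by rewrite /r invfM mulrCA mulrA; field; rewrite gt_eqF// ltr_wpDl.
  by apply: ler_pM => //; [rewrite lerDl|exact: ltW].
have -> : phi_ n s - phi s = (phi_ n s - phi_ n t) + (phi_ n t - phi t) + (phi t - phi s) by ring.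
rewrite (le_trans (ler_normD _ _))// [leRHS](_ : e = e / 3 + e / 3 + e / 3); last by field.
apply: lerD; last exact: (le_trans (phiL _ _ Kt Ks)).
rewrite (le_trans (ler_normD _ _))// lerD//; last by rewrite distrC.
by rewrite (le_trans (phi_L _ _ _ Ks Kt))// distrC.
Qed.

Variables (A : alberti_pair X) (y : fragment X).
Hypothesis ac : alb_nu A y `<< (fun E : set (borel X) => hausdorff1 (E `&` frag_im y)).

(** The push-forward of [nu_y] to the line has a density with respect to
    Lebesgue measure; [u] is its product with [g \o y]. The function [h] may be any
    function which agrees almost everywhere with the derivative on the domain,
    in particular the derivative of an extension of [f \o y]. *)
Lemma frag_density (g : borel X -> R) (M : R) : measurable_fun setT g ->
  (forall x, `|g x| <= M) ->
  exists u : R -> R, leb.-integrable setT (EFin \o u) /\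
    forall (f : LipB X) (h : R -> R) (L : R), measurable_fun [set: measurableTypeR R] h ->
      (forall t, `|h t| <= L) ->
      {ae leb, forall t, fdom y t -> frag_derive f y t = h t} ->
      (im_integral A f g y = (\int[leb]_t (u t * h t))%:E)%E.
Proof.
move=> mg gM; have M0 : 0 <= M by exact: le_trans (normr_ge0 _) (gM point).
pose rn := Radon_Nikodym (charge_of_finite_measure (frag_push A y)) leb.
have dom : charge_of_finite_measure (frag_push A y) `<< leb by exact: push_dominated.
have irn : leb.-integrable setT rn by exact: Radon_Nikodym_integrable.
have rnE t : ((fine (rn t))%:E = rn t)%E by rewrite fineK// Radon_Nikodym_fin_num.
have malong := along_measurable y mg.
have ird : leb.-integrable setT (EFin \o (fun t => fine (rn t))).
  by apply: eq_integrable irn => // t _; rewrite /= rnE.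
pose u t := fine (rn t) * along g y t.
have iu : leb.-integrable setT (EFin \o u).
  by apply: (integrableM_bounded (M := M)) => // t _; exact: along_bound.
exists u; split => // f h L mh hL fh.
have [L1 L10 fL1] := along_lip_exists y f.
have [L2 L20 [mp pL]] := frag_partial_bounded y f.
have mder := (frag_derive_measurable fL1 L10).
pose w t := frag_derive f y t * along g y t.
have mw : measurable_fun [set: measurableTypeR R] w by exact: measurable_funM.
have wM t : `|w t| <= L1 * M.
  by rewrite normrM ler_pM//; [exact: frag_derive_le|exact: along_bound].
have -> : (im_integral A f g y = \int[frag_push A y]_t (w t)%:E)%E.
  apply: (push_integral ac mw wM).
  - by move=> t nt; rewrite /w along_off// mulr0.
  - exact: measurable_funM.
  - move=> x ix; have [yt tx] := frag_im_inv ix.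
    by rewrite frag_partialE// /w alongE// tx mulrC.
rewrite -(Radon_Nikodym_change_of_variables dom)//; last exact: (bounded_integrable (frag_push A y) mw wM).
have iuh : leb.-integrable setT (EFin \o (fun t => u t * h t)).
  by apply: (integrableM_bounded (M := L)).
rewrite /Rintegral fineK; last exact: integrable_fin_num.
apply: ae_eq_integral => //.
- apply: emeasurable_funM; first exact/measurable_EFinP.
  exact: measurable_int irn.
- by case/integrableP : iuh.
apply: (@filterS _ _ (ae_filter_ringOfSetsType leb) _ _ _ fh) => t th _.
rewrite /= -/rn -rnE -EFinM; congr (_%:E); rewrite /u /w.
have [yt|nt] := pselect (fdom y t); first by rewrite th//; ring.
by rewrite along_off//; ring.
Qed.

(** On the compact domain the equi-Lipschitz functions [F n \o y] converge
    uniformly, so their McShane extensions with a common constant converge too,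
    and their derivatives converge weakly on the line ([lipschitz_weak]). *)
Lemma im_integral_wcvg (F : nat -> LipB X) (f : LipB X) (g : borel X -> R) (M : R) :
  lipb_wcvg F f -> measurable_fun setT g -> (forall x, `|g x| <= M) ->
  im_integral A (F n) g y @[n --> \oo] --> im_integral A f g y.
Proof.
move=> [Ff [N FN]] mg gM.
have [u [iu uE]] := frag_density mg gM.
have [l l0 yl] := frag_lip_exists y.
have lf0 := lip_const_ge0 f; have sf0 := sup_norm_ge0 f.
have N0 : 0 <= N by exact: le_trans (lipb_norm_ge0 _) (FN 0%N).
pose L := (N + lip_const f) * l; pose B := N + sup_norm f.
have L0 : 0 <= L by rewrite mulr_ge0// addr_ge0.
have liple (k : LipB X) : lip_const k <= N + lip_const f ->
    forall s t, fdom y s -> fdom y t ->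
      `|along k y s - along k y t| <= L * `|s - t|.
  move=> kN s t ys yt; rewrite (le_trans (frag_lip_along k yl ys yt))//.
  by rewrite ler_wpM2r// ler_wpM2r.
have FL n : forall s t, fdom y s -> fdom y t ->
    `|along (F n) y s - along (F n) y t| <= L * `|s - t|.
  by apply: liple; rewrite (le_trans (lip_const_le_norm _))// (le_trans (FN n))// lerDl.
have fL : forall s t, fdom y s -> fdom y t ->
    `|along f y s - along f y t| <= L * `|s - t|.
  by apply: liple; rewrite lerDr.
have FB n s : fdom y s -> `|along (F n) y s| <= B.
  move=> ys; rewrite alongE// (le_trans (sup_normP _ _))//.
  apply: (@le_trans _ _ N); last by rewrite lerDl.
  by apply: le_trans (FN n); rewrite /lipb_norm le_max lexx.
have fB s : fdom y s -> `|along f y s| <= B.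
  by move=> ys; rewrite alongE// (le_trans (sup_normP _ _))// lerDr.
have K0 := fdom_neq0 y.
pose G k := mcshane (fdom y) (along k y) L.
have GL n := mcshane_lipschitz K0 (FB n) L0.
have gL := mcshane_lipschitz K0 fB L0.
have GE n s : fdom y s -> G (F n) s = along (F n) y s.
  exact: (mcshane_ext K0 (FB n) L0 (FL n)).
have gE s : fdom y s -> G f s = along f y s by exact: (mcshane_ext K0 fB L0 fL).
have [h_ hP] := choice (fun n => lipschitz_ae_slope (GL n)).
have [h [mh hL hE hsl]] := lipschitz_ae_slope gL.
have dE (k : LipB X) (v : R -> R) : (forall s, fdom y s -> G k s = along k y s) ->
    {ae leb, forall t, has_slope (G k) t (v t)} ->
    {ae leb, forall t, fdom y t -> frag_derive k y t = v t}.
  move=> kE ksl.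
  apply: (@filterS _ _ (ae_filter_ringOfSetsType leb) _ _ _ (frag_ae_derivable kE ksl)).
  by move=> t dt yt; exact: (dt yt).2.
have -> : (fun n => im_integral A (F n) g y) = (fun n => (\int[leb]_t (u t * h_ n t))%:E).
  apply/funext => n; have [mhn hnL hnE hnsl] := hP n.
  exact: (uE (F n) (h_ n) L mhn hnL (dE _ _ (GE n) hnsl)).
rewrite (uE f h L mh hL (dE _ _ gE hsl)).
apply: cvg_EFin; first exact: nearW.
apply: (@lipschitz_weak R L (fun n => G (F n)) (G f)) => //.
- by move=> n; have [] := hP n.
- by move=> n; have [] := hP n.
- by move=> n; have [] := hP n.
move=> t; apply/cvgrPdist_le => e e0.
have cv s : fdom y s -> along (F n) y s @[n --> \oo] --> along f y s.
  move=> ys; rewrite alongE//; under eq_fun do rewrite alongE//.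
  exact: Ff.
have := compact_equilipschitz_cvg (@fdom_compact R X y) L0 FL fL cv e0.
apply: filterS => n hn; rewrite distrC.
exact: mcshane_close (FB n) fB L0 hn.
Qed.

End weak_continuity_fragment.

Section weak_continuity.
Context {R : realType} {X : completeMetricType R}.
Variables (mu : {measure set (borel X) -> \bar R}) (sf : sigma_finite setT mu).
Variables (A : alberti_pair X) (hA : is_alberti mu A) (C : R) (AC : alberti_lip C A).
Notation P := (alb_P A).

(** Dominated convergence: for almost every [y] the inner integrals are at most
    [N * C] times the integral of [|g|] against [nu_y], and this bound integrates
    to [N * C] times the integral of [|g|] against [mu]. *)
Lemma outer_wcvg (F : nat -> LipB X) (f : LipB X) (g : borel X -> R) (M : R) :
  lipb_wcvg F f -> measurable_fun setT g -> (forall x, `|g x| <= M) ->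
  mu.-integrable setT (EFin \o g) ->
  (\int[P]_y im_integral A (F n) g y)%E @[n --> \oo] -->
  (\int[P]_y im_integral A f g y)%E.
Proof.
move=> Ff mg gM ig; have [_ [N FN]] := Ff.
have C0 := lip_ge0 AC.
have iI (k : LipB X) : P.-integrable setT (im_integral A k g).
  have [q [_ _ h]] := alberti_density sf hA AC k.
  by have [] := h g M mg gM ig.
have N0 : 0 <= N by exact: le_trans (lipb_norm_ge0 _) (FN 0%N).
pose g2 := (fun x : borel X => `|g x|).
have mg2 : measurable_fun [set: borel X] g2 by exact: measurableT_comp.
have [mPsi EPsi] := alberti_ge0_integral hA mg2 (fun x => normr_ge0 _).
set Psi := (fun y => _) in mPsi.
have ig2 : mu.-integrable setT (EFin \o g2) by exact: integrable_norm.
have iPsi : P.-integrable setT Psi.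
  apply/integrableP; split => //.
  have Psi0 y : (0 <= Psi y)%E by apply: integral_ge0 => x _; rewrite lee_fin /g2.
  under eq_integral => y _ do rewrite (gee0_abs (Psi0 y)).
  by rewrite -EPsi; have := integral_fune_lt_pinfty measurableT ig2.
have [] // := @dominated_convergence _ _ R P setT measurableT
  (fun n => im_integral A (F n) g) (im_integral A f g) (fun y => (N * C)%:E * Psi y)%E.
- by move=> n; exact: measurable_int (iI _).
- exact: measurable_int (iI _).
- by apply: nearW => y _; have h := im_integral_wcvg (@alb_ac _ _ _ _ hA y) Ff mg gM; exact: h.
- exact: integrableZl.
- apply: (@filterS _ _ (ae_filter_ringOfSetsType P) _ _ _ (ae_lip AC)) => y yC n _.
  have [L L0 [mp pL]] := frag_partial_bounded y (F n).
  have i2 : (alb_nu A y).-integrable setT (EFin \o g2).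
    by apply: (@bounded_integrable _ _ _ _ _ M) => // x; rewrite /g2 normr_id.
  rewrite /im_integral (le_trans (le_abse_integral _ _ _))//.
    by apply/measurable_EFinP; exact: measurable_funM.
  rewrite -integralZl//.
  apply: ge0_le_integral => //.
  + apply: measurableT_comp => //; apply/measurable_EFinP; exact: measurable_funM.
  + by apply: measurable_funeM; exact/measurable_EFinP.
  move=> x _; rewrite -EFinM lee_fin normrM mulrC ler_wpM2r//.
  rewrite (le_trans (frag_partial_le _ C0 yC x))// ler_wpM2r//.
  by rewrite (le_trans (lip_const_le_norm _)).
Qed.

End weak_continuity.

(** * The derivation of an Alberti representation *)

Section alberti_derivation.
Context {R : realType} {X : completeMetricType R}.
Variables (mu : {measure set (borel X) -> \bar R}) (sf : sigma_finite setT mu).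
Variables (A : alberti_pair X) (hA : is_alberti mu A) (C : R) (AC : alberti_lip C A).
Notation P := (alb_P A).

(** The densities [dens f] are genuine functions, bounded everywhere, and the
    classes [derf f] agree with them almost everywhere; computations are made on
    the former. *)
Section representatives.
Variables (dens : LipB X -> borel X -> R) (derf : LipB X -> Linf mu).
Hypotheses (mdens : forall f, measurable_fun setT (dens f))
  (densK : forall f x, `|dens f x| <= lip_const f * C)
  (densE : forall (f : LipB X) (g : borel X -> R) (M : R), measurable_fun setT g ->
    (forall x, `|g x| <= M) -> mu.-integrable setT (EFin \o g) ->
    P.-integrable setT (im_integral A f g) /\
    (\int[mu]_x (g x * dens f x)%:E = \int[P]_y im_integral A f g y)%E)
  (derfE : forall f, {ae mu, forall x, derf f x = dens f x}).

Let mind (E : set (borel X)) : measurable E ->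
  measurable_fun [set: borel X] (\1_E : borel X -> R).
Proof. by move=> mE; exact: measurable_indic. Qed.

Let derf_integral (f : LipB X) (h : borel X -> R) : mu.-integrable setT (EFin \o h) ->
  [/\ mu.-integrable setT (EFin \o (fun x => h x * dens f x)),
      mu.-integrable setT (fun x => (h x * derf f x)%:E) &
      (\int[mu]_x (h x * derf f x)%:E = \int[mu]_x (h x * dens f x)%:E)%E].
Proof.
move=> ih; have mh : measurable_fun setT h.
  by apply/measurable_EFinP; exact: measurable_int ih.
have ihd : mu.-integrable setT (EFin \o (fun x => h x * dens f x)).
  exact: (integrableM_bounded (M := lip_const f * C)).
have md : measurable_fun setT (fun x => (h x * derf f x)%:E).
  apply/measurable_EFinP; apply: measurable_funM => //; exact: Linf_measurable.
have hae : ae_eq mu setT (EFin \o (fun x => h x * dens f x))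
    (fun x => (h x * derf f x)%:E).
  apply: (@filterS _ _ (ae_filter_ringOfSetsType mu) _ _ _ (derfE f)) => x dx _ /=.
  by rewrite dx.
split => //; first exact: integrable_ae_eq md hae ihd.
by symmetry; apply: ae_eq_integral => //; exact: measurable_int ihd.
Qed.

Let derf_formula : alberti_der A derf.
Proof.
move=> f g mg [M gM] ig; have [i1 i2 e] := derf_integral f ig.
have [iP eP] := densE f mg gM ig.
have dE : dom_integral A f g = im_integral A f g.
  by apply/funext => y; exact: (dom_integralE (@alb_ac _ _ _ _ hA y) f mg gM).
split => //.
- by move=> y; exact: dom_integrable mg gM.
- by move=> y; exact: frag_partial_integrable mg gM.
- by rewrite dE.
- by rewrite dE e.
- by rewrite dE.
Qed.

Let dens_unique (f : LipB X) (v : borel X -> R) : measurable_fun setT v ->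
  (forall E, measurable E -> (mu E < +oo)%E ->
    (\int[mu]_(x in E) (v x)%:E = \int[P]_y im_integral A f \1_E y)%E) ->
  {ae mu, forall x, dens f x = v x}.
Proof.
move=> mv vE; apply: sigma_finite_ae_eq => // E mE Efin.
have iE := indic_integrable mE Efin.
split; last first.
  rewrite vE// integral_indicM.
  by have [] := @densE f \1_E 1 (mind mE) (indic_le1 R E) iE.
apply: (eq_integrable _ (EFin \o (fun x => \1_E x * dens f x))) => //.
  by move=> x xE /=; rewrite indicE xE mul1r.
by have [ii _ _] := derf_integral f iE; exact: (integrableS measurableT mE _ ii).
Qed.

(** A linear relation between derivatives along the fragments, with
    coefficients that are bounded functions on the space, holds for the
    densities: test it on [E] and apply the formula with the test functions [\1_E * v]
    and [\1_E * w]. Linearity and the Leibniz rule are both of this form. *)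
Let derf_combine (k f g : LipB X) (v w : borel X -> R) (M N : R) :
  measurable_fun setT v -> (forall x, `|v x| <= M) ->
  measurable_fun setT w -> (forall x, `|w x| <= N) ->
  (forall y, {ae alb_nu A y, forall x,
    frag_partial k y x = v x * frag_partial f y x + w x * frag_partial g y x}) ->
  {ae mu, forall x, derf k x = v x * derf f x + w x * derf g x}.
Proof.
move=> mv vM mw wN kfg.
suff h : {ae mu, forall x, dens k x = v x * dens f x + w x * dens g x}.
  have h3 : {ae mu, forall x, derf f x = dens f x /\ derf g x = dens g x}.
    by apply: (@filterS2 _ _ (ae_filter_ringOfSetsType mu) _ _ _ _ (derfE f) (derfE g)).
  apply: (@filterS3 _ _ (ae_filter_ringOfSetsType mu) _ _ _ _ _ (derfE k) h h3).
  by move=> x -> -> [-> ->].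
apply: dens_unique.
  by apply: measurable_funD; apply: measurable_funM.
move=> E mE Efin; have iE := indic_integrable mE Efin.
have part (u : borel X -> R) (L : R) (j : LipB X) : measurable_fun setT u ->
    (forall x, `|u x| <= L) ->
    let eu x := \1_E x * u x in
    [/\ measurable_fun setT eu, (forall x, `|eu x| <= L),
      mu.-integrable setT (EFin \o (fun x => eu x * dens j x)),
      P.-integrable setT (im_integral A j eu) &
      (\int[mu]_x (eu x * dens j x)%:E = \int[P]_y im_integral A j eu y)%E].
  move=> mu_ uL eu.
  have meu : measurable_fun setT eu by exact: measurable_funM.
  have euL x : `|eu x| <= L.
    by rewrite /eu normrM -[L]mul1r; apply: ler_pM => //; exact: indic_le1.
  have ieu : mu.-integrable setT (EFin \o eu).
    exact: (integrableM_bounded (M := L)).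
  have [i e] := densE j meu euL ieu; split => //.
  by have [] := derf_integral j ieu.
have [mev evM iv ivP ev] := part v M f mv vM.
have [mew ewN iw iwP ew] := part w N g mw wN.
pose ev_ x := \1_E x * v x; pose ew_ x := \1_E x * w x.
have -> : (\int[mu]_(x in E) (v x * dens f x + w x * dens g x)%:E =
    \int[P]_y im_integral A f ev_ y + \int[P]_y im_integral A g ew_ y)%E.
  rewrite -ev -ew -(integralD_EFin measurableT iv iw) integral_indicM.
  by apply: eq_integral => x _; rewrite /= -EFinD mulrDr !mulrA.
rewrite -(integralD measurableT ivP iwP).
apply: eq_integral => y _; rewrite /im_integral.
rewrite -(integralD_EFin measurableT (frag_partial_integrable A y f mev evM)
  (frag_partial_integrable A y g mew ewN)).
have [L1 L10 [mp1 pL1]] := frag_partial_bounded y f.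
have [L2 L20 [mp2 pL2]] := frag_partial_bounded y g.
have [L3 L30 [mp3 pL3]] := frag_partial_bounded y k.
apply: ae_eq_integral => //.
- by apply: emeasurable_funD; apply/measurable_EFinP; exact: measurable_funM.
- by apply/measurable_EFinP; exact: measurable_funM.
apply: (@filterS _ _ (ae_filter_ringOfSetsType (alb_nu A y)) _ _ _ (kfg y)) => x kx _.
by rewrite /= kx -EFinD mulrDr !mulrA.
Qed.

Let derf_linear (a : R) (f g : LipB X) :
  {ae mu, forall x, derf (a *: f + g) x = a * derf f x + derf g x}.
Proof.
have := @derf_combine (a *: f + g) f g (cst a) (cst 1) `|a| 1.
move=> h; have h2 : {ae mu, forall x, derf (a *: f + g) x =
    cst a x * derf f x + cst 1 x * derf g x}.
  apply: h => //; first by move=> x; rewrite /= normr1.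
  move=> y; have := frag_partialD (@alb_ac _ _ _ _ hA y) a f g.
  by apply: (@filterS _ _ (ae_filter_ringOfSetsType (alb_nu A y))) => x ->; rewrite /= mul1r.
by apply: (@filterS _ _ (ae_filter_ringOfSetsType mu) _ _ _ h2) => x ->; rewrite /= mul1r.
Qed.

Let derf_leibniz (f g : LipB X) :
  {ae mu, forall x, derf (f * g) x = f x * derf g x + g x * derf f x}.
Proof.
apply: (derf_combine (lipb_measurable f) (sup_normP f) (lipb_measurable g) (sup_normP g)).
by move=> y; exact: frag_partialM (@alb_ac _ _ _ _ hA y) f g.
Qed.

Let C0 : 0 <= C := lip_ge0 AC.

Let derf_norm (f : LipB X) : (Linf_norm (derf f) <= (lip_const f * C)%:E)%E.
Proof.
apply: Linf_norm_le; first by rewrite mulr_ge0//; exact: lip_const_ge0 f.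
by apply: (@filterS _ _ (ae_filter_ringOfSetsType mu) _ _ _ (derfE f)) => x ->.
Qed.

Let derf_wcontinuous (F : nat -> LipB X) (f : LipB X) : lipb_wcvg F f ->
  forall h : borel X -> R, mu.-integrable setT (EFin \o h) ->
    (\int[mu]_x (h x * derf (F n) x)%:E)%E @[n --> \oo] -->
    (\int[mu]_x (h x * derf f x)%:E)%E.
Proof.
move=> Ff h ih; have [_ [N FN]] := Ff.
have lf0 := lip_const_ge0 f.
have N0 : 0 <= N by exact: le_trans (lipb_norm_ge0 _) (FN 0%N).
pose M := (N + lip_const f) * C.
have dM (k : LipB X) : lip_const k <= N + lip_const f -> forall x, `|dens k x| <= M.
  by move=> kN x; rewrite (le_trans (densK k x))// ler_wpM2r.
have FM n x : `|dens (F n) x| <= M.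
  by apply: dM; rewrite (le_trans (lip_const_le_norm _))// (le_trans (FN n))// lerDl.
have fM x : `|dens f x| <= M by apply: dM; rewrite lerDr.
have tests E : measurable E -> (mu E < +oo)%E ->
    weak_test mu (fun n => dens (F n)) (dens f) \1_E.
  move=> mE Efin; have iE := indic_integrable mE Efin; split => //.
  have := outer_wcvg sf hA AC Ff (mind mE) (indic_le1 R E) iE.
  have e k := (@densE k \1_E 1 (mind mE) (indic_le1 R E) iE).2.
  under eq_fun do rewrite -e.
  rewrite -e.
  have [iEf _ _] := derf_integral f iE.
  rewrite -[X in _ --> X]fineK; last exact: (integrable_fin_num measurableT iEf).
  by move/fine_cvgP => [_].
have [_ t] := weak_test_indic (fun n => mdens (F n)) (mdens f) FM fM tests ih.
have rE k : (\int[mu]_x (h x * derf k x)%:E = (\int[mu]_x (h x * dens k x))%:E)%E.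
  have [i1 i2 ->] := derf_integral k ih.
  by rewrite /Rintegral fineK//; exact: (integrable_fin_num measurableT i1).
under eq_fun do rewrite rE.
rewrite rE; apply: cvg_EFin; last exact: t.
exact: nearW.
Qed.

Let derf_is_derivation : is_derivation derf.
Proof.
split; [exact: derf_linear| |exact: derf_leibniz|exact: derf_wcontinuous].
exists C => f; apply: (le_trans (derf_norm f)).
by rewrite lee_fin mulrC ler_wpM2l// lip_const_le_norm.
Qed.

Lemma derivation_of_representatives : exists D : derivation mu,
  alberti_der A D /\ (der_norm D <= C%:E)%E.
Proof.
exists (Derivation derf_is_derivation); split; first exact: derf_formula.
apply: ge_ereal_sup => _ [f /= f1 <-]; apply: (le_trans (derf_norm f)).
rewrite lee_fin ler_piMl// (le_trans _ f1)//; exact: lip_const_le_norm.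
Qed.

End representatives.

Lemma alberti_derivation : exists D : derivation mu,
  alberti_der A D /\ (der_norm D <= C%:E)%E.
Proof.
have [dens densP] := choice (alberti_density sf hA AC).
have mdens f : measurable_fun setT (dens f) by have [] := densP f.
have densK f x : `|dens f x| <= lip_const f * C by have [_ + _] := densP f; apply.
have K0 (f : LipB X) : 0 <= lip_const f * C.
  by rewrite mulr_ge0//; [exact: lip_const_ge0 f|exact: lip_ge0 AC].
have [derf derfE] := choice (fun f => Linf_exists (K0 f) (mdens f) (aeW mu (densK f))).
apply: (derivation_of_representatives mdens densK _ derfE) => f.
by have [] := densP f.
Qed.

End alberti_derivation.

(** * Radon measures on separable spaces are sigma-finite *)

Section radon_sigma_finite.
Context {R : realType} {X : completeMetricType R}.

Lemma metric_ball_open (x : X) (r : R) : open (ball x r).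
Proof.
rewrite openE => z; rewrite ballEmdist /= => xz; apply/nbhs_ballP.
exists (r - mdist x z); first by rewrite /= subr_gt0.
move=> w; rewrite !ballEmdist /= ltrBrDl; apply: le_lt_trans.
exact: metric_triangle.
Qed.

(** Every point has a neighbourhood of finite measure, hence lies in a ball of
    finite measure with centre in the countable dense set and radius of the form
    [1 / n.+1]. *)
Lemma radon_sigma_finite (mu : {measure set (borel X) -> \bar R}) :
  separable X -> radon mu -> sigma_finite setT mu.
Proof.
move=> [D cD dD] [lf _].
have [a0 [Da0 _]] : D `&` [set: X] !=set0.
  by rewrite setIC; apply: dD; [exists point|exact: openT].
have /pfcard_geP[D0|[g]] := cD; first by rewrite D0 in Da0.
pose b (p : nat * nat) : set X := ball (g p.1) p.2.+1%:R^-1.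
have mb p : measurable (b p : set (borel X)).
  by apply: sub_sigma_algebra; exact: metric_ball_open.
pose F k : set (borel X) := if unpickle k is Some p then
  if `[< mu (b p : set (borel X)) < +oo >]%E then b p else set0 else set0.
exists F; last first.
  move=> k; rewrite /F; case: unpickle => [p|]; last by rewrite measure0.
  by case: asboolP => // _; rewrite measure0.
apply/esym; rewrite -subTset => x _.
have [U [oU Ux] Ufin] := lf x.
have /nbhs_ballP[e /= e0 eU] := open_nbhs_nbhs (conj oU Ux).
pose n := Num.trunc (2 / e).
have ne : (n.+1%:R^-1 : R) < e / 2.
  by rewrite -[e / 2]invrK ltf_pV2 ?posrE ?invr_gt0 ?divr_gt0// invf_div truncnS_gt.
have n0 : 0 < (n.+1%:R^-1 : R) by rewrite invr_gt0.
have [a [xa Da]] : ball x n.+1%:R^-1 `&` D !=set0.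
  apply: dD; last exact: metric_ball_open.
  by exists x; exact: ballxx.
have [i _ gi] : (g @` [set: nat]) a by exact: surj.
exists (pickle (i, n)) => //; rewrite /F pickleK.
have bU : b (i, n) `<=` U.
  move=> z; rewrite /b /= gi => az; apply: eU.
  have -> : e = e / 2 + e / 2 by rewrite -splitr.
  apply: (@ball_triangle _ _ a); first exact: le_ball (ltW ne) _ xa.
  exact: le_ball (ltW ne) _ az.
case: asboolP => [_|nfin]; first by rewrite /b /= gi; exact: ball_sym.
exfalso; apply: nfin; apply: le_lt_trans Ufin.
by apply: le_measure => //; rewrite inE//; exact: sub_sigma_algebra.
Qed.

End radon_sigma_finite.

(** * Extension by zero and uniqueness *)

Section zero_extension.
Context {R : realType} {X : completeMetricType R}.
Variables (mu : {measure set (borel X) -> \bar R}) (S : set (borel X)) (mS : measurable S).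
Notation muS := (mrestr mu mS).
Variable D : derivation muS.

(** The norm of L^oo has the value [0] when the measure of the whole space is
    zero, but then every statement holds almost everywhere. *)
Lemma der_ae_bounded : exists2 M : R, 0 <= M &
  forall f, {ae muS, forall x, `|D f x| <= M * lipb_norm f}.
Proof.
have [M DM] := der_bounded (derP D).
exists `|M| => // f; have n0 : 0 <= lipb_norm f.
  by exact: lipb_norm_ge0.
have MM : M * lipb_norm f <= `|M| * lipb_norm f by rewrite ler_wpM2r// ler_norm.
have := DM f; rewrite /Linf_norm unlock /Lnorm; case: ifPn => [_ /ess_sup_inf.ess_supP h|].
  apply: (@filterS _ _ (ae_filter_ringOfSetsType muS) _ _ _ h) => x.
  by rewrite /= lee_fin => /le_trans; apply.
rewrite lt0e measure_ge0 andbT negbK => /eqP muS0 _.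
by exists setT; split => //; exact: measurableT.
Qed.

(** Everything that holds almost everywhere for the restriction to [S] holds
    almost everywhere on [S], and off [S] all the identities read [0 = 0]. *)
Lemma zero_extension_exists : exists E : derivation mu, zero_extension D E.
Proof.
have [M M0 DM] := der_ae_bounded.
have n0 (f : LipB X) : 0 <= M * lipb_norm f.
  by rewrite mulr_ge0// lipb_norm_ge0.
have mD f : measurable_fun [set: borel X] (D f : borel X -> R) by exact: Linf_measurable.
have mSD f : measurable_fun [set: borel X] (fun x => \1_S x * D f x).
  by apply: measurable_funM.
have SDM f : {ae mu, forall x, `|\1_S x * D f x| <= M * lipb_norm f}.
  apply: (@filterS _ _ (ae_filter_ringOfSetsType mu) _ _ _ (ae_mrestr (DM f))) => x h.
  rewrite indicE; case: (boolP (x \in S)) => [/set_mem Sx|_]; first by rewrite mul1r h.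
  by rewrite mul0r normr0.
have [E EE] := choice (fun f => Linf_exists (n0 f) (mSD f) (SDM f)).
have isE : is_derivation E.
  split.
  - move=> a f g.
    have h := ae_mrestr (der_linear (derP D) a f g).
    have h2 : {ae mu, forall x, E f x = \1_S x * D f x /\ E g x = \1_S x * D g x}.
      by apply: (@filterS2 _ _ (ae_filter_ringOfSetsType mu) _ _ _ _ (EE f) (EE g)).
    apply: (@filterS3 _ _ (ae_filter_ringOfSetsType mu) _ _ _ _ _ (EE (a *: f + g)) h2 h).
    move=> x e1 [e2 e3] lx; rewrite e1 e2 e3 indicE.
    by case: (boolP (x \in S)) => [/set_mem/lx ->|_]; rewrite ?mul1r// !mul0r mulr0 addr0.
  - exists M => f; apply: Linf_norm_le => //.
    apply: (@filterS2 _ _ (ae_filter_ringOfSetsType mu) _ _ _ _ (EE f) (SDM f)).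
    by move=> x ->.
  - move=> f g.
    have h := ae_mrestr (der_leibniz (derP D) f g).
    have h2 : {ae mu, forall x, E f x = \1_S x * D f x /\ E g x = \1_S x * D g x}.
      by apply: (@filterS2 _ _ (ae_filter_ringOfSetsType mu) _ _ _ _ (EE f) (EE g)).
    apply: (@filterS3 _ _ (ae_filter_ringOfSetsType mu) _ _ _ _ _ (EE (f * g)) h2 h).
    move=> x e1 [e2 e3] lx; rewrite e1 e2 e3 indicE.
    by case: (boolP (x \in S)) => [/set_mem/lx ->|_]; rewrite ?mul1r// !mul0r !mulr0 addr0.
  - move=> F f Ff h ih.
    have mh : measurable_fun [set: borel X] h.
      by apply/measurable_EFinP; exact: measurable_int ih.
    have ihS : muS.-integrable setT (EFin \o h).
      apply/mrestr_integrable; first exact: measurable_int ih.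
      exact: integrableS ih.
    have rE k : (\int[mu]_x (h x * E k x)%:E = \int[muS]_x (h x * D k x)%:E)%E.
      rewrite mrestr_integral; last first.
        by apply/measurable_EFinP; exact: measurable_funM.
      rewrite integral_mkcond; apply: ae_eq_integral => //.
      + apply/measurable_EFinP; apply: measurable_funM => //; exact: Linf_measurable.
      + apply/(measurable_restrictT _ mS); apply: measurable_funTS.
        by apply/measurable_EFinP; exact: measurable_funM.
      apply: (@filterS _ _ (ae_filter_ringOfSetsType mu) _ _ _ (EE k)) => x -> _.
      by rewrite patchE indicE; case: (x \in S); rewrite ?mul1r// mul0r mulr0.
    under eq_fun do rewrite rE.
    rewrite rE; exact: (der_wcontinuous (derP D) Ff ihS).
exists (Derivation isE) => f; exact: EE.
Qed.

End zero_extension.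

Section uniqueness.
Context {R : realType} {X : completeMetricType R}.
Variables (mu : {measure set (borel X) -> \bar R}) (A : alberti_pair X).

Lemma alberti_der_test (D : LipB X -> Linf mu) (f : LipB X) (E : set (borel X)) :
  alberti_der A D -> measurable E -> (mu E < +oo)%E ->
  mu.-integrable setT (fun x => (\1_E x * D f x)%:E) /\
  (\int[mu]_x (\1_E x * D f x)%:E = \int[alb_P A]_y im_integral A f \1_E y)%E.
Proof.
move=> AD mE Efin.
have mi : measurable_fun [set: borel X] (\1_E : borel X -> R) by exact: measurable_indic.
have iE := indic_integrable mE Efin.
have [i1 _ _ _ _ e1 e2] := AD f \1_E mi (ex_intro _ 1 (indic_le1 R E)) iE.
by split => //; rewrite e1 e2.
Qed.

Lemma alberti_der_unique (D1 D2 : LipB X -> Linf mu) : sigma_finite setT mu ->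
  alberti_der A D1 -> alberti_der A D2 -> D1 = D2.
Proof.
move=> sf AD1 AD2; apply/funext => f; apply: Linf_eq.
apply: sigma_finite_ae_eq => //; [exact: Linf_measurable|exact: Linf_measurable|].
move=> E mE Efin.
have [i1 e1] := alberti_der_test f AD1 mE Efin.
have [i2 e2] := alberti_der_test f AD2 mE Efin.
split; last by rewrite [LHS]integral_indicM [RHS]integral_indicM e1 e2.
apply: (eq_integrable _ (fun x => (\1_E x * D1 f x)%:E)) => //.
  by move=> x xE /=; rewrite indicE xE mul1r.
exact: (integrableS measurableT mE _ i1).
Qed.

End uniqueness.

Section subrepresentations.
Context {R : realType} {X : completeMetricType R}.
Variables (mu : {measure set (borel X) -> \bar R}) (sf : sigma_finite setT mu).
Variable A : alberti_pair X.

(** The right-hand side does not involve [S]: this is why the extension by zero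
    depends only on the pair [A]. *)
Let restr_test (S : set (borel X)) (mS : measurable S)
    (D : LipB X -> Linf (mrestr mu mS)) (f : LipB X) (E : set (borel X)) :
  alberti_der A D -> measurable E -> (mu E < +oo)%E ->
  mu.-integrable E (EFin \o (fun x => \1_S x * D f x)) /\
  (\int[mu]_(x in E) (\1_S x * D f x)%:E =
   \int[alb_P A]_y im_integral A f \1_E y)%E.
Proof.
move=> AD mE Efin.
have ESfin : (mrestr mu mS E < +oo)%E.
  by rewrite (le_lt_trans _ Efin)// /mrestr le_measure ?inE//; exact: measurableI.
have [i e] := alberti_der_test f AD mE ESfin.
have mED := measurable_int _ i.
have := i; rewrite (mrestr_integrable mu mS mED) integrable_mkcond// => i'.
have EQ x : (\1_E x * (\1_S x * D f x))%:E =
    ((fun x => (\1_E x * D f x)%:E) \_ S) x.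
  by rewrite patchE [X in _ * (X * _)]indicE; case: (x \in S); rewrite ?mul1r// mul0r mulr0.
split.
  apply: (eq_integrable _ ((fun x => (\1_E x * D f x)%:E) \_ S)) => //.
    by move=> x xE; rewrite -EQ /= [X in X * _]indicE xE mul1r.
  exact: (integrableS measurableT mE _ i').
rewrite -e (mrestr_integral mu mS mED) integral_indicM [RHS]integral_mkcond.
by apply: eq_integral => x _; rewrite EQ.
Qed.

(** A pair may represent the restrictions of [mu] to different sets, but the
    derivations it gives have the same extension. *)
Lemma zero_extension_transfer (S S' : set (borel X)) (mS : measurable S) (mS' : measurable S')
    (D : derivation (mrestr mu mS)) (D' : derivation (mrestr mu mS')) (E : derivation mu) :
  alberti_der A D -> alberti_der A D' -> zero_extension D E -> zero_extension D' E.
Proof.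
move=> AD AD' DE f.
suff h : {ae mu, forall x, \1_S x * D f x = \1_S' x * D' f x}.
  apply: (@filterS2 _ _ (ae_filter_ringOfSetsType mu) _ _ _ _ (DE f) h).
  by move=> x ->.
apply: sigma_finite_ae_eq => //.
- by apply: measurable_funM => //; exact: Linf_measurable.
- by apply: measurable_funM => //; exact: Linf_measurable.
move=> B mB Bfin.
have [i1 e1] := restr_test f AD mB Bfin.
by have [_ e2] := restr_test f AD' mB Bfin; split => //; rewrite e1 e2.
Qed.

End subrepresentations.

Theorem theorem3p11 (R : realType) (X : completeMetricType R)
    (hX : separable X) (mu : {measure set (borel X) -> \bar R})
    (hmu : radon mu) :
  (forall (C : R) (A : alberti_pair X), is_alberti mu A -> alberti_lip C A ->
     exists D : derivation mu,
       [/\ alberti_der A D,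
           (forall D' : LipB X -> Linf mu, alberti_der A D' ->
              D' = der_fun D) &
           (der_norm D <= C%:E)%E]) /\
  (exists Der : Alb_sub mu -> derivation mu,
     forall (A : Alb_sub mu) (S : set (borel X)) (mS : measurable S),
       Alb (mrestr mu mS) (\val A) ->
       exists D : derivation (mrestr mu mS),
         alberti_der (\val A) D /\ zero_extension D (Der A)).
Proof.
have sf := radon_sigma_finite hX hmu.
split=> [C A hA AC|].
  have [D [AD DC]] := alberti_derivation sf hA AC.
  exists D; split => // D' AD'; exact: alberti_der_unique sf AD' AD.
have ex (A : Alb_sub mu) : exists E : derivation mu,
    forall (S : set (borel X)) (mS : measurable S), Alb (mrestr mu mS) (\val A) ->
    exists D : derivation (mrestr mu mS), alberti_der (\val A) D /\ zero_extension D E.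
  have [S0 [mS0 [hA0 [C0 AC0]]]] := set_valP A.
  have [D0 [AD0 _]] := alberti_derivation (sigma_finite_mrestr mS0 sf) hA0 AC0.
  have [E D0E] := zero_extension_exists D0.
  exists E => S mS [hA [C AC]].
  have [D [AD _]] := alberti_derivation (sigma_finite_mrestr mS sf) hA AC.
  by exists D; split => //; exact: (zero_extension_transfer sf AD0 AD D0E).
have [Der DerP] := choice ex.
by exists Der => A; exact: DerP.
Qed.
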